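(* Let $\Theta=\sum_{k=1}^\infty\theta_k\delta_{\psi_k}$ be a random measure on $\Psi$ and let $X$ be generated conditional on $\Theta$ according to an exponential CRM with fixed-location atoms at $\{\psi_k\}_{k=1}^\infty$ and no ordinary component: $X=\sum_{k=1}^\infty x_k\delta_{\psi_k}$, where, conditional on $\Theta$, the weights $x_k\in\{0,1,2,\dots\}$ are independent and $x_k$ has probability mass function $$h(x\mid\theta_k)=\kappa(x)\exp\{\langle\eta(\theta_k),\phi(x)\rangle-A(\theta_k)\}.$$ Then a conjugate prior for $\Theta$ is the following exponential CRM distribution, consisting of two independent parts. First, $\Theta$ has $K_{prior,fix}<\infty$ fixed-location atoms. The $k$th such atom has random weight $\theta_{fix,k}$ with proper density $$f_{prior,fix,k}(\theta)=\exp\{\langle\xi_{fix,k},\eta(\theta)\rangle+\lambda_{fix,k}[-A(\theta)]-B(\xi_{fix,k},\lambda_{fix,k})\},$$ where $(\eta',-A)'$ is the sufficient statistic, $B$ is the log partition function, and $\xi_{fix,k},\lambda_{fix,k}$ are fixed hyperparameters for this atom weight. Second, $\Theta$ has an ordinary component with rate measure $\nu(d\theta)\cdot G(d\psi)$, where $G$ is any proper (diffuse) distribution on $\Psi$ and the weight rate measure is $$\nu(d\theta)=\gamma\exp\{\langle\xi,\eta(\theta)\rangle+\lambda[-A(\theta)]\}\,d\theta,$$ with fixed hyperparameters $\gamma,\xi,\lambda$ chosen so that $\nu(\mathbb{R}_+)=\infty$ and $\sum_{x=1}^\infty\int_{\mathbb{R}_+}\nu(d\theta)\,h(x\mid\theta)<\infty$.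 That is, for a prior in this family, the distribution of $\Theta\mid X$ again belongs to this family (with possibly different fixed-location atoms and hyperparameters).
   Context: $\Psi$ is a measurable space whose $\sigma$-algebra contains all singletons; $\mathbb{R}_+$ denotes the non-negative reals (if the parameter $\theta$ of $h$ ranges only over a measurable subset of $\mathbb{R}_+$, all weights, densities and rate measures in $\theta$ are supported on, and all integrals are over, that subset); $d\theta$ is Lebesgue measure. A random measure $\Theta$ on $\Psi$ is completely random (a CRM) if $\Theta(A_1),\dots,\Theta(A_K)$ are independent for all disjoint measurable $A_1,\dots,A_K$. All CRMs here have no deterministic component, so they are independent sums of a fixed-location component $\sum_k\theta_{fix,k}\delta_{\psi_{fix,k}}$ (deterministic distinct locations, independent non-negative random weights) and an ordinary component $\sum_k\theta_{ord,k}\delta_{\psi_{ord,k}}$, where $\{(\theta_{ord,k},\psi_{ord,k})\}$ are the points of a Poisson point process on $\mathbb{R}_+\times\Psi$ with the given rate (mean) measure. $\Theta=\sum_k\theta_k\delta_{\psi_k}$ lists all fixed-location and ordinary atoms; $x_k=0$ means that $X$ has no atom at $\psi_k$. Exponential CRM: a CRM whose fixed-location atoms (finitely or infinitely many, at distinct locations) have weights with densities (with respect to Lebesgue or counting measure) $\kappa(\theta)\exp\{\langle\eta(\zeta_k),\phi(\theta)\rangle-A(\zeta_k)\}$, with base density $\kappa$, natural parameter function $\eta$, sufficient statistic $\phi$ and log partition function $A$ shared across atoms and an atom-specific parameter $\zeta_k$, and whose ordinary component has rate measure $\nu(d\theta)G(d\psi)$ with $G$ a proper distribution and $\nu(d\theta)=\gamma\exp\{\langle\eta(\zeta),\phi(\theta)\rangle\}d\theta$,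 sharing $\eta,\phi$ with the fixed atoms and having its own fixed hyperparameters $\gamma,\zeta$. Here $B(\xi,\lambda)=\log\int\exp\{\langle\xi,\eta(\theta)\rangle-\lambda A(\theta)\}\,d\theta$. A prior family for $\Theta$ is conjugate to the likelihood if the posterior distribution of $\Theta$ given $X$ belongs to the same family. *)

(* Defs.v *)
From HB Require Import structures.
From mathcomp Require Import all_boot all_order all_algebra.
From mathcomp Require Import all_classical all_reals all_analysis.
From mathcomp Require Import measurable_realfun.

Set Implicit Arguments.
Unset Strict Implicit.
Unset Printing Implicit Defensive.

Import Order.TTheory GRing.Theory Num.Theory.
Import numFieldNormedType.Exports.

Local Open Scope classical_set_scope.
Local Open Scope ring_scope.

Section atomic_measures.
Context d (Psi : measurableType d) (R : realType).
Local Open Scope ereal_scope.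

Definition sum_of_atoms (w : nat -> R) (q : nat -> Psi) (S : set Psi) : \bar R :=
  \sum_(k <oo) (w k)%:E * \d_(q k) S.

(* Countable sums of weighted point masses in which every single atom has
   finite mass. The total mass may be infinite, even on every set that is not
   negligible, since the sum of the weights of a Poisson process of atoms may
   diverge. *)
Record atomic_measure := AtomicMeasure {
  am_measure :> {measure set Psi -> \bar R} ;
  am_fin : forall p : Psi, am_measure [set p] < +oo ;
  am_atomic : exists (w : nat -> {nonneg R}) (q : nat -> Psi),
    forall S : set Psi, measurable S ->
      am_measure S = sum_of_atoms (fun k => (w k)%:num%R) q S }.

Definition zero_measure : {measure set Psi -> \bar R} := mzero.

Lemma zero_measure_fin (p : Psi) : zero_measure [set p] < +oo.
Proof. exact: ltry. Qed.

Lemma zero_measure_atomic : exists (w : nat -> {nonneg R}) (q : nat -> Psi),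
  forall S : set Psi, measurable S ->
    zero_measure S = sum_of_atoms (fun k => (w k)%:num%R) q S.
Proof.
exists (fun=> 0%:nng%R), (fun=> point) => S _.
by rewrite /sum_of_atoms eseries0// => k _ _; rewrite mul0e.
Qed.

HB.instance Definition _ := gen_eqMixin atomic_measure.
HB.instance Definition _ := gen_choiceMixin atomic_measure.
HB.instance Definition _ := isPointed.Build atomic_measure
  (AtomicMeasure zero_measure_fin zero_measure_atomic).

Definition atoms (m : atomic_measure) : set (measurableTypeR R * Psi) :=
  [set z | z.1 != 0%R /\ m [set z.2] = (z.1)%:E].

Definition atom_count (m : atomic_measure)
    (C : set (measurableTypeR R * Psi)) : \bar R :=
  counting (atoms m `&` C).

(* The sigma-algebra on atomic measures makes all the masses m S and all the
   counts of atoms (weight, location) in C random variables. The counts are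
   needed because the masses alone do not determine the atoms when they are
   infinite, or when the sigma-algebra of Psi is not countably generated. *)
Definition atomic_events : set (set atomic_measure) :=
  [set E : set atomic_measure | exists (S : set Psi) (V : set (\bar R)),
     [/\ measurable S, measurable V & E = [set m : atomic_measure | V (m S)]]] `|`
  [set E : set atomic_measure | exists (C : set (measurableTypeR R * Psi)) (V : set (\bar R)),
     [/\ measurable C, measurable V & E = [set m : atomic_measure | V (atom_count m C)]]].

Definition atomic_display : measure_display.
Proof. by constructor. Qed.

HB.instance Definition _ := @isMeasurable.Build atomic_display atomic_measure
  <<s atomic_events >> (@sigma_algebra0 _ setT atomic_events)
  (@sigma_algebraC _ atomic_events)
  (@sigma_algebra_bigcup _ setT atomic_events).

End atomic_measures.

Section random_measures.
Context d (Psi : measurableType d) (R : realType).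
Context d' (Omega : measurableType d') (P : {measure set Omega -> \bar R}).
Local Open Scope ereal_scope.

(* poisson_prob 0 is the point mass at 0. *)
Definition poisson_distributed (N : Omega -> \bar R) (r : \bar R) : Prop :=
  match r with
  | r'%:E => forall n : nat,
      P [set w | N w = n%:R%:E] = poisson_prob r' 0%N [set n]
  | +oo => P [set w | N w = +oo] = 1
  | -oo => False
  end.

Definition poisson_process d0 (Z : measurableType d0)
    (N : Omega -> set Z -> \bar R) (mu : set Z -> \bar R) : Prop :=
  (forall C, measurable C -> poisson_distributed (N ^~ C) (mu C)) /\
  (forall (n : nat) (C : 'I_n -> set Z) (V : 'I_n -> set (\bar R)),
     (forall i, measurable (C i)) -> trivIset setT C ->
     (forall i, measurable (V i)) ->
     P [set w | forall i, V i (N w (C i))] =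
     \prod_(i < n) P [set w | V i (N w (C i))]).

(* Theta is the independent sum of fixed atoms at the distinct locations p k,
   with weights of Lebesgue density f k on T, and of an ordinary component
   whose atoms form a Poisson point process of rate measure mu. *)
Definition crm_with (Theta : Omega -> atomic_measure Psi R) (T : set R)
    (K : nat) (p : 'I_K -> Psi) (f : 'I_K -> R -> R)
    (mu : set (measurableTypeR R * Psi) -> \bar R) : Prop :=
  injective p /\
  exists (tfix : 'I_K -> Omega -> R) (Tord : Omega -> atomic_measure Psi R),
  [/\ (forall k, measurable_fun setT (tfix k)) /\ measurable_fun setT Tord,
      {ae P, forall w, forall S : set Psi, measurable S ->
         Theta w S = \sum_(k < K) (tfix k w)%:E * \d_(p k) S + Tord w S},
      forall k (V : set R), measurable V ->
        P (tfix k @^-1` V) = \int[lebesgue_measure]_(t in V `&` T) (f k t)%:E,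
      poisson_process (fun w => atom_count (Tord w)) mu &
      forall (V : 'I_K -> set R) (D : set (atomic_measure Psi R)),
        (forall k, measurable (V k)) -> measurable D ->
        P ([set w | forall k, V k (tfix k w)] `&` Tord @^-1` D) =
        (\prod_(k < K) P (tfix k @^-1` V k)) * P (Tord @^-1` D)].

End random_measures.

Section exponential_family.
Context (R : realType) (s : nat).

Definition dot (u v : 'rV[R]_s) : R := \sum_(i < s) u 0 i * v 0 i.

Variables (T : set R) (kappa : nat -> R) (eta : R -> 'rV[R]_s)
  (phi : nat -> 'rV[R]_s) (A : R -> R).

Definition likelihood (x : nat) (t : R) : R :=
  kappa x * expR (dot (eta t) (phi x) - A t).

Definition conj_kernel (xi : 'rV[R]_s) (lam : R) (t : R) : R :=
  expR (dot xi (eta t) + lam * - A t).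

(* Only meaningful when the integral is positive and finite, which the
   properness of conj_density ensures. *)
Definition log_partition (xi : 'rV[R]_s) (lam : R) : R :=
  ln (fine (\int[lebesgue_measure]_(t in T) (conj_kernel xi lam t)%:E)).

Definition conj_density (xi : 'rV[R]_s) (lam : R) (t : R) : R :=
  expR (dot xi (eta t) + lam * - A t - log_partition xi lam).

Definition conj_weight_rate (gamma : R) (xi : 'rV[R]_s) (lam : R) (t : R) : R :=
  gamma * conj_kernel xi lam t.

Local Open Scope ereal_scope.

Definition conj_rate d (Psi : measurableType d) (G : probability Psi R)
    (gamma : R) (xi : 'rV[R]_s) (lam : R)
    (C : set (measurableTypeR R * Psi)) : \bar R :=
  \int[lebesgue_measure]_(t in T)
    ((conj_weight_rate gamma xi lam t)%:E * G (xsection C t)).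

Definition conj_prior d (Psi : measurableType d) (G : probability Psi R)
    d' (Omega : measurableType d') (P : {measure set Omega -> \bar R})
    (Theta : Omega -> atomic_measure Psi R) : Prop :=
  exists (K : nat) (p : 'I_K -> Psi) (xifix : 'I_K -> 'rV[R]_s)
    (lamfix : 'I_K -> R) (gamma : R) (xi : 'rV[R]_s) (lam : R),
  [/\ forall k, \int[lebesgue_measure]_(t in T)
        (conj_density (xifix k) (lamfix k) t)%:E = 1,
      (0 < gamma)%R,
      \int[lebesgue_measure]_(t in T) (conj_weight_rate gamma xi lam t)%:E = +oo,
      \sum_(1 <= x <oo) \int[lebesgue_measure]_(t in T)
        (conj_weight_rate gamma xi lam t * likelihood x t)%:E < +oo &
      crm_with P Theta T p (fun k => conj_density (xifix k) (lamfix k))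
        (conj_rate G gamma xi lam)].

End exponential_family.

Section bayes.
Context d (Psi : measurableType d) (R : realType).
Context d' (Omega : measurableType d') (P : probability Omega R).
Local Open Scope ereal_scope.

(* Conditionally on the atoms (theta k, psi k), that is, on the sigma-algebra
   that they generate, the x k are independent and x k has probability mass
   function h ^~ (theta k). *)
Definition cond_independent_pmf (h : nat -> R -> R)
    (theta : nat -> Omega -> R) (psi : nat -> Omega -> Psi)
    (x : nat -> Omega -> nat) : Prop :=
  forall (n : nat) (a : 'I_n -> nat) (E : set Omega),
  <<s [set F | exists k (C : set (measurableTypeR R * Psi)),
         measurable C /\ F = [set w | C (theta k w, psi k w)]] >> E ->
  P (E `&` [set w | forall k : 'I_n, x k w = a k]) =
  \int[P]_(w in E) (\prod_(k < n) h (a k) (theta k w))%:E.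

Definition posterior_kernel d1 d2 (M : measurableType d1) (Y : measurableType d2)
    (Theta : Omega -> M) (X : Omega -> Y) (Q : R.-pker Y ~> M) : Prop :=
  forall (D : set M) (E : set Y), measurable D -> measurable E ->
  P (Theta @^-1` D `&` X @^-1` E) = \int[P]_(w in X @^-1` E) Q (X w) D.

End bayes.

(* Main.v *)
From HB Require Import structures.
Require Import Defs.
From mathcomp Require Import all_boot all_order all_algebra.
From mathcomp Require Import all_classical all_reals all_analysis.
From mathcomp Require Import measurable_realfun.
From mathcomp Require Import finmap ring lra.

Set Implicit Arguments.
Unset Strict Implicit.
Unset Printing Implicit Defensive.

Import Order.TTheory GRing.Theory Num.Theory.
Import numFieldNormedType.Exports.

Local Open Scope classical_set_scope.
Local Open Scope ring_scope.

(** The proof runs on generating functionals. For [f] with values in [0, 1],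
    let [pgf f m] be the product of the values of [f] at the atoms of [m]. It is
    the exponential of minus an integral against the counting measure of the
    atoms, so it makes sense for infinitely many atoms and is multiplicative in
    [f]. The functionals [pgf f] generate the sigma-algebra of atomic measures,
    hence identities between expectations of such products extend to all
    events ([bspan_indic], [bspan_pgfs]).

    For a completely random measure with fixed atoms at [p k] of law [rho k] and
    a Poisson component of intensity [mu], the expectation of [pgf g] is
      [(\prod_k ev (rho k) (g (., p k))) * exp (- \int[mu] (1 - g))]
    ([pgf_crm]), and conversely this formula without fixed atoms characterizes
    Poisson processes ([pgf_poisson]). Averaging over the conditionally
    independent marks replaces a function of an atom and its mark by its mixture
    over the mark ([marking]), so the joint functional of [Theta] and [X] is
    again of this form.

    The rest is Bayes' rule for one atom. A conjugate kernel times the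
    likelihood of [n] is a constant times the conjugate kernel with parameters
    [xi + phi n] and [lam + 1] ([kernel_update]). At a fixed location this
    updates the density of the weight. Away from the fixed locations an atom
    with a mark [n > 0] becomes a fixed atom of the posterior, whose density is
    the normalized product of the weight rate and the likelihood of [n]; the
    atoms with mark 0 are not seen, and form a Poisson process whose weight rate
    is the prior rate times the likelihood of 0, which is again of conjugate
    form ([post_rateE]). The new rate is still infinite, because the marks
    [n > 0] only take away a finite part of it ([rate_unmarked]); for the same
    reason [X] has finitely many atoms outside the fixed locations
    ([ae_finite]), so the posterior has finitely many fixed atoms.

    Accordingly, the posterior law given [X = m] is built by adding independent
    atoms, with the updated densities, at the fixed locations and at the atoms
    of [m], to the law of the unmarked part of [Theta] ([posterior]). Comparing
    generating functionals gives Bayes' rule for products ([joint_pgf_bayes]),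
    and the extension to events gives the posterior kernel
    ([exists_posterior]). *)

(** * Classes of functions closed under bounded limits *)

Section bounded_classes.
Context (R : realType) (X : Type).
Implicit Types (H W : set (X -> R)) (f g : X -> R).

(** Closure under sums, scalings and pointwise limits of sequences bounded by
    1: all these are preserved by expectations. *)
Definition bclosed H : Prop :=
  [/\ (forall f g, H f -> H g -> H (fun x => f x + g x)),
      (forall (c : R) f, H f -> H (fun x => c * f x)) &
      (forall (F : nat -> X -> R) f, (forall n, H (F n)) ->
         (forall n x, `|F n x| <= 1) ->
         (forall x, F n x @[n --> \oo] --> f x) -> H f)].

(** An identity between expectations that holds on [W] holds on [bspan W]. *)
Definition bspan W : set (X -> R) :=
  [set f | forall H, bclosed H -> W `<=` H -> H f].

Lemma bspan_bclosed W : bclosed (bspan W).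
Proof.
split=> [f g Wf Wg H Hc WH|c f Wf H Hc WH|F f WF F1 Ff H Hc WH].
- by case: (Hc) => + _ _; apply; [exact: Wf|exact: Wg].
- by case: (Hc) => _ + _; apply; exact: Wf.
- by case: (Hc) => _ _; apply; [move=> n; exact: WF|exact: F1|].
Qed.

Lemma sub_bspan W : W `<=` bspan W.
Proof. by move=> f Wf H _; exact. Qed.

Lemma bclosed_sum H (I : Type) (s : seq I) (F : I -> X -> R) : bclosed H ->
  H (cst 0) -> (forall i, H (F i)) -> H (fun x => \sum_(i <- s) F i x).
Proof.
move=> Hc H0 HF; elim: s => [|i s IH].
  by under eq_fun do rewrite big_nil.
under eq_fun do rewrite big_cons.
by case: (Hc) => + _ _; apply.
Qed.

Definition level_sets W : set (set X) :=
  [set A | exists v a, W v /\ A = [set x | v x = a]].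

Section multiplicative.
Variable W : set (X -> R).
Hypothesis W1 : W (cst 1).
Hypothesis WM : forall f g, W f -> W g -> W (fun x => f x * g x).
Hypothesis W01 : forall f x, W f -> 0 <= f x <= 1.

Let H0 H : bclosed H -> W `<=` H -> H (cst 0).
Proof.
move=> [_ HZ _] /(_ _ W1) /(HZ 0); congr H.
by apply/funext => x /=; rewrite mul0r.
Qed.

Let cylinder (s : seq ((X -> R) * R)) x : R :=
  \prod_(va <- s) (va.1 x == va.2)%:R.

Let cylinder01 s x : 0 <= cylinder s x <= 1.
Proof.
rewrite /cylinder; elim/big_ind: _ => //=; first by rewrite ler01 lexx.
  by move=> a b /andP[a0 a1] /andP[b0 b1]; rewrite mulr_ge0//= mulr_ile1.
by move=> i _; case: eqP; rewrite ?lexx ?ler01.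
Qed.

(** The indicator of [v = a] is the pointwise limit of the polynomials
    [(1 - (v - a) ^+ 2) ^+ n] in [v]: no uniform approximation is needed to
    pass from a multiplicative family to its level sets. *)
Let cylinder_bspan s : (forall va, List.In va s -> W va.1) ->
  forall w, W w -> bspan W (fun x => w x * cylinder s x).
Proof.
elim: s => [|[v a] s IH] Ws w Ww.
  rewrite (_ : (fun _ => _) = w); first exact: sub_bspan.
  by apply/funext => x; rewrite /cylinder big_nil mulr1.
have Wv : W v by apply: (Ws (v, a)); left.
have {}IH u : W u -> bspan W (fun x => u x * cylinder s x).
  by apply: IH => va vas; apply: Ws; right.
have [a01|a01] := boolP (0 <= a <= 1); last first.
  rewrite (_ : (fun _ => _) = cst 0).
    by move=> H Hc WH; exact: H0.
  apply/funext => x; rewrite /cylinder big_cons/=.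
  case: eqP => [va|]; last by rewrite mul0r mulr0.
  by move: a01; rewrite -va (W01 x Wv).
have poly (p : {poly R}) u : W u ->
    bspan W (fun x => u x * p.[v x] * cylinder s x).
  elim/poly_ind: p u => [|p c IHp] u Wu.
    under eq_fun do rewrite horner0 mulr0 mul0r.
    by move=> H Hc WH; exact: H0.
  rewrite (_ : (fun _ => _) = (fun x => (u x * v x) * p.[v x] * cylinder s x +
     c * (u x * cylinder s x))); last first.
    by apply/funext => x; rewrite hornerMXaddC; ring.
  case: (bspan_bclosed W) => HD HZ _; apply: HD.
    by apply: IHp; exact: WM.
  by apply: HZ; exact: IH.
case: (bspan_bclosed W) => _ _ Hlim.
pose q : {poly R} := 1 - ('X - a%:P) ^+ 2.
have qE x : q.[v x] = 1 - (v x - a) ^+ 2.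
  by rewrite /q !hornerE.
have q01 x : 0 <= q.[v x] <= 1.
  rewrite qE; have /andP[v0 v1] := W01 x Wv; have /andP[a0 a1] := a01.
  have h : 0 <= (1 - (v x - a)) * (1 + (v x - a)) by apply: mulr_ge0; lra.
  have h2 := sqr_ge0 (v x - a); apply/andP; split; last by lra.
  by rewrite expr2; move: h; nra.
apply: (Hlim (fun n x => w x * (q ^+ n).[v x] * cylinder s x)).
- by move=> n; exact: poly.
- move=> n x; have /andP[w0 w1] := W01 x Ww; have /andP[c0 c1] := cylinder01 s x.
  have /andP[q0 q1] := q01 x.
  rewrite horner_exp ger0_norm; last by rewrite !mulr_ge0// exprn_ge0.
  by rewrite !mulr_ile1// ?mulr_ge0// ?exprn_ge0// exprn_ile1.
- move=> x; rewrite /cylinder big_cons/=.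
  rewrite (_ : (fun n => _) =
      fun n => (w x * cylinder s x) * q.[v x] ^+ n); last first.
    by apply/funext => n; rewrite horner_exp mulrAC.
  rewrite [X in _ --> X](_ : _ = w x * cylinder s x * (v x == a)%:R); last first.
    by rewrite (mulrC (_ == _)%:R) mulrA.
  apply: cvgMl_tmp.
  case: eqP => [vx|/eqP vx].
    rewrite qE vx subrr expr0n subr0 (_ : GRing.exp 1 = cst 1); last first.
      by apply/funext => n; rewrite expr1n.
    exact: cvg_cst.
  apply: cvg_expr; have /andP[q0 q1] := q01 x.
  rewrite ger0_norm// qE ltrBlDr ltrDl.
  by rewrite exprn_even_gt0//= subr_eq0.
Qed.

(** The indicators of finite intersections of level sets are limits of
    polynomials in members of [W]; Dynkin's theorem gives the other events, as
    [bclosed] contains complements and disjoint unions. *)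
Lemma bspan_indic (A : set X) : <<s level_sets W >> A -> bspan W \1_A.
Proof.
pose G := [set A | exists2 s, (forall va, List.In va s -> W va.1) &
                    A = [set x | cylinder s x = 1]].
have cylE s : cylinder s = \1_[set x | cylinder s x = 1].
  apply/funext => x; rewrite indicE.
  have [c1|c0] : cylinder s x = 1 \/ cylinder s x = 0.
    rewrite /cylinder; elim/big_ind: _ => [|a b|i _]; first by left.
      by case=> ->; case=> ->; rewrite ?mulr1 ?mul0r ?mulr0; [left|right|right|right].
    by case: eqP; [left|right].
  - by rewrite c1 mem_set.
  - by rewrite c0 memNset//= c0 => /esym/eqP; rewrite oner_eq0.
have GI : setI_closed G.
  move=> _ _ [s Ws ->] [t Wt ->]; exists (s ++ t).
    by move=> va vst; have [/Ws|/Wt] := List.in_app_or _ _ _ vst.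
  apply/seteqP; split => x /=; rewrite /cylinder big_cat/=.
    by move=> [-> ->]; rewrite mulr1.
  have /andP[s0 s1] := cylinder01 s x; have /andP[t0 t1] := cylinder01 t x.
  rewrite -/(cylinder s x) -/(cylinder t x) => st.
  suff s1' : cylinder s x = 1 by move: st; rewrite s1' mul1r.
  apply/eqP; rewrite eq_le s1/= -st.
  by rewrite ger_pMr// lt_neqAle s0 andbT; apply: contra_eq_neq st => <-; rewrite mul0r eq_sym oner_eq0.
have sub : level_sets W `<=` G.
  move=> _ [v [a [Wv ->]]]; exists [:: (v, a)] => [va [<-//|[]]|].
  apply/seteqP; split => x /=; rewrite /cylinder big_seq1/=.
    by move=> ->; rewrite eqxx.
  by case: eqP => // _ /esym/eqP; rewrite oner_eq0.
move=> /(sub_sigma_algebra2 sub).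
have [HD HZ Hlim] := bspan_bclosed W.
rewrite -(setI_closed_g_dynkin_g_sigma_algebra GI).
move=> /(_ [set B | bspan W \1_B]); apply; split; last first.
  move=> _ [s Ws ->] /=; rewrite -cylE.
  by have := cylinder_bspan Ws W1; under eq_fun do rewrite mul1r.
have sp1 : bspan W (cst 1) by exact: sub_bspan.
split.
- by rewrite /= indicT.
- move=> B spB; rewrite /= (_ : \1__ = fun x => 1 + -1 * \1_B x).
    by apply: HD => //; exact: HZ.
  apply/funext => x; rewrite !indicE in_setC.
  by case: (x \in B); rewrite /= ?mulr1 ?mulr0 ?addr0 ?subrr.
- move=> F tF spF.
  apply: (Hlim (fun n x => \sum_(i <- iota 0 n) \1_(F i) x)) => [n|n x|x].
  + apply: (@bclosed_sum _ _ _ (fun i => \1_(F i)));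
      [exact: bspan_bclosed| |exact: spF].
    by move=> H Hc WH; exact: H0.
  + rewrite ger0_norm; last by apply: sumr_ge0.
    have [[i Fi]|nF] := pselect (exists i, F i x).
      apply: (@le_trans _ _ (\sum_(j <- iota 0 n) (j == i)%:R)).
        apply: ler_sum => j _; rewrite indicE.
        case: (boolP (x \in F j)) => //=; move=> /set_mem Fj.
        suff -> : j = i by rewrite eqxx.
        by apply: tF => //; exists x.
      have [ni|ni] := leqP n i.
        rewrite big1_seq// => j /andP[_]; rewrite mem_iota/= add0n => jn.
        by rewrite ltn_eqF// (leq_trans jn).
      rewrite (bigD1_seq i) ?iota_uniq ?mem_iota//= eqxx big1 ?addr0//.
      by move=> j /negbTE ->.
    rewrite big1// => j _; rewrite indicE memNset// => Fj.
    by apply: nF; exists j.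
  + have [[i Fi]|nF] := pselect (exists i, F i x); last first.
      rewrite indicE memNset; last by move=> [i _ Fi]; apply: nF; exists i.
      rewrite (_ : (fun n => _) = cst 0); first exact: cvg_cst.
      apply/funext => n; rewrite big1// => j _; rewrite indicE memNset// => Fj.
      by apply: nF; exists j.
    rewrite indicE mem_set; last by exists i.
    apply: cvg_near_cst; exists i.+1 => //= n /= ni.
    rewrite (bigD1_seq i) ?iota_uniq ?mem_iota//=.
    rewrite indicE mem_set// big1 ?addr0// => j ji; rewrite indicE memNset// => Fj.
    by move/eqP : ji; apply; apply: tF => //; exists x.
Qed.

End multiplicative.

Definition indicators (G : set (set X)) : set (X -> R) :=
  [set f | exists2 A, G A & f = \1_A].

(** The lower approximation of [f] by multiples of [1 / n] is an average of
    indicators of superlevel sets. *)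
Lemma bspan_superlevel (G : set (set X)) (f : X -> R) :
  (forall x, 0 <= f x <= 1) -> (forall a, G [set x | a <= f x]) ->
  bspan (indicators G) f.
Proof.
move=> f01 Gf; have [HD HZ Hlim] := bspan_bclosed (indicators G).
have Hi a : bspan (indicators G) \1_[set x | a <= f x].
  by apply: sub_bspan; exists [set x | a <= f x].
have H0 : bspan (indicators G) (cst 0).
  have := HZ 0 _ (Hi 0); congr (bspan _ _).
  by apply/funext => x /=; rewrite mul0r.
(* [F n x] is [f x] rounded down to a multiple of [1 / n.+1]. *)
pose F n x : R := n.+1%:R^-1 * \sum_(i <- iota 1 n.+1) \1_[set x | i%:R / n.+1%:R <= f x] x.
have FE n x : F n x = n.+1%:R^-1 * (Num.truncn (n.+1%:R * f x))%:R.
  rewrite /F; congr (_ * _); have /andP[f0 f1] := f01 x.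
  have nf0 : 0 <= n.+1%:R * f x by rewrite mulr_ge0.
  have /andP[] := truncn_itv nf0; set k := Num.truncn _ => k1 k2.
  have kn : (k <= n.+1)%N.
    by rewrite -(ler_nat R) (le_trans k1)// ler_piMr.
  rewrite -(subnKC kn) iotaD big_cat/= [X in _ + X]big1_seq ?addr0.
    rewrite big_seq (eq_bigr (fun=> 1)).
      by rewrite -big_seq big_const_seq count_predT size_iota iter_addr_0.
    move=> i; rewrite mem_iota => /andP[_ ik]; rewrite indicE mem_set//=.
    rewrite subnKC// ler_pdivrMr// mulrC (le_trans _ k1)// ler_nat.
    by rewrite -ltnS -(add1n k).
  move=> i /andP[_]; rewrite mem_iota => /andP[ik _]; rewrite indicE memNset//=.
  apply/negP; rewrite -ltNge subnKC// ltr_pdivlMr// mulrC.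
  by rewrite (lt_le_trans k2)// ler_nat -add1n.
have Fb n x : F n x <= f x <= F n x + n.+1%:R^-1.
  have /andP[f0 f1] := f01 x.
  have nf0 : 0 <= n.+1%:R * f x by rewrite mulr_ge0.
  have /andP[k1 k2] := truncn_itv nf0.
  rewrite FE ler_pdivrMl// k1/=.
  rewrite -[X in _ <= _ + X]mulr1 -mulrDr ler_pdivlMl//.
  by rewrite natr1 ltW.
apply: (Hlim F).
- move=> n; apply: HZ.
  apply: (@bclosed_sum _ _ _ (fun i => \1_[set x | i%:R / n.+1%:R <= f x]));
    [exact: bspan_bclosed|exact: H0|by move=> i; exact: Hi].
- move=> n x; have /andP[f0 f1] := f01 x; have /andP[+ _] := Fb n x.
  rewrite ger0_norm; first by move/le_trans; apply.
  by rewrite FE mulr_ge0.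
- move=> x; apply: (@squeeze_cvgr _ _ _ _ (fun n => f x - n.+1%:R^-1) (cst (f x))).
  + by near=> n; have /andP[h1 h2] := Fb n x; rewrite h1 andbT lerBlDr.
  + rewrite -[X in _ --> X]subr0; apply: cvgB; first exact: cvg_cst.
    exact: cvg_harmonic.
  + exact: cvg_cst.
Unshelve. all: by end_near.
Qed.

End bounded_classes.

(** * Expectations of bounded functions *)

Section bounded_expectation.
Context d (Om : measurableType d) (R : realType).
Implicit Types (F G : Om -> R).

Definition bmeas F : Prop :=
  measurable_fun setT F /\ exists M, forall w, `|F w| <= M.

Lemma bmeas_cst (c : R) : bmeas (cst c).
Proof. by split; [exact: measurable_cst|exists `|c|]. Qed.

Lemma bmeasD F G : bmeas F -> bmeas G -> bmeas (fun w => F w + G w).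
Proof.
move=> [mF [M FM]] [mG [N GN]]; split; first exact: measurable_funD.
by exists (M + N) => w; rewrite (le_trans (ler_normD _ _))// lerD.
Qed.

Lemma bmeasM F G : bmeas F -> bmeas G -> bmeas (fun w => F w * G w).
Proof.
move=> [mF [M FM]] [mG [N GN]]; split; first exact: measurable_funM.
by exists (M * N) => w; rewrite normrM ler_pM.
Qed.

Lemma bmeasZ (c : R) F : bmeas F -> bmeas (fun w => c * F w).
Proof. by apply: bmeasM; exact: bmeas_cst. Qed.

Lemma bmeas_prod (I : Type) (s : seq I) (F : I -> Om -> R) :
  (forall i, bmeas (F i)) -> bmeas (fun w => \prod_(i <- s) F i w).
Proof.
move=> mF; elim: s => [|i s IH].
  by under eq_fun do rewrite big_nil; exact: bmeas_cst.
by under eq_fun do rewrite big_cons; exact: bmeasM.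
Qed.

Lemma bmeas_sum (I : Type) (s : seq I) (F : I -> Om -> R) :
  (forall i, bmeas (F i)) -> bmeas (fun w => \sum_(i <- s) F i w).
Proof.
move=> mF; elim: s => [|i s IH].
  by under eq_fun do rewrite big_nil; exact: bmeas_cst.
by under eq_fun do rewrite big_cons; exact: bmeasD.
Qed.

Lemma bmeas01 F : measurable_fun setT F -> (forall w, 0 <= F w <= 1) -> bmeas F.
Proof.
by move=> mF F01; split=> //; exists 1 => w; have /andP[? ?] := F01 w; rewrite ger0_norm.
Qed.

Lemma bmeas_indic (A : set Om) : measurable A -> bmeas \1_A.
Proof.
move=> mA; apply: bmeas01 => [|w]; first exact: measurable_indic.
by rewrite indicE; case: (w \in A); rewrite ?ler01 ?lexx.
Qed.

(** Boundedness passes to the limit because the bound is uniform. *)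
Lemma bmeas_cvg (F : nat -> Om -> R) G (M : R) : (forall n, bmeas (F n)) ->
  (forall n w, `|F n w| <= M) -> (forall w, F n w @[n --> \oo] --> G w) ->
  bmeas G.
Proof.
move=> bF FM FG; split.
  by apply: (measurable_fun_cvg _ (fun w _ => FG w)) => n; case: (bF n).
exists M => w; rewrite -(cvg_lim _ (cvg_norm (FG w)))//.
by apply: limr_le; [apply/cvg_ex; exists `|G w|; exact: cvg_norm|exact: nearW].
Qed.

Context (P : probability Om R).

Definition ev F : R := \int[P]_w F w.

Lemma bmeas_integrable F : bmeas F -> P.-integrable setT (EFin \o F).
Proof.
move=> [mF [M FM]]; apply: (@le_integrable _ _ _ _ _ _ _ (EFin \o cst M)) => //.
- exact/measurable_EFinP.
- by move=> w _; rewrite /= lee_fin (le_trans (FM w))// ler_norm.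
- exact: finite_measure_integrable_cst.
Qed.

Lemma EFin_ev F : bmeas F -> (ev F)%:E = (\int[P]_w (F w)%:E)%E.
Proof.
by move=> bF; rewrite /ev /Rintegral fineK// integrable_fin_num//; exact: bmeas_integrable.
Qed.

Lemma ev_cst (c : R) : ev (cst c) = c.
Proof. by rewrite /ev Rintegral_cst//= probability_setT mulr1. Qed.

Lemma evD F G : bmeas F -> bmeas G -> ev (fun w => F w + G w) = ev F + ev G.
Proof. by move=> bF bG; rewrite /ev RintegralD//; exact: bmeas_integrable. Qed.

Lemma evZ (c : R) F : bmeas F -> ev (fun w => c * F w) = c * ev F.
Proof. by move=> bF; rewrite /ev RintegralZl//; exact: bmeas_integrable. Qed.

Lemma evB F G : bmeas F -> bmeas G -> ev (fun w => F w - G w) = ev F - ev G.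
Proof. by move=> bF bG; rewrite /ev RintegralB//; exact: bmeas_integrable. Qed.

Lemma ev_sum (I : Type) (s : seq I) (F : I -> Om -> R) :
  (forall i, bmeas (F i)) ->
  ev (fun w => \sum_(i <- s) F i w) = \sum_(i <- s) ev (F i).
Proof.
move=> bF; elim: s => [|i s IH].
  by under eq_fun do rewrite big_nil; rewrite big_nil ev_cst.
under eq_fun do rewrite big_cons.
by rewrite big_cons evD// ?IH//; exact: bmeas_sum.
Qed.

Lemma ev_ge0 F : (forall w, 0 <= F w) -> 0 <= ev F.
Proof. by move=> F0; exact: Rintegral_ge0. Qed.

Lemma ev_le F G : bmeas F -> bmeas G -> (forall w, F w <= G w) -> ev F <= ev G.
Proof. by move=> bF bG FG; apply: le_Rintegral => //; exact: bmeas_integrable. Qed.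

Lemma ev_indic (A : set Om) : measurable A -> (ev \1_A)%:E = P A.
Proof.
by move=> mA; rewrite EFin_ev ?integral_indic ?setIT//; exact: bmeas_indic.
Qed.

Lemma ev_cvg (F : nat -> Om -> R) G (M : R) : (forall n, bmeas (F n)) ->
  (forall n w, `|F n w| <= M) -> (forall w, F n w @[n --> \oo] --> G w) ->
  ev (F n) @[n --> \oo] --> ev G.
Proof.
move=> bF FM FG; have bG := bmeas_cvg bF FM FG.
have : (\int[P]_w (F n w)%:E)%E @[n --> \oo] --> (\int[P]_w (G w)%:E)%E.
  apply: (@dominated_cvg _ _ _ _ _ _ _ _ (cst M%:E)) => //.
  - by move=> n; apply/measurable_EFinP; case: (bF n).
  - by move=> w _; apply/cvg_EFin; [exact: nearW|exact: FG].
  - exact: finite_measure_integrable_cst.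
  - by move=> n w _; rewrite lee_fin.
by rewrite -(EFin_ev bG) => /fine_cvgP[].
Qed.

Lemma ev_ae F G : measurable_fun setT F -> measurable_fun setT G ->
  {ae P, forall w, F w = G w} -> ev F = ev G.
Proof.
move=> mF mG FG; rewrite /ev /Rintegral; congr fine.
apply: ae_eq_integral => //; [exact/measurable_EFinP|exact/measurable_EFinP|].
by apply: filterS FG => w -> _.
Qed.

(** The bound may grow under sums and scalings, which is why [bmeas] does not
    fix it. *)
Lemma bclosed_bmeas : bclosed bmeas.
Proof.
split=> [F G|c F|F G bF F1 FG]; [exact: bmeasD|exact: bmeasZ|].
exact: bmeas_cvg bF F1 FG.
Qed.

End bounded_expectation.
Arguments ev {d Om R} P F.

Lemma ev_pushforward d1 d2 (S : measurableType d1) (U : measurableType d2)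
    (R : realType) (P : probability S R) (Q : probability U R) (X : S -> U) :
  measurable_fun setT X -> (forall A, measurable A -> Q A = P (X @^-1` A)) ->
  forall F, bmeas F -> ev Q F = ev P (F \o X).
Proof.
move=> mX QP F bF.
have bFX : bmeas (F \o X).
  case: bF => mF [M FM]; split; last by exists M => w; exact: FM.
  exact: measurableT_comp.
rewrite /ev /Rintegral; congr fine.
rewrite (@eq_measure_integral _ _ _ _ (pushforward P X)).
  rewrite integral_pushforward//.
    by apply/measurable_EFinP; case: bF.
  exact: bmeas_integrable.
by move=> A mA _; exact: QP.
Qed.

(** Independence of finitely many bounded variables can be checked on
    generating classes, one coordinate at a time. *)
Section independence.
Context d (Om : measurableType d) (R : realType) (P : probability Om R).

Definition ev_prod (I : finType) (F : I -> Om -> R) : Prop :=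
  ev P (fun w => \prod_(i : I) F i w) = \prod_(i : I) ev P (F i).

Lemma ev_prod_bspan (I : finType) (W : I -> set (Om -> R)) :
  (forall i, W i `<=` bmeas (R := R)) ->
  (forall F, (forall i, W i (F i)) -> ev_prod F) ->
  forall F, (forall i, bspan (W i) (F i)) -> ev_prod F.
Proof.
move=> Wb Wprod.
have Bb i : bspan (W i) `<=` bmeas (R := R).
  by move=> F; apply; [exact: bclosed_bmeas|exact: Wb].
suff claim (s : seq I) F : uniq s -> (forall i, bspan (W i) (F i)) ->
    (forall i, i \notin s -> W i (F i)) -> ev_prod F.
  move=> F WF; apply: (claim (enum I)) => //; first exact: enum_uniq.
  by move=> i; rewrite mem_enum.
elim: s F => [|j s IH] F; first by move=> _ _ WF; apply: Wprod => i; exact: WF.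
move=> /= /andP[js us] BF WF.
pose upd f i := if i == j then f else F i.
have updE f i : i != j -> upd f i = F i by rewrite /upd => /negbTE ->.
have updj f : upd f j = f by rewrite /upd eqxx.
have prodE f w : \prod_i upd f i w = f w * \prod_(i | i != j) F i w.
  by rewrite (bigD1 j)//= updj; congr (_ * _); apply: eq_bigr => i /updE ->.
have evE f : \prod_i ev P (upd f i) = ev P f * \prod_(i | i != j) ev P (F i).
  by rewrite (bigD1 j)//= updj; congr (_ * _); apply: eq_bigr => i /updE ->.
pose rest w := \prod_(i | i != j) F i w.
have brest : bmeas rest.
  rewrite /rest; under eq_fun do rewrite -big_filter.
  by apply: bmeas_prod => i; exact: (Bb i).
have evupd f : ev P (fun w => \prod_i upd f i w) = ev P (fun w => f w * rest w).
  by congr (ev P _); apply/funext => w; rewrite prodE.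
suff : bmeas (F j) /\ ev_prod (upd (F j)).
  case=> _; rewrite /ev_prod; congr (_ = _).
    congr (ev P _); apply/funext => w; apply: eq_bigr => i _.
    by rewrite /upd; case: eqP => // ->.
  by apply: eq_bigr => i _; rewrite /upd; case: eqP => // ->.
apply: (BF j [set f | bmeas f /\ ev_prod (upd f)]); last first.
  move=> f Wf; split; first exact: Wb Wf.
  apply: IH => // i.
    rewrite /upd; case: eqP => [->|_]; [exact: sub_bspan|exact: BF].
  rewrite /upd; case: eqP => [->//|/eqP ij] si; apply: WF.
  by rewrite in_cons negb_or ij.
rewrite /ev_prod; split=> [f g [bf +] [bg]|c f [bf]|G f /all_and2[bG +] G1 Gf].
- rewrite !evupd !evE => fE gE; split; first exact: bmeasD.
  rewrite evupd evE.
  rewrite (_ : (fun w => (f w + g w) * rest w) =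
      fun w => f w * rest w + g w * rest w); last first.
    by apply/funext => w; rewrite mulrDl.
  by rewrite !evD ?fE ?gE ?mulrDl//; exact: bmeasM.
- rewrite !evupd !evE => fE; split; first exact: bmeasZ.
  rewrite evupd evE.
  rewrite (_ : (fun w => (c * f w) * rest w) = fun w => c * (f w * rest w)); last first.
    by apply/funext => w; rewrite mulrA.
  by rewrite !evZ ?fE ?mulrA//; exact: bmeasM.
- move=> GE; split; first exact: bmeas_cvg bG G1 Gf.
  rewrite evupd evE; case: (brest) => _ [M restM].
  have bGr n : bmeas (fun w => G n w * rest w) by exact: bmeasM.
  have GrM n w : `|G n w * rest w| <= M.
    by rewrite normrM -[leRHS]mul1r ler_pM.
  have Grf w : G n w * rest w @[n --> \oo] --> f w * rest w.
    exact: cvgMr_tmp (Gf w).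
  have := ev_cvg (P := P) bGr GrM Grf.
  rewrite (_ : (fun n => _) =
      fun n => ev P (G n) * \prod_(i | i != j) ev P (F i)); last first.
    by apply/funext => n; rewrite -evE -GE evupd.
  move=> /cvg_unique; apply => //; apply: cvgMr_tmp.
  exact: ev_cvg bG G1 Gf.
Qed.

End independence.

(** * Infinite products of numbers in [0, 1] *)

Section exponential_of_minus.
Context (R : realType).
Implicit Types (e : \bar R) (y : R).
Local Open Scope ereal_scope.

(** Products of numbers in [0, 1] correspond to sums in [0, +oo], and the
    value 0 to +oo; so products over atoms become integrals. *)
Definition expn e : R := if e is r%:E then expR (- r) else 0%R.

Definition nlog y : \bar R := if (y <= 0)%R then +oo else (- ln y)%:E.

Lemma expn01 e : 0 <= e -> (0 <= expn e <= 1)%R.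
Proof.
case: e => [r|_|//]; last by rewrite /= lexx ler01.
by rewrite lee_fin /= expR_ge0 => r0; rewrite -[leRHS]expR0 ler_expR oppr_le0.
Qed.

Lemma expn0 : expn 0 = 1%R. Proof. by rewrite /= oppr0 expR0. Qed.

Lemma expnD a b : 0 <= a -> 0 <= b -> expn (a + b) = (expn a * expn b)%R.
Proof.
case: a b => [a| |] [b| |]//= _ _; rewrite ?mul0r ?mulr0//.
by rewrite opprD expRD.
Qed.

Lemma expn_nlog y : (0 <= y)%R -> expn (nlog y) = y.
Proof.
rewrite /nlog; case: ifPn => y0 y1; first by apply/eqP; rewrite eq_le y1 y0.
by rewrite /= opprK lnK// posrE ltNge.
Qed.

Lemma nlog_ge0 y : (y <= 1)%R -> 0 <= nlog y.
Proof.
by rewrite /nlog; case: ifPn => // y0 y1; rewrite lee_fin oppr_ge0 ln_le0.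
Qed.

Lemma nlog1 : nlog 1%R = 0.
Proof. by rewrite /nlog ifF ?ln1 ?oppr0//; apply/negbTE; rewrite -ltNge ltr01. Qed.

Lemma nlogM y1 y2 : (0 <= y1)%R -> (0 <= y2)%R ->
  nlog (y1 * y2)%R = nlog y1 + nlog y2.
Proof.
rewrite le_eqVlt => /predU1P[<- _|y10].
  by rewrite mul0r /nlog lexx; case: ifPn.
rewrite le_eqVlt => /predU1P[<-|y20].
  by rewrite mulr0 /nlog lexx; case: ifPn.
rewrite /nlog !leNgt mulr_gt0// y10 y20/=.
by rewrite lnM// opprD EFinD.
Qed.

(** Continuity includes the point at infinity, where [expn] vanishes. *)
Lemma expn_cvg (u : nat -> \bar R) l : (forall n, 0 <= u n) ->
  u n @[n --> \oo] --> l -> expn (u n) @[n --> \oo] --> expn l.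
Proof.
move=> u0; case: l => [r|uoo|].
- move=> /fine_cvgP[ufin ur] /=.
  apply: (@cvg_trans _ (expR (- fine (u n)) @[n --> \oo])).
    apply: near_eq_cvg; apply: filterS ufin => n.
    by move: (u0 n); case: (u n).
  apply: continuous_cvg; first exact: continuous_expR.
  exact: cvgN ur.
- apply/cvgrPdist_lt => e e0 /=.
  move/cvgeyPge : uoo => /(_ (- ln (e / 2)))%R.
  apply: filterS => n un; rewrite sub0r normrN ger0_norm; last first.
    by have /andP[] := expn01 (u0 n).
  move: un; case: (u n) => [s| |]//=.
  rewrite lee_fin lerNl => h.
  have := ler_expR (- s)%R (ln (e / 2)); rewrite h lnK ?posrE ?divr_gt0//.
  move=> /(le_lt_trans); apply.
  by rewrite ltr_pdivrMr// ltr_pMr// ltr1n.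
- move=> /cvgeNyPle/(_ (- 1)%R)[N _ /(_ N (leqnn N))] /=.
  by move=> /(le_trans (u0 N)); rewrite lee_fin lerNr oppr0 ler10.
Qed.

Lemma measurable_expn : measurable_fun setT expn.
Proof.
rewrite (_ : expn = fun e => if e \is a fin_num then expR (- fine e) else 0%R).
  apply: measurable_fun_ifT => //.
    by apply: (@measurable_fun_bool _ _ _ _ true); apply: emeasurable_fin_num.
  apply: measurableT_comp; first exact: measurable_expR.
  apply: measurableT_comp; first exact: oppr_measurable.
  exact: fine_measurable.
by apply/funext => -[].
Qed.

Lemma measurable_nlog : measurable_fun setT nlog.
Proof.
apply: measurable_fun_ifT => //; first exact: measurable_fun_ler.
apply/measurable_EFinP; apply: measurableT_comp => //; exact: measurable_ln.
Qed.

(** The infinite product of the [u k]: for factors in [0, 1] it always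
    converges, possibly to 0. *)
Definition iprod (u : nat -> R) : R := expn (\sum_(k <oo) nlog (u k)).

Section infinite_product.
Variable u : nat -> R.
Hypothesis u01 : forall k, (0 <= u k <= 1)%R.

Lemma nlog_sum_ge0 : 0 <= \sum_(k <oo) nlog (u k).
Proof. by apply: nneseries_ge0 => k _ _; apply: nlog_ge0; case/andP: (u01 k). Qed.

Lemma iprod_cvg : (\prod_(k < n) u k)%R @[n --> \oo] --> iprod u.
Proof.
have nl0 k : 0 <= nlog (u k) by apply: nlog_ge0; case/andP: (u01 k).
have : (\sum_(0 <= k < n) nlog (u k))%E @[n --> \oo] --> \sum_(k <oo) nlog (u k).
  by apply: is_cvg_nneseries => k _ _.
move=> /expn_cvg; rewrite -/(iprod u).
rewrite (_ : (fun n => expn _) = fun n => (\prod_(k < n) u k)%R).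
  by apply => n; exact: sume_ge0.
apply/funext; elim => [|n IH]; first by rewrite big_geq// big_ord0 expn0.
rewrite big_nat_recr//= big_ord_recr/= expnD ?sume_ge0// IH.
by rewrite expn_nlog//; case/andP: (u01 n).
Qed.

End infinite_product.

Lemma iprodM u v : (forall k, 0 <= u k <= 1)%R -> (forall k, 0 <= v k <= 1)%R ->
  iprod (fun k => u k * v k)%R = (iprod u * iprod v)%R.
Proof.
move=> u01 v01; rewrite /iprod -expnD ?nlog_sum_ge0//.
rewrite -nneseriesD//; last 2 first.
- by move=> k _ _; apply: nlog_ge0; case/andP: (u01 k).
- by move=> k _ _; apply: nlog_ge0; case/andP: (v01 k).
congr expn; apply: eq_eseriesr => k _.
by rewrite nlogM//; [case/andP: (u01 k)|case/andP: (v01 k)].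
Qed.

Lemma iprod_eq u v : (forall k, u k = v k) -> iprod u = iprod v.
Proof. by move=> uv; congr iprod; apply/funext. Qed.

End exponential_of_minus.

(** * Atoms of atomic measures and their generating functional *)

Lemma counting_image (R : realType) (A B : choiceType) (f : A -> B) (D : set A) :
  {in D &, injective f} -> counting (f @` D) = counting D :> \bar R.
Proof.
move=> fI; have fE : (f @` D #= D)%card by exact: inj_card_eq.
rewrite /counting (eq_finite_set fE).
case: ifPn => // /asboolP fD; congr (_%:R%:E).
by apply/(fcard_eq _ fD) => //; exact: finite_image.
Qed.

Section atoms_of_measures.
Context d (Psi : measurableType d) (R : realType).
Hypothesis singletonsP : forall p : Psi, measurable [set p].
Local Notation AM := (atomic_measure Psi R).
Local Notation Z := (measurableTypeR R * Psi)%type.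
Implicit Types (m : AM) (C D : set Z) (f : Z -> R).
Local Open Scope ereal_scope.

Definition am_mass m (p : Psi) : R := fine (m [set p]).

Lemma am_massE m p : m [set p] = (am_mass m p)%:E.
Proof. by rewrite /am_mass fineK// ge0_fin_numE//; exact: am_fin. Qed.

Lemma am_mass_ge0 m p : (0 <= am_mass m p)%R.
Proof. by rewrite fine_ge0. Qed.

Lemma atomsP m y q : atoms m (y, q) <-> (y != 0%R /\ am_mass m q = y).
Proof.
rewrite /atoms/= am_massE; split=> [[y0 my]|[y0 my]]; split=> //.
  exact: EFin_inj my.
by rewrite my.
Qed.

Lemma measurable_point (z : Z) : measurable [set z].
Proof.
rewrite (_ : [set z] = [set z.1] `*` [set z.2]); last first.
  by apply/seteqP; split=> [_ ->//|[y q] /= [-> ->]]; case: z.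
by apply: measurableX.
Qed.

(** An atom can only sit at one of the countably many locations of a
    decomposition into point masses. *)
Lemma countable_locations m : countable [set p | am_mass m p != 0%R].
Proof.
have [w [q mE]] := am_atomic m.
apply: (@sub_countable _ _ _ (range q)); last exact: sub_countable (card_image_le _ _) _.
apply: subset_card_le => p /= mp0; apply: contrapT => pq; move/eqP: mp0; apply.
apply: EFin_inj; rewrite -am_massE mE// /sum_of_atoms.
apply: eseries0 => k _ _; rewrite diracE memNset ?mule0//= => qp.
by apply: pq; exists k.
Qed.

Lemma measurable_atoms m : measurable (atoms m).
Proof.
apply: countable_measurable; first exact: measurable_point.
have -> : atoms m = (fun p => (am_mass m p, p)) @` [set p | am_mass m p != 0%R].
  apply/seteqP; split => [[y q] /atomsP[y0 my]|_ [p p0 <-]].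
    by exists q; rewrite /= my.
  exact/atomsP.
exact: sub_countable (card_image_le _ _) (countable_locations m).
Qed.

Definition atom_measure m : {measure set Z -> \bar R} :=
  mrestr (@counting _ R) (measurable_atoms m).

Lemma atom_measureE m C : atom_measure m C = atom_count m C.
Proof. by rewrite /atom_count setIC. Qed.

Section enumeration.
Variables (m : AM) (D : set Z) (b : nat -> bool) (z : nat -> Z).
Hypothesis zI : forall i j, b i -> b j -> z i = z j -> i = j.
Hypothesis z_atom : forall k, b k -> atoms m (z k) /\ D (z k).
Hypothesis atom_z : forall y, atoms m y -> D y -> exists2 k, b k & z k = y.

Lemma atom_count_enum C : C `<=` D ->
  atom_count m C = \sum_(k <oo) (if b k then \d_(z k) C else 0).
Proof.
move=> CD; rewrite /atom_count.
have -> : atoms m `&` C = z @` [set k | b k /\ C (z k)].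
  apply/seteqP; split => [y [my Cy]|_ [k [bk Ck] <-]].
    by have [k bk zk] := atom_z my (CD _ Cy); exists k => //; rewrite /= zk.
  by split=> //; case: (z_atom bk).
rewrite counting_image; last first.
  by move=> i j /set_mem[bi _] /set_mem[bj _]; exact: zI.
rewrite counting_dirac; apply: eq_eseriesr => k _.
rewrite !diracE; case: ifPn => bk.
  have [zk|zk] := pselect (C (z k)); first by rewrite !mem_set.
  by rewrite !memNset// => -[].
by rewrite memNset// => -[]; rewrite (negbTE bk).
Qed.

Hypothesis mD : measurable D.

Lemma integral_atom_enum (phi : Z -> \bar R) : measurable_fun setT phi ->
  (forall y, 0 <= phi y) -> (forall y, ~ D y -> phi y = 0) ->
  \int[atom_measure m]_y phi y = \sum_(k <oo) (if b k then phi (z k) else 0).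
Proof.
move=> mphi phi0 phiD.
have -> : \int[atom_measure m]_y phi y = \int[atom_measure m]_(y in D) phi y.
  rewrite [RHS]integral_mkcond; apply: eq_integral => y _.
  by rewrite patchE; case: ifPn => // /negP yD; apply: phiD => /mem_set.
pose mu k : {measure set Z -> \bar R} :=
  if b k then [the measure _ _ of \d_(z k)] else [the measure _ _ of mzero].
rewrite (@eq_measure_integral _ _ _ _ (mseries mu 0)); last first.
  move=> A mA AD; rewrite atom_measureE atom_count_enum// /mseries.
  by apply: eq_eseriesr => k _; rewrite /mu; case: (b k).
rewrite ge0_integral_measure_series//; last exact: measurable_funTS.
apply: eq_eseriesr => k _; rewrite /mu; case: ifPn => bk.
  rewrite integral_dirac//; last exact: measurable_funTS.
  by rewrite diracE mem_set ?mul1e//; case: (z_atom bk).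
exact: integral_measure_zero.
Qed.

End enumeration.

(** The probability generating functional: a product over the atoms, written as
    an integral against their counting measure. *)
Definition pgf f m : R := expn (\int[atom_measure m]_z nlog (f z)).

Definition unit_fun f : Prop :=
  measurable_fun setT f /\ forall z, (0 <= f z <= 1)%R.

Lemma unit_funM f g : unit_fun f -> unit_fun g ->
  unit_fun (fun z => f z * g z)%R.
Proof.
move=> [mf f01] [mg g01]; split; first exact: measurable_funM.
move=> z; have /andP[f0 f1] := f01 z; have /andP[g0 g1] := g01 z.
by rewrite mulr_ge0//= mulr_ile1.
Qed.

Lemma unit_fun_cst1 : unit_fun (cst 1%R).
Proof. by split=> [|z]; [exact: measurable_cst|rewrite /= ler01 lexx]. Qed.

Lemma measurable_nlog_unit f : unit_fun f -> measurable_fun setT (@nlog R \o f).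
Proof. by move=> [mf _]; apply: measurableT_comp => //; exact: measurable_nlog. Qed.

Lemma nlog_unit_ge0 f z : unit_fun f -> 0 <= nlog (f z).
Proof. by move=> [_ f01]; apply: nlog_ge0; case/andP: (f01 z). Qed.

Lemma pgf01 f m : unit_fun f -> (0 <= pgf f m <= 1)%R.
Proof. by move=> uf; apply: expn01; apply: integral_ge0 => z _; exact: nlog_unit_ge0. Qed.

Lemma pgfM f g m : unit_fun f -> unit_fun g ->
  pgf (fun z => f z * g z)%R m = (pgf f m * pgf g m)%R.
Proof.
move=> uf ug; rewrite /pgf -expnD; last 2 first.
- by apply: integral_ge0 => z _; exact: nlog_unit_ge0.
- by apply: integral_ge0 => z _; exact: nlog_unit_ge0.
rewrite -ge0_integralD//.
- congr expn; apply: eq_integral => z _.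
  by rewrite nlogM//; [case: uf => _ /(_ z)/andP[]|case: ug => _ /(_ z)/andP[]].
- by move=> z _; exact: nlog_unit_ge0.
- exact: measurable_nlog_unit.
- by move=> z _; exact: nlog_unit_ge0.
- exact: measurable_nlog_unit.
Qed.

Lemma pgf_cst1 m : pgf (cst 1%R) m = 1%R.
Proof. by rewrite /pgf /=; under eq_integral do rewrite nlog1; rewrite integral0 expn0. Qed.

(** The sequence [z] may enumerate the atoms in [D] with gaps, marked by [b],
    as [m] may have only finitely many atoms. *)
Lemma pgf_enum f m D (b : nat -> bool) (z : nat -> Z) :
  (forall i j, b i -> b j -> z i = z j -> i = j) ->
  (forall k, b k -> atoms m (z k) /\ D (z k)) ->
  (forall y, atoms m y -> D y -> exists2 k, b k & z k = y) ->
  measurable D -> unit_fun f -> (forall y, ~ D y -> f y = 1%R) ->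
  pgf f m = iprod (fun k => if b k then f (z k) else 1%R).
Proof.
move=> zI za az mD uf fD; rewrite /pgf (integral_atom_enum zI za az)//.
- congr expn; apply: eq_eseriesr => k _; case: ifP => //.
  by rewrite nlog1.
- exact: measurable_nlog_unit.
- by move=> y; exact: nlog_unit_ge0.
- by move=> y yD; rewrite fD// nlog1.
Qed.

End atoms_of_measures.

(** * The sigma-algebra of atomic measures *)

Definition count_value (R : realType) (e : \bar R) : Prop :=
  (exists n, e = n%:R%:E)%E \/ e = +oo%E.

(** A bounded function of a count that determines the count, also when it is
    infinite. *)
Definition half_power (R : realType) (e : \bar R) : R :=
  expn ((- ln 2^-1)%:E * e)%E.

Lemma half_power_inj (R : realType) (x y : \bar R) : count_value x ->
  count_value y -> half_power x = half_power y -> x = y.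
Proof.
have lnh : 0 < - ln 2^-1 :> R by rewrite oppr_gt0 ln_lt0// invr_gt0 ltr0n invf_lt1// ltr1n.
have gy : half_power (+oo%E : \bar R) = 0 by rewrite /half_power gt0_muley ?lte_fin.
move=> [[n ->]|->] [[k ->]|->]//.
- by rewrite /half_power /= => /expR_inj/oppr_inj/(mulfI _) -> //; rewrite gt_eqF.
- by rewrite gy /half_power /= => /eqP; rewrite gt_eqF ?expR_gt0.
- by rewrite gy /half_power /= => /esym/eqP; rewrite gt_eqF ?expR_gt0.
Qed.

(** A count takes countably many values, each of them a level of
    [half_power]. *)
Lemma level_count (R : realType) (X : Type) (W : set (X -> R))
    (N : X -> \bar R) (V : set (\bar R)) :
  (forall x, count_value (N x)) -> W (fun x => half_power (N x)) ->
  <<s level_sets W >> [set x | V (N x)].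
Proof.
move=> Nc WN.
have lev e : <<s level_sets W >> [set x | half_power (N x) = half_power e].
  by apply: sub_gen_smallest; exists (fun x => half_power (N x)), (half_power e).
have [s0 sC sU] := smallest_sigma_algebra setT (level_sets W).
pose val n : \bar R := if n is k.+1 then k%:R%:E else +oo%E.
rewrite (_ : [set x | _] = \bigcup_n (if `[< V (val n) >] then
    [set x | half_power (N x) = half_power (val n)] else set0)).
  by apply: sU => n; case: ifP => _; [exact: lev|exact: s0].
apply/seteqP; split => x /=.
  move=> Vx; have [[n xn]|xn] := Nc x.
    by exists n.+1 => //; rewrite asboolT /= -?xn.
  by exists 0%N => //; rewrite asboolT /= -?xn.
move=> [n _]; case: ifPn => [/asboolP Vn|//] /= /half_power_inj -> //.
by case: n {Vn} => [|n]; [right|left; exists n].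
Qed.

Section sigma_algebra_of_atomic_measures.
Context d (Psi : measurableType d) (R : realType).
Hypothesis singletonsP : forall p : Psi, measurable [set p].
Local Notation AM := (atomic_measure Psi R).
Local Notation Z := (measurableTypeR R * Psi)%type.
Local Notation pgf := (pgf singletonsP).
Implicit Types (m : AM) (C D : set Z) (f : Z -> R).
Local Open Scope ereal_scope.

Lemma measurable_atom_count C : measurable C ->
  measurable_fun setT (fun m : AM => atom_count m C).
Proof.
by move=> mC _ V mV; rewrite setTI; apply: sub_gen_smallest; right; exists C, V.
Qed.

Lemma measurable_am (S : set Psi) : measurable S ->
  measurable_fun setT (fun m : AM => m S).
Proof.
by move=> mS _ V mV; rewrite setTI; apply: sub_gen_smallest; left; exists S, V.
Qed.

Lemma measurable_am_mass p : measurable_fun setT (fun m : AM => am_mass m p).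
Proof.
apply: (@measurableT_comp _ _ _ _ _ _ fine); first exact: fine_measurable.
exact: measurable_am.
Qed.

Lemma measurable_pgf f : unit_fun f -> measurable_fun setT (pgf f).
Proof.
move=> uf; apply: measurableT_comp; first exact: measurable_expn.
apply: (@measurable_fun_integral_kernel _ _ _ _ _ (atom_measure singletonsP)).
- by move=> U mU; under eq_fun do rewrite atom_measureE; exact: measurable_atom_count.
- by move=> z; exact: nlog_unit_ge0.
- exact: measurable_nlog_unit.
Qed.

Lemma bmeas_pgf f : unit_fun f -> bmeas (pgf f : AM -> R).
Proof. by move=> uf; apply: bmeas01 => [|m]; [exact: measurable_pgf|exact: pgf01]. Qed.

Lemma atom_count_range m C : count_value (atom_count m C).
Proof. by rewrite /atom_count /counting; case: ifPn => _; [left; eexists|right]. Qed.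

Definition step_fun (u : R) C : Z -> R := fun z => if z \in C then u else 1%R.

Lemma unit_step_fun u C : measurable C -> (0 <= u <= 1)%R ->
  unit_fun (step_fun u C).
Proof.
move=> mC u01; split; last by move=> z; rewrite /step_fun; case: ifP; rewrite ?ler01 ?lexx.
apply: measurable_fun_ifT => //.
apply: (measurable_fun_bool true); rewrite setTI (_ : _ @^-1` _ = C)//.
by apply/seteqP; split => z /=; [exact: set_mem|exact: mem_set].
Qed.

(** With the value [u] on [C] and 1 elsewhere, the product over the atoms only
    counts the atoms in [C]. *)
Lemma pgf_step_fun u C m : measurable C -> (0 < u <= 1)%R ->
  pgf (step_fun u C) m = expn ((- ln u)%:E * atom_count m C).
Proof.
move=> mC /andP[u0 u1]; rewrite /pgf.
have lnu : (0 <= - ln u)%R by rewrite oppr_ge0 ln_le0.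
under eq_integral => z _.
  rewrite (_ : nlog _ = (- ln u)%:E * (\1_C z)%:E); first over.
  rewrite /step_fun indicE; case: (z \in C); rewrite ?mule0 ?nlog1//.
  by rewrite mule1 /nlog leNgt u0.
rewrite ge0_integralZl_EFin//; last first.
  by apply/measurable_EFinP; exact: measurable_indic.
by rewrite integral_indic// setIT -(atom_measureE singletonsP).
Qed.

Definition pgfs : set (AM -> R) := [set F | exists2 f, unit_fun f & F = pgf f].

Lemma level_atom_count C (V : set (\bar R)) : measurable C ->
  <<s level_sets pgfs >> [set m | V (atom_count m C)].
Proof.
move=> mC; have h0 : (0 < 2^-1 :> R)%R by rewrite invr_gt0.
have h1 : (2^-1 <= 1 :> R)%R by rewrite invf_le1// ler1n.
apply: level_count => [m|]; first exact: atom_count_range.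
exists (step_fun (2^-1)%R C); first by apply: unit_step_fun => //; rewrite ltW.
by apply/funext => m; rewrite pgf_step_fun// h0.
Qed.

(** The locations of a decomposition into point masses may repeat, and their
    weights may vanish: only the first occurrence of a location of positive
    mass is kept. *)
Lemma am_enum m : exists (b : nat -> bool) (z : nat -> Z),
  [/\ (forall i j, b i -> b j -> z i = z j -> i = j),
      (forall k, b k -> atoms m (z k)),
      (forall y, atoms m y -> exists2 k, b k & z k = y) &
      forall S, measurable S ->
        m S = \sum_(k <oo) (if b k then ((z k).1)%:E * \d_((z k).2) S else 0)].
Proof.
have [w [q mE]] := am_atomic m.
pose first k := all (fun j => q j != q k) (iota 0 k).
have firstI i j : first i -> first j -> q i = q j -> i = j.
  wlog ij : i j / (i <= j)%N => [wl|].
    by have [/wl//|/ltnW/wl + fi fj qij] := leqP i j; move=> /(_ fj fi (esym qij)).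
  move=> _ /allP fj qij; move: ij; rewrite leq_eqVlt => /predU1P[//|ij].
  by have := fj i; rewrite mem_iota add0n ij qij eqxx => /(_ isT).
have firstE k : exists2 j, first j & q j = q k.
  elim/ltn_ind: k => k IH; have [fk|/allPn[j]] := boolP (first k); first by exists k.
  by rewrite mem_iota/= add0n => /IH[i fi <-]; rewrite negbK => /eqP <-; exists i.
exists (fun k => (am_mass m (q k) != 0%R) && first k), (fun k => (am_mass m (q k), q k)).
have q_atom p : am_mass m p != 0%R -> exists k, q k = p.
  move=> mp0; apply: contrapT => pq; move/eqP: mp0; apply.
  apply: EFin_inj; rewrite -am_massE mE// /sum_of_atoms.
  apply: eseries0 => k _ _; rewrite diracE memNset ?mule0//= => qp.
  by apply: pq; exists k.
split.
- by move=> i j /andP[_ fi] /andP[_ fj] [_]; exact: firstI.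
- by move=> k /andP[mk _]; exact/atomsP.
- move=> [y p] /atomsP[y0 my]; have [k kp] : exists k, q k = p.
    by apply: q_atom; rewrite my.
  have [j fj jk] := firstE k; exists j; last by rewrite jk kp my.
  by rewrite jk kp my y0.
- move=> S mS /=.
  have mq : measurable (range q).
    apply: countable_measurable => //.
    exact: sub_countable (card_image_le _ _) _.
  rewrite (measureDI m mS mq) [X in X + _](_ : _ = 0) ?add0e; last first.
    rewrite [LHS]mE; last exact: measurableD.
    apply: eseries0 => k _ _; rewrite diracE memNset ?mule0//= => -[_ nq].
    by apply: nq; exists k.
  pose F k := if first k then [set q k] `&` S else set0.
  have mF k : measurable (F k).
    by rewrite /F; case: ifP => // _; apply: measurableI.
  have -> : S `&` range q = \bigcup_k F k.
    apply/seteqP; split => [p [Sp [k _ kp]]|p [k _]].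
      have [j fj jk] := firstE k; exists j => //; rewrite /F fj; split => //=.
      by rewrite jk kp.
    by rewrite /F; case: ifP => // _ [-> Sk]; split => //; exists k.
  rewrite [LHS](@measure_bigcup _ _ _ (am_measure m))//; last first.
    move=> i j _ _ [p []]; rewrite /F; case: ifP => // fi [-> _].
    by case: ifP => // fj [/firstI -> //].
  rewrite [LHS]eseries_mkcond; apply: eq_eseriesr => k _; rewrite in_setT /F.
  case: (boolP (first k)) => fk; last by rewrite andbF measure0.
  rewrite andbT diracE; have [Sk|Sk] := pselect (S (q k)).
    rewrite mem_set// mule1 setIidl ?am_massE; last by move=> _ ->.
    by case: ifPn => //; rewrite negbK => /eqP ->.
  rewrite memNset//= mule0 (_ : _ `&` _ = set0) ?measure0 ?if_same//.
  by apply/seteqP; split => // p [->].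
Qed.

Lemma mass_integral m S : measurable S ->
  m S = \int[atom_measure singletonsP m]_z (`|z.1|%:E * (\1_S z.2)%:E).
Proof.
move=> mS; have [b [z [zI za az ->//]]] := am_enum m.
rewrite (integral_atom_enum singletonsP (D := setT) (b := b) (z := z) zI)//.
- apply: eq_eseriesr => k _; case: ifPn => // bk.
  have := za _ bk; case: (z k) => y q /atomsP[y0 <-] /=.
  by rewrite ger0_norm ?am_mass_ge0// diracE indicE.
- by move=> k bk; split=> //; exact: za.
- by move=> y my _; exact: az.
- apply: emeasurable_funM; apply/measurable_EFinP.
    exact: measurableT_comp measurable_fst.
  apply: (measurableT_comp (measurable_indic mS)) => //.
- by move=> y; case.
Qed.

(** The masses are integrals of counts, so the counts alone generate the
    sigma-algebra, and a count is determined by one value of a generating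
    functional. *)
Lemma am_events_level (D : set AM) : measurable D -> <<s level_sets pgfs >> D.
Proof.
apply: smallest_sub; first exact: smallest_sigma_algebra.
move=> _ [|] [C [V [mC mV ->]]]; last exact: level_atom_count.
pose X := g_sigma_algebraType (level_sets pgfs).
have : measurable_fun setT
    (fun m : X => \int[atom_measure singletonsP m]_z (`|z.1|%:E * (\1_C z.2)%:E)).
  apply: (@measurable_fun_integral_kernel _ _ X _ _ (atom_measure singletonsP)).
  - move=> U mU; under eq_fun do rewrite atom_measureE.
    by move=> _ W _; rewrite setTI; exact: level_atom_count.
  - by move=> z; rewrite mule_ge0// lee_fin.
  - apply: emeasurable_funM; apply/measurable_EFinP.
      exact: measurableT_comp measurable_fst.
    exact: (measurableT_comp (measurable_indic mC)).
move=> /(_ measurableT V mV); rewrite setTI.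
rewrite (_ : _ @^-1` V = [set m : AM | V (m C)])//.
by apply/seteqP; split => m /=; rewrite -mass_integral.
Qed.

(** The generating functionals are closed under products. *)
Lemma bspan_pgfs (D : set AM) : measurable D -> bspan pgfs \1_D.
Proof.
move=> /am_events_level; apply: bspan_indic.
- by exists (cst 1%R); [exact: unit_fun_cst1|apply/funext => m; rewrite pgf_cst1].
- move=> _ _ [f uf ->] [g ug ->]; exists (fun z => f z * g z)%R; first exact: unit_funM.
  by apply/funext => m; rewrite pgfM.
- by move=> _ m [f uf ->]; exact: pgf01.
Qed.

Lemma measurable_fun_pgf d' (Y : measurableType d') (X : Y -> AM) :
  (forall f, unit_fun f -> measurable_fun setT (pgf f \o X)) ->
  measurable_fun setT X.
Proof.
move=> mpgf _ D mD; rewrite setTI.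
suff : <<s level_sets pgfs >> `<=` [set E : set AM | measurable (X @^-1` E)].
  by apply; exact: am_events_level.
apply: smallest_sub.
  split=> [|E mE|E mE] /=; first by rewrite preimage_set0.
    by rewrite setTD preimage_setC; exact: measurableC.
  by rewrite preimage_bigcup; exact: bigcupT_measurable.
move=> _ [_ [a [[f uf ->] ->]]] /=.
have := mpgf f uf measurableT [set a] (measurable_set1 a).
by rewrite setTI.
Qed.

Lemma measurable_fun_am d' (Y : measurableType d') (X : Y -> AM) :
  (forall C, measurable C -> measurable_fun setT (fun y => atom_count (X y) C)) ->
  measurable_fun setT X.
Proof.
move=> mX; apply: measurable_fun_pgf => f uf.
apply: (measurableT_comp (@measurable_expn R)
  (g := fun y => \int[atom_measure singletonsP (X y)]_z nlog (f z))).
apply: (@measurable_fun_integral_kernel _ _ _ _ _ (atom_measure singletonsP \o X)).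
- by move=> U mU; under eq_fun do rewrite /= atom_measureE; exact: mX.
- by move=> z; exact: nlog_unit_ge0.
- exact: measurable_nlog_unit.
Qed.

End sigma_algebra_of_atomic_measures.

(** * The generating functional of a Poisson process *)

Section poisson_generating_function.
Context (R : realType).
Local Open Scope ereal_scope.

Lemma poisson_prob_sum1 (r : R) :
  \sum_(n <oo) poisson_prob r 0%N [set n] = 1 :> \bar R.
Proof.
rewrite -[RHS](@probability_setT _ _ _ (poisson_prob r 0%N)).
have -> : [set: nat] = \bigcup_n [set n] by apply/seteqP; split=> // n _; exists n.
rewrite measure_bigcup//=; last first.
  by move=> i j _ _ [k [-> ->]].
by apply: eq_eseriesl => n; rewrite in_setT.
Qed.

Lemma poisson_generating (r u : R) : (0 <= r)%R -> (0 < u)%R ->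
  \sum_(n <oo) (u ^+ n)%:E * poisson_prob r 0%N [set n] =
    (expR (- ((1 - u) * r)))%:E.
Proof.
rewrite le_eqVlt => /predU1P[<- u0|r0 u0].
  rewrite mulr0 oppr0 expR0 -[RHS](poisson_prob_sum1 0); apply: eq_eseriesr.
  move=> [|n] _; first by rewrite expr0 mul1e.
  by rewrite /poisson_prob ltxx diracE memNset ?mule0.
have ur0 : (0 < u * r)%R by rewrite mulr_gt0.
transitivity ((expR (- ((1 - u) * r)))%:E * \sum_(n <oo) poisson_prob (u * r) 0%N [set n]).
  rewrite -[RHS]nneseriesZl; last by move=> n _; exact: measure_ge0.
  apply: eq_eseriesr => n _.
  rewrite /poisson_prob r0 ur0 !esum_set1 ?lee_fin ?poisson_pmf_ge0//.
  rewrite /poisson_pmf r0 ur0 -!EFinM; congr _%:E.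
  have -> : expR (- r) = (expR (- ((1 - u) * r)) * expR (- (u * r)))%R.
    by rewrite -expRD; congr expR; ring.
  by rewrite exprMn; ring.
by rewrite poisson_prob_sum1 mule1.
Qed.

Context d (Om : measurableType d) (P : probability Om R).

Lemma expn_powern (u : R) n : (0 < u)%R -> expn ((- ln u)%:E * n%:R%:E) = (u ^+ n)%R.
Proof. by move=> u0 /=; rewrite mulNr opprK mulrC expRM_natl lnK. Qed.

(** For an infinite rate the count is infinite almost surely, and both sides
    vanish unless [u] is 1. *)
Lemma poisson_ev (N : Om -> \bar R) (r : \bar R) (u : R) :
  measurable_fun setT N -> (forall w, 0 <= N w) ->
  poisson_distributed P N r -> 0 <= r -> (0 < u <= 1)%R ->
  ev P (fun w => expn ((- ln u)%:E * N w)) = expn ((1 - u)%:E * r).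
Proof.
move=> mN N0 + + /andP[u0 u1]; have lu0 : (0 <= - ln u)%R by rewrite oppr_ge0 ln_le0.
have mF : measurable_fun setT (fun w => expn ((- ln u)%:E * N w)).
  apply: measurableT_comp; first exact: measurable_expn.
  exact: measurable_funeM.
have mNe e : measurable [set w | N w = e].
  rewrite (_ : [set w | _] = N @^-1` [set e])// -[X in measurable X]setTI.
  exact: mN.
case: r => [r|Noo _|//]; last first.
  have [->|u1'] := eqVneq u 1%R.
    rewrite subrr mul0e expn0 -[RHS](ev_cst P 1%R); congr (ev P _).
    by apply/funext => w; rewrite ln1 oppr0 mul0e expn0.
  have {}u1 : (u < 1)%R by rewrite lt_neqAle u1'.
  rewrite gt0_muley ?lte_fin ?subr_gt0//= -[RHS](ev_cst P 0%R).
  apply: ev_ae => //; exists (~` [set w | N w = +oo]); split.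
  - exact: measurableC.
  - by rewrite probability_setC// Noo subee.
  - move=> w h Nw; apply: h.
    transitivity (expn ((- ln u)%:E * +oo)); first by rewrite -Nw.
    by rewrite gt0_muley// lte_fin oppr_gt0 ln_lt0// u0.
move=> Nr; rewrite lee_fin => r0.
have F01 w : (0 <= expn ((- ln u)%:E * N w) <= 1)%R.
  by apply: expn01; rewrite mule_ge0.
have bF := bmeas01 mF F01.
pose A n := [set w | N w = n%:R%:E].
have tA : trivIset setT A.
  move=> i j _ _ [w [/= Ni Nj]]; apply/eqP; rewrite -(eqr_nat R).
  by apply/eqP/EFin_inj; rewrite -Ni -Nj.
have mU : measurable (\bigcup_n A n) by apply: bigcup_measurable => n _; exact: mNe.
have PU : P (\bigcup_n A n) = 1.
  rewrite measure_bigcup//; last by move=> n _; exact: mNe.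
  rewrite -(poisson_prob_sum1 r) [LHS](eq_eseriesl (Q := xpredT)).
    by apply: eq_eseriesr => n _; exact: Nr.
  by move=> n; rewrite in_setT.
apply: EFin_inj; rewrite EFin_ev//.
have mUC := measurableC mU.
have PUC : P (~` \bigcup_n A n) = 0 by rewrite probability_setC// PU subee.
have mFE : measurable_fun setT (fun w => (expn ((- ln u)%:E * N w))%:E).
  exact/measurable_EFinP.
rewrite (ge0_negligible_integral mUC measurableT mFE _ PUC); last first.
  by move=> w _; rewrite lee_fin; case/andP: (F01 w).
rewrite setTD setCK ge0_integral_bigcup//; last 2 first.
- exact: measurable_funTS.
- by move=> w _; rewrite lee_fin; case/andP: (F01 w).
rewrite /= -poisson_generating//; apply: eq_eseriesr => n _.
rewrite (eq_integral (cst (u ^+ n)%:E)); last first.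
  by move=> w /set_mem Nw; rewrite /= Nw -[X in expn X]/((- ln u)%:E * n%:R%:E) expn_powern.
rewrite integral_cst; last exact: mNe.
  by congr (_ * _); exact: Nr.
by move=> n; exact: mNe.
Qed.

End poisson_generating_function.

Lemma expn_sum (R : realType) (I : Type) (s : seq I) (F : I -> \bar R) :
  (forall i, (0 <= F i)%E) ->
  expn (\sum_(i <- s) F i)%E = \prod_(i <- s) expn (F i).
Proof.
move=> F0; elim: s => [|i s IH]; first by rewrite !big_nil expn0.
by rewrite !big_cons expnD ?IH// sume_ge0.
Qed.

Lemma prod_indic (R : realType) (X : Type) (I : finType) (E : I -> set X) x :
  \prod_i \1_(E i) x = \1_[set x | forall i, E i x] x :> R.
Proof.
rewrite indicE; have [h|h] := boolP (x \in _).
  rewrite big1// => i _; rewrite indicE mem_set//; exact: (set_mem h).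
have [i Ei] : exists i, ~ E i x.
  by apply/existsNP => Ex; move/negP : h; apply; exact: mem_set.
by rewrite (bigD1 i)//= indicE memNset// mul0r.
Qed.

Section simple_integral.
Context d (S : measurableType d) (R : realType).
Import HBNNSimple.

Lemma integral_comp_nnsfun (mu : {measure set S -> \bar R})
    (g : {nnsfun S >-> R}) (h : R -> R) : (forall y, 0 <= h y) ->
  (\int[mu]_z (h (g z))%:E = \sum_(y <- fset_set (range g))
     (h y)%:E * mu (g @^-1` [set y]))%E.
Proof.
move=> h0.
rewrite (eq_integral (fun z => \sum_(y <- fset_set (range g))
   ((h y)%:E * (\1_(g @^-1` [set y]) z)%:E)%E)%E); last first.
  move=> z _; have gz : g z \in fset_set (range g).
    by rewrite in_fset_set ?mem_set//; exists z.
  rewrite (bigD1_seq (g z)) ?fset_uniq//=.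
  rewrite indicE mem_set// mule1 big1 ?adde0// => y yz.
  by rewrite indicE memNset ?mule0//= => /esym/eqP; rewrite (negbTE yz).
rewrite ge0_integral_sum//; last 2 first.
- move=> y; apply: measurable_funeM; apply/measurable_EFinP.
  exact: measurable_indic.
- by move=> y z _; rewrite mule_ge0// lee_fin.
apply: eq_bigr => y _; rewrite ge0_integralZl_EFin//; last first.
  by apply/measurable_EFinP; exact: measurable_indic.
by rewrite integral_indic// setIT.
Qed.

End simple_integral.

Section poisson_processes.
Context d (Psi : measurableType d) (R : realType).
Hypothesis singletonsP : forall p : Psi, measurable [set p].
Context d' (Om : measurableType d') (P : probability Om R).
Local Notation AM := (atomic_measure Psi R).
Local Notation Z := (measurableTypeR R * Psi)%type.
Local Notation pgf := (pgf singletonsP).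
Variables (M : Om -> AM) (mu : {measure set Z -> \bar R}).
Hypothesis mM : measurable_fun setT M.
Implicit Types (C D : set Z) (f : Z -> R).
Local Open Scope ereal_scope.

Lemma measurable_count C : measurable C ->
  measurable_fun setT (fun w => atom_count (M w) C).
Proof. by move=> mC; exact: (measurableT_comp (measurable_atom_count mC) mM). Qed.

Lemma bmeas_pgf_comp f : unit_fun f -> bmeas (fun w => pgf f (M w)).
Proof.
move=> uf; apply: bmeas01 => [|w]; last exact: pgf01.
by apply: (measurableT_comp (measurable_pgf singletonsP uf) mM).
Qed.

Lemma atom_count_ge0 (m : AM) C : 0 <= atom_count m C.
Proof. by have [[n ->]|->] := atom_count_range m C. Qed.

Section forward.
Hypothesis MP : poisson_process P (fun w => atom_count (M w)) mu.
Import HBNNSimple.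

(** The levels of a simple function are finitely many disjoint sets, whose
    counts are independent Poisson variables. *)
Lemma poisson_laplace_simple (g : {nnsfun Z >-> R}) :
  ev P (fun w => expn (\int[atom_measure singletonsP (M w)]_z (g z)%:E)) =
  expn (\int[mu]_z (1 - expR (- g z))%:E).
Proof.
have [Mpois Mind] := MP.
have integralE (nu : {measure set Z -> \bar R}) (h : R -> R) :
    (forall y, (0 <= h y)%R) -> \int[nu]_z (h (g z))%:E =
    \sum_(i < size (fset_set (range g))) (h (fset_set (range g))`_i)%:E *
       nu (g @^-1` [set (fset_set (range g))`_i]).
  by move=> h0; rewrite integral_comp_nnsfun// (big_nth 0%R) big_mkord.
set s := fset_set (range g) in integralE.
pose y (i : 'I_(size s)) : R := s`_i; pose C i := g @^-1` [set y i].
have mC i : measurable (C i) by exact: measurable_sfunP.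
have tC : trivIset setT C.
  move=> i j _ _ [z [/= zi zj]]; apply: val_inj => /=.
  by apply/eqP; rewrite -(nth_uniq 0%R _ _ (fset_uniq s))// -/(y i) -zi zj.
pose N i w := atom_count (M w) (C i).
pose F i w := expn (`|y i|%:E * N i w).
have N0 i w : 0 <= N i w by exact: atom_count_ge0.
have F01 i w : (0 <= F i w <= 1)%R by apply: expn01; rewrite mule_ge0// lee_fin.
have mF i : measurable_fun setT (F i).
  apply: measurableT_comp; first exact: measurable_expn.
  by apply: measurable_funeM; exact: measurable_count.
transitivity (ev P (fun w => \prod_i F i w)%R).
  congr (ev P _); apply/funext => w; rewrite /F -expn_sum; last first.
    by move=> i; rewrite mule_ge0// lee_fin.
  congr expn; rewrite -[RHS](eq_bigr _ (fun i _ =>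
     congr1 (mule _) (atom_measureE singletonsP (M w) (C i)))).
  rewrite -(integralE (atom_measure singletonsP (M w)) Num.norm)//.
  by apply: eq_integral => z _; rewrite ger0_norm.
have -> : ev P (fun w => \prod_i F i w)%R = (\prod_i ev P (F i))%R.
  apply: (@ev_prod_bspan _ _ _ P _ (fun i => indicators
    [set E | exists2 V, measurable V & E = [set w | V (N i w)]])).
  - move=> i _ [_ [V mV ->] ->]; apply: bmeas_indic.
    rewrite (_ : [set w | _] = N i @^-1` V)// -[X in measurable X]setTI.
    exact: measurable_count.
  - move=> G GW; have /choice[V VG] : forall i, exists V : set (\bar R),
        measurable V /\ G i = \1_[set w | V (N i w)].
      by move=> i; have [_ [V mV ->] ->] := GW i; exists V.
    have mVN i : measurable [set w | V i (N i w)].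
      rewrite (_ : [set w | _] = N i @^-1` (V i))// -[X in measurable X]setTI.
      by apply: measurable_count => //; case: (VG i).
    rewrite /ev_prod (_ : (fun w => _) = \1_[set w | forall i, V i (N i w)]); last first.
      apply/funext => w; rewrite -(prod_indic R (fun i => [set w | V i (N i w)])).
      by apply: eq_bigr => i _; case: (VG i) => _ ->.
    apply: EFin_inj; rewrite ev_indic; last first.
      rewrite (_ : [set w | _] = \bigcap_(i in setT) [set w | V i (N i w)]).
        by apply: fin_bigcap_measurable => // i _; exact: mVN.
      by apply/seteqP; split => w h => [i _|i]; exact: h.
    rewrite Mind//; last by move=> i; case: (VG i).
    rewrite -prodEFin; apply: eq_bigr => i _.
    by case: (VG i) => _ ->; rewrite ev_indic.
  - move=> i; apply: bspan_superlevel; first exact: F01.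
    move=> a; exists [set e | (a <= expn (`|y i|%:E * e))%R] => //.
    rewrite -[X in measurable X]setTI.
    rewrite (_ : [set e | _] = (fun e => expn (`|y i|%:E * e)) @^-1` `[a, +oo[%classic).
      apply: (measurableT_comp (@measurable_expn R)) => //.
      exact: measurable_funeM.
    by apply/seteqP; split => e /=; rewrite in_itv/= andbT.
rewrite (eq_bigr (fun i => expn ((1 - expR (- `|y i|))%:E * mu (C i)))).
  rewrite -expn_sum; last first.
    by move=> i; rewrite mule_ge0// lee_fin subr_ge0 -[leRHS]expR0 ler_expR oppr_le0.
  congr expn; rewrite -(integralE mu (fun r => 1 - expR (- `|r|))%R).
    by apply: eq_integral => z _; rewrite ger0_norm.
  by move=> r; rewrite subr_ge0 -[leRHS]expR0 ler_expR oppr_le0.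
move=> i _; rewrite /F.
rewrite -(@poisson_ev _ _ _ P (N i))//.
- by congr (ev P _); apply/funext => w; rewrite expRK opprK.
- exact: measurable_count.
- exact: Mpois.
- by rewrite expR_gt0/= -[leRHS]expR0 ler_expR oppr_le0.
Qed.

(** Monotone approximation of [- ln f] by simple functions. *)
Lemma poisson_pgf f : unit_fun f ->
  ev P (fun w => pgf f (M w)) = expn (\int[mu]_z (1 - f z)%:E).
Proof.
move=> uf; have mphi := measurable_nlog_unit uf.
have phi0 z : 0 <= nlog (f z) by exact: nlog_unit_ge0.
pose g := nnsfun_approx measurableT mphi.
have g_cvg z : (g n z)%:E @[n --> \oo] --> nlog (f z).
  by apply: (@cvg_nnsfun_approx _ _ _ _ measurableT _ mphi) => // t _; exact: phi0.
have g_nd z n k : (n <= k)%N -> (g n z <= g k z)%R.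
  by move=> nk; have /lefP := nd_nnsfun_approx measurableT mphi nk; exact.
have int_cvg (nu : {measure set Z -> \bar R}) (h : R -> R) (psi : Z -> \bar R) :
    measurable_fun setT h -> (forall r, (0 <= r)%R -> (0 <= h r)%R) ->
    (forall r t, (0 <= r)%R -> (r <= t)%R -> (h r <= h t)%R) ->
    (forall z, (h (g n z))%:E @[n --> \oo] --> psi z) ->
    \int[nu]_z (h (g n z))%:E @[n --> \oo] --> \int[nu]_z psi z.
  move=> mh h0 hnd hpsi.
  rewrite (eq_integral (fun z => limn (fun n => (h (g n z))%:E))).
    apply: cvg_monotone_convergence => //.
    - by move=> n; apply/measurable_EFinP; exact: measurableT_comp.
    - by move=> n z _; rewrite lee_fin h0.
    - by move=> z _ n k nk; rewrite lee_fin hnd// g_nd.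
  by move=> z _; apply/esym/cvg_lim => //; exact: hpsi.
have L := poisson_laplace_simple.
have cL : ev P (fun w => expn (\int[atom_measure singletonsP (M w)]_z (g n z)%:E))
    @[n --> \oo] --> ev P (fun w => pgf f (M w)).
  have e01 n w : (0 <= expn (\int[atom_measure singletonsP (M w)]_z (g n z)%:E) <= 1)%R.
    by apply: expn01; apply: integral_ge0 => z _; rewrite lee_fin.
  apply: (@ev_cvg _ _ _ P _ _ 1%R).
  - move=> n; apply: bmeas01; last exact: e01.
    apply: (measurableT_comp (@measurable_expn R)
      (g := fun w => \int[atom_measure singletonsP (M w)]_z (g n z)%:E)).
    apply: (@measurable_fun_integral_kernel _ _ _ _ _ (atom_measure singletonsP \o M)).
    + by move=> U mU; under eq_fun do rewrite /= atom_measureE; exact: measurable_count.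
    + by move=> z; rewrite lee_fin.
    + exact/measurable_EFinP.
  - by move=> n w; have /andP[e0 e1] := e01 n w; rewrite ger0_norm.
  - move=> w; apply: expn_cvg; first by move=> n; apply: integral_ge0 => z _; rewrite lee_fin.
    exact: (int_cvg (atom_measure singletonsP (M w)) id).
have cR : expn (\int[mu]_z (1 - expR (- g n z))%:E) @[n --> \oo] -->
    expn (\int[mu]_z (1 - f z)%:E).
  apply: expn_cvg.
    move=> n; apply: integral_ge0 => z _; rewrite lee_fin.
    by rewrite subr_ge0 -[leRHS]expR0 ler_expR oppr_le0.
  apply: (int_cvg mu (fun r => 1 - expR (- r))%R).
  - apply: measurable_funB => //; apply: measurableT_comp => //.
  - by move=> r r0; rewrite subr_ge0 -[leRHS]expR0 ler_expR oppr_le0.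
  - by move=> r t r0 rt; rewrite lerD2l lerN2 ler_expR lerN2.
  - move=> z; apply/cvg_EFin; first exact: nearW.
    apply: cvgB; first exact: cvg_cst.
    have /expn_cvg := g_cvg z; rewrite expn_nlog.
      by apply => n; rewrite lee_fin.
    by case: uf => _ /(_ z)/andP[].
move: cL; under eq_fun do rewrite L.
by move=> /cvg_unique; apply.
Qed.

End forward.

End poisson_processes.

(** * Poisson processes recognized by their generating functional *)

Section law_of_a_count.
Context (R : realType).
Context d1 (Om1 : measurableType d1) (P1 : probability Om1 R).
Context d2 (Om2 : measurableType d2) (P2 : probability Om2 R).
Variables (N1 : Om1 -> \bar R) (N2 : Om2 -> \bar R).
Hypothesis mN1 : measurable_fun setT N1.
Hypothesis mN2 : measurable_fun setT N2.
Hypothesis N1c : forall w, count_value (N1 w).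
Hypothesis N2c : forall w, count_value (N2 w).

Lemma half_power01 (e : \bar R) : count_value e -> 0 <= half_power e <= 1.
Proof.
move=> ec; apply: expn01; rewrite mule_ge0 ?lee_fin//.
  by rewrite oppr_ge0 ln_le0// invf_le1// ler1n.
by case: ec => [[n ->]|->].
Qed.

Lemma bmeas_half_power d (Om : measurableType d) (N : Om -> \bar R) j :
  measurable_fun setT N -> (forall w, count_value (N w)) ->
  bmeas (fun w => half_power (N w) ^+ j).
Proof.
move=> mN Nc; apply: bmeas01.
  apply: measurable_funX; apply: (measurableT_comp (@measurable_expn R)).
  exact: measurable_funeM.
move=> w; have /andP[h0 h1] := half_power01 (Nc w).
by rewrite exprn_ge0//= exprn_ile1.
Qed.

(** The powers of [half_power] form a multiplicative family that separates
    counts. *)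
Lemma count_law_unique :
  (forall j, ev P1 (fun w => half_power (N1 w) ^+ j) =
             ev P2 (fun w => half_power (N2 w) ^+ j)) ->
  forall V, measurable V -> P1 [set w | V (N1 w)] = P2 [set w | V (N2 w)].
Proof.
move=> N12 V mV.
(* [None] stands for an infinite count. *)
pose c (x : option nat) : \bar R := if x is Some n then n%:R%:E else +oo%E.
have cc x : count_value (c x) by case: x => [n|]; [left; exists n|right].
pose enc e : option nat :=
  if e is r%:E then Some (Num.truncn (r : R)) else None : option nat.
have encK e : count_value e -> c (enc e) = e.
  by move=> [[n ->]|->] //=; rewrite natrK.
pose W : set (option nat -> R) :=
  [set F | exists j, F = fun x => half_power (c x) ^+ j].
have : bspan W \1_[set x | V (c x)].
  apply: bspan_indic.
  - by exists 0%N; apply/funext => x; rewrite expr0.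
  - move=> _ _ [i ->] [j ->]; exists (i + j)%N.
    by apply/funext => x; rewrite exprD.
  - move=> _ x [j ->]; have /andP[h0 h1] := half_power01 (cc x).
    by rewrite exprn_ge0//= exprn_ile1.
  - by apply: level_count => //; exists 1%N; apply/funext => x; rewrite expr1.
move=> /(_ [set F | [/\ bmeas (fun w => F (enc (N1 w))),
   bmeas (fun w => F (enc (N2 w))) &
   ev P1 (fun w => F (enc (N1 w))) = ev P2 (fun w => F (enc (N2 w)))]])[].
- split=> [F G [bF1 bF2 F12] [bG1 bG2 G12]|a F [bF1 bF2 F12]|F G].
  + by split; [exact: bmeasD|exact: bmeasD|rewrite !evD// F12 G12].
  + by split; [exact: bmeasZ|exact: bmeasZ|rewrite !evZ// F12].
  + move=> F12 F1 FG.
    have b1 n : bmeas (fun w => F n (enc (N1 w))) by case: (F12 n).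
    have b2 n : bmeas (fun w => F n (enc (N2 w))) by case: (F12 n).
    split; [exact: (bmeas_cvg (M := 1) b1)|exact: (bmeas_cvg (M := 1) b2)|].
    have c1 : ev P1 (fun w => F n (enc (N1 w))) @[n --> \oo] -->
        ev P1 (fun w => G (enc (N1 w))) by exact: (ev_cvg (M := 1)).
    have c2 : ev P2 (fun w => F n (enc (N2 w))) @[n --> \oo] -->
        ev P2 (fun w => G (enc (N2 w))) by exact: (ev_cvg (M := 1)).
    move: c1; rewrite (_ : (fun n => ev P1 _) = fun n => ev P2 (fun w => F n (enc (N2 w)))).
      by move=> /cvg_unique; apply.
    by apply/funext => n; case: (F12 n).
- move=> _ [j ->]; split.
  + rewrite (_ : (fun w => _) = fun w => half_power (N1 w) ^+ j).
      exact: bmeas_half_power.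
    by apply/funext => w; rewrite encK.
  + rewrite (_ : (fun w => _) = fun w => half_power (N2 w) ^+ j).
      exact: bmeas_half_power.
    by apply/funext => w; rewrite encK.
  + transitivity (ev P1 (fun w => half_power (N1 w) ^+ j)).
      by congr (ev P1 _); apply/funext => w; rewrite encK.
    by rewrite N12; congr (ev P2 _); apply/funext => w; rewrite encK.
have mV1 : measurable [set w | V (N1 w)].
  rewrite (_ : [set w | _] = N1 @^-1` V)// -[X in measurable X]setTI; exact: mN1.
have mV2 : measurable [set w | V (N2 w)].
  rewrite (_ : [set w | _] = N2 @^-1` V)// -[X in measurable X]setTI; exact: mN2.
move=> _ _; rewrite (_ : (fun w => _) = \1_[set w | V (N1 w)]); last first.
  by apply/funext => w; rewrite !indicE; congr (nat_of_bool _)%:R; apply/idP/idP =>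
    /set_mem/= h; apply: mem_set; move: h; rewrite /= encK.
rewrite (_ : (fun w => _) = \1_[set w | V (N2 w)]); last first.
  by apply/funext => w; rewrite !indicE; congr (nat_of_bool _)%:R; apply/idP/idP =>
    /set_mem/= h; apply: mem_set; move: h; rewrite /= encK.
by move=> h; have := congr1 EFin h; rewrite !ev_indic.
Qed.

End law_of_a_count.

Section poisson_processes_from_pgf.
Context d (Psi : measurableType d) (R : realType).
Hypothesis singletonsP : forall p : Psi, measurable [set p].
Context d' (Om : measurableType d') (P : probability Om R).
Local Notation AM := (atomic_measure Psi R).
Local Notation Z := (measurableTypeR R * Psi)%type.
Local Notation pgf := (pgf singletonsP).
Variables (M : Om -> AM) (mu : {measure set Z -> \bar R}).
Hypothesis mM : measurable_fun setT M.
Variables (D : set Z).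
Implicit Types C : set Z.
Hypothesis mD : measurable D.
Hypothesis pgf_mu : forall f : Z -> R, unit_fun f -> (forall z, ~ D z -> f z = 1%R) ->
  ev P (fun w => pgf f (M w)) = expn (\int[mu]_z (1 - f z)%:E)%E.
Local Open Scope ereal_scope.

Let u j : R := (2^-1 ^+ j)%R.

Let u01 j : (0 < u j <= 1)%R.
Proof. by rewrite /u exprn_gt0 ?invr_gt0//= exprn_ile1// ?invr_ge0// invf_le1// ler1n. Qed.

Let step_half j C w : measurable C ->
  pgf (step_fun (u j) C) (M w) = (half_power (atom_count (M w) C) ^+ j)%R.
Proof.
move=> mC; rewrite pgf_step_fun// /half_power.
elim: j => [|j IH]; first by rewrite /u expr0 ln1 oppr0 mul0e expn0 expr0.
have lnh : (0 <= - ln (2^-1 : R))%R.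
  by rewrite oppr_ge0 ln_le0// invf_le1// ler1n.
have lnu : (0 <= - ln (u j))%R by rewrite oppr_ge0 ln_le0//; case/andP: (u01 j).
rewrite exprS -IH -expnD; last 2 first.
- by rewrite mule_ge0 ?atom_count_ge0.
- by rewrite mule_ge0 ?atom_count_ge0.
rewrite -ge0_muleDl ?lee_fin// /u exprS lnM ?posrE ?invr_gt0 ?exprn_gt0 ?invr_gt0//.
by rewrite opprD.
Qed.

Let unit_step j C : measurable C -> unit_fun (step_fun (u j) C).
Proof. by move=> mC; apply: unit_step_fun => //; have /andP[/ltW -> ->] := u01 j. Qed.

Let int_step j C : measurable C ->
  \int[mu]_z (1 - step_fun (u j) C z)%:E = (1 - u j)%:E * mu C.
Proof.
move=> mC; have u1 : (0 <= 1 - u j)%R by rewrite subr_ge0; case/andP: (u01 j).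
rewrite (eq_integral (fun z => (1 - u j)%:E * (\1_C z)%:E)); last first.
  by move=> z _; rewrite /step_fun indicE; case: (z \in C); rewrite ?mule1// subrr mule0.
rewrite ge0_integralZl_EFin//; last by apply/measurable_EFinP; exact: measurable_indic.
by rewrite integral_indic// setIT.
Qed.

Let ev_half j C : measurable C -> C `<=` D ->
  ev P (fun w => half_power (atom_count (M w) C) ^+ j)%R = expn ((1 - u j)%:E * mu C).
Proof.
move=> mC CD; under eq_fun do rewrite -step_half//.
rewrite pgf_mu ?int_step//; first exact: unit_step.
by move=> z Dz; rewrite /step_fun memNset// => /CD.
Qed.

(** The functional at products of step functions of disjoint sets gives the
    joint generating functions of their counts. Only functions equal to 1
    outside [D] are tested, so only the atoms in [D] are described. *)
Lemma pgf_poisson : poisson_process P (fun w C => atom_count (M w) (C `&` D))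
  (fun C => mu (C `&` D)).
Proof.
split=> [C mC|n C V mC tC mV].
  have mCD : measurable (C `&` D) by exact: measurableI.
  have CDD : C `&` D `<=` D by move=> z [].
  have mN := measurable_count mM mCD.
  have Nc w : count_value (atom_count (M w) (C `&` D)) by exact: atom_count_range.
  have : 0 <= mu (C `&` D) by exact: measure_ge0.
  have := fun j => ev_half j mCD CDD.
  case: (mu (C `&` D)) => [r evr r0 k|evoo _|//].
    have inatc (w : nat) : count_value (w%:R%:E : \bar R) by left; exists w.
    have mnat : measurable_fun setT (fun w : nat => w%:R%:E : \bar R) by [].
    transitivity (poisson_prob r 0%N [set w | [set k%:R%:E : \bar R] w%:R%:E]).
      apply: (count_law_unique (P1 := P) (P2 := poisson_prob r 0%N) mN mnat Nc inatc) => //.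
      move=> j; rewrite evr.
      rewrite -(@poisson_ev _ _ _ (poisson_prob r 0%N) (fun w => w%:R%:E) r%:E)//.
      - congr (ev _ _); apply/funext => w.
        rewrite expn_powern; last by case/andP: (u01 j).
        by rewrite /half_power expn_powern ?invr_gt0// /u exprAC.
      - move=> k'; congr (poisson_prob r 0%N _).
        apply/seteqP; split => w /=; last by move=> ->.
        by move=> h; apply/eqP; rewrite -(eqr_nat R) (EFin_inj h).
    congr (poisson_prob r 0%N _); apply/seteqP; split => w /=; last by move=> ->.
    by move=> h; apply/eqP; rewrite -(eqr_nat R) (EFin_inj h).
  transitivity (P [set w | [set +oo : \bar R] (cst +oo w)]).
    apply: (count_law_unique (P1 := P) (P2 := P) (N2 := cst +oo) mN
      (measurable_cst _) Nc (fun=> or_intror erefl)) => //.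
    move=> j; rewrite evoo; case: j => [|j].
      rewrite /u expr0 subrr mul0e expn0.
      by rewrite (_ : (fun w => _) = cst 1%R) ?ev_cst//; apply/funext => w; rewrite expr0.
    rewrite gt0_muley; last first.
      rewrite lte_fin subr_gt0 /u exprn_ilt1//; rewrite ?invr_ge0// ?invf_lt1// ?ltr1n//.
    rewrite (_ : (fun w => _) = cst 0%R) ?ev_cst//; apply/funext => w.
    rewrite /half_power gt0_muley /= ?expr0n//.
    by rewrite lte_fin oppr_gt0 ln_lt0// invr_gt0 ltr0n invf_lt1// ltr1n.
  rewrite (_ : [set w | _] = setT) ?probability_setT//.
  by apply/seteqP; split.
pose N i w := atom_count (M w) (C i `&` D).
have mCD i : measurable (C i `&` D) by exact: measurableI.
have mN i : measurable_fun setT (N i) by exact: measurable_count.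
have mVN i : measurable [set w | V i (N i w)].
  rewrite (_ : [set w | _] = N i @^-1` (V i))// -[X in measurable X]setTI.
  exact: mN.
apply/esym.
have : ev_prod P (fun i => \1_[set w | V i (N i w)]).
  apply: (@ev_prod_bspan _ _ _ P _ (fun i =>
    [set F | exists j, F = fun w => (half_power (N i w) ^+ j)%R])).
  - move=> i _ [j ->]; apply: bmeas_half_power => // w; exact: atom_count_range.
  - move=> F /choice[j FE].
    have {}FE i : F i = fun w => pgf (step_fun (u (j i)) (C i `&` D)) (M w).
      by rewrite FE; apply/funext => w; rewrite step_half.
    pose f z := (\prod_i step_fun (u (j i)) (C i `&` D) z)%R.
    have pgf_prod (r : seq 'I_n) m :
        unit_fun (fun z => \prod_(i <- r) step_fun (u (j i)) (C i `&` D) z)%R /\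
        pgf (fun z => \prod_(i <- r) step_fun (u (j i)) (C i `&` D) z)%R m =
        (\prod_(i <- r) pgf (step_fun (u (j i)) (C i `&` D)) m)%R.
      elim: r => [|i r [ur IH]].
        under eq_fun do rewrite big_nil; rewrite big_nil.
        by split; [exact: unit_fun_cst1|exact: pgf_cst1].
      under eq_fun do rewrite big_cons; rewrite big_cons -IH.
      split; last by rewrite pgfM//; exact: unit_step.
      by apply: unit_funM => //; exact: unit_step.
    rewrite /ev_prod; under eq_fun do under eq_bigr do rewrite FE.
    under eq_fun do rewrite -(pgf_prod _ _).2.
    rewrite pgf_mu; last 2 first.
    + by case: (pgf_prod (index_enum 'I_n) point).
    + move=> z Dz; rewrite big1// => i _; rewrite /step_fun memNset// => -[_].
      exact: Dz.
    rewrite (eq_bigr (fun i => expn ((1 - u (j i))%:E * mu (C i `&` D)))); last first.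
      move=> i _; rewrite FE; under eq_fun do rewrite step_half//.
      by rewrite ev_half// => z [].
    rewrite -expn_sum; last first.
      move=> i; rewrite mule_ge0// lee_fin subr_ge0; by case/andP: (u01 (j i)).
    congr expn.
    rewrite (eq_bigr (fun i =>
      \int[mu]_z (1 - step_fun (u (j i)) (C i `&` D) z)%:E)); last first.
      by move=> i _; rewrite int_step.
    rewrite -ge0_integral_sum//; last 2 first.
    + move=> i; apply/measurable_EFinP; apply: measurable_funB => //.
      by case: (unit_step (j i) (mCD i)).
    + move=> i z _; rewrite lee_fin subr_ge0.
      by case: (unit_step (j i) (mCD i)) => _ /(_ z)/andP[].
    apply: eq_integral => z _; rewrite sumEFin; congr _%:E.
    have [[i Ci]|nC] := pselect (exists i, (C i `&` D) z).
      have other k : k != i -> step_fun (u (j k)) (C k `&` D) z = 1%R.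
        move=> ki; rewrite /step_fun memNset// => Ck; move/eqP : ki; apply.
        by apply: tC => //; exists z; split; [case: Ck|case: Ci].
      rewrite (bigD1 i)//= big1 ?mulr1; last by move=> k /other.
      rewrite [RHS](bigD1 i)//= big1 ?addr0// => k /other ->.
      by rewrite subrr.
    rewrite !big1 ?subrr// => i _; rewrite /step_fun memNset ?subrr// => Ci;
      by apply: nC; exists i.
  - move=> i; apply: bspan_indic.
    + by exists 0%N; apply/funext => w; rewrite expr0.
    + move=> _ _ [a ->] [b ->]; exists (a + b)%N.
      by apply/funext => w; rewrite exprD.
    + move=> _ w [j ->]; have /andP[h0 h1] := half_power01 (atom_count_range (M w) (C i `&` D)).
      by rewrite exprn_ge0//= exprn_ile1.
    + apply: level_count; first by move=> w; exact: atom_count_range.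
      by exists 1%N; apply/funext => w; rewrite expr1.
rewrite /ev_prod (_ : (fun w => _) = \1_[set w | forall i, V i (N i w)]); last first.
  by apply/funext => w; rewrite -(prod_indic R (fun i => [set w | V i (N i w)])).
move=> /(congr1 (@EFin R)); rewrite ev_indic; last first.
  rewrite (_ : [set w | _] = \bigcap_(i in setT) [set w | V i (N i w)]).
    by apply: fin_bigcap_measurable => // i _; exact: mVN.
  by apply/seteqP; split => w Vw => [i _|i]; exact: Vw.
move=> PE; apply: (etrans _ (esym PE)); rewrite -prodEFin.
by apply: eq_bigr => i _; rewrite ev_indic.
Qed.

End poisson_processes_from_pgf.

(** * Mixtures, densities and rate measures *)

Section mixture_measures.
Context (R : realType) d0 (S : measurableType d0) d (Z : measurableType d).
Variables (nu : {measure set S -> \bar R}) (D : set S) (r : S -> R)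
  (k : S -> {measure set Z -> \bar R}).
Hypothesis mD : measurable D.
Hypothesis mr : measurable_fun D r.
Hypothesis r0 : forall s, D s -> 0 <= r s.
Hypothesis mk : forall C, measurable C -> measurable_fun setT (k ^~ C).
Local Open Scope ereal_scope.

(** Point masses [k s] give measures with a density, and the laws of [(s, q)],
    with [q] drawn from [G], give the rate measures of completely random
    measures. *)
Definition mix_fun (C : set Z) : \bar R := \int[nu]_(s in D) ((r s)%:E * k s C).

Let mix0 : mix_fun set0 = 0.
Proof. by rewrite /mix_fun integral0_eq// => s _; rewrite measure0 mule0. Qed.

Let mix_ge0 C : 0 <= mix_fun C.
Proof. by apply: integral_ge0 => s Ds; rewrite mule_ge0// lee_fin r0. Qed.

Let mrk (F : S -> \bar R) : measurable_fun setT F ->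
  measurable_fun D (fun s => (r s)%:E * F s).
Proof.
move=> mF; apply: emeasurable_funM; first exact/measurable_EFinP.
exact: measurable_funTS.
Qed.

Let mix_sigma_additive : semi_sigma_additive mix_fun.
Proof.
move=> F mF tF mUF.
rewrite /mix_fun [X in _ --> X](_ : _ = \sum_(i <oo) mix_fun (F i)).
  by apply: is_cvg_nneseries => n _ _; exact: mix_ge0.
rewrite -integral_nneseries//; last 2 first.
- by move=> n; apply: mrk; exact: mk.
- by move=> n s Ds; rewrite mule_ge0// lee_fin r0.
apply: eq_integral => s /set_mem Ds; rewrite nneseriesZl//.
congr (_ * _); rewrite measure_semi_bigcup//.
Qed.

Definition mixture : set Z -> \bar R := mix_fun.

HB.instance Definition _ := isMeasure.Build _ _ _ mixture
  mix0 mix_ge0 mix_sigma_additive.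

Definition mixture_measure : {measure set Z -> \bar R} := mixture.

Lemma mixtureE C : mixture_measure C = \int[nu]_(s in D) ((r s)%:E * k s C).
Proof. by []. Qed.

Import HBNNSimple.

Lemma integral_mixture (phi : Z -> \bar R) : measurable_fun setT phi ->
  (forall z, 0 <= phi z) ->
  \int[mixture_measure]_z phi z =
  \int[nu]_(s in D) ((r s)%:E * \int[k s]_z phi z).
Proof.
move=> mphi phi0; pose g := nnsfun_approx measurableT mphi.
have g_cvg z : (g n z)%:E @[n --> \oo] --> phi z.
  exact: (@cvg_nnsfun_approx _ _ _ _ measurableT _ mphi).
have g_nd z n j : (n <= j)%N -> (g n z <= g j z)%R.
  by move=> nj; have /lefP := nd_nnsfun_approx measurableT mphi nj; exact.
have int_cvg (mu : {measure set Z -> \bar R}) :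
    \int[mu]_z (g n z)%:E @[n --> \oo] --> \int[mu]_z phi z.
  rewrite (eq_integral (fun z => limn (fun n => (g n z)%:E))).
    apply: cvg_monotone_convergence => //.
    - by move=> n; apply/measurable_EFinP.
    - by move=> n z _; rewrite lee_fin.
    - by move=> z _ n j nj; rewrite lee_fin g_nd.
  by move=> z _; apply/esym/cvg_lim => //; exact: g_cvg.
have int_nd (mu : {measure set Z -> \bar R}) n j : (n <= j)%N ->
    \int[mu]_z (g n z)%:E <= \int[mu]_z (g j z)%:E.
  move=> nj; apply: ge0_le_integral => //.
  - by move=> z _; rewrite lee_fin.
  - exact/measurable_EFinP.
  - exact/measurable_EFinP.
  - by move=> z _; rewrite lee_fin g_nd.
have mint n : measurable_fun setT (fun s => \int[k s]_z (g n z)%:E).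
  apply: measurable_fun_integral_kernel => //.
  - by move=> z; rewrite lee_fin.
  - exact/measurable_EFinP.
have int0 (mu : {measure set Z -> \bar R}) n : 0 <= \int[mu]_z (g n z)%:E.
  by apply: integral_ge0 => z _; rewrite lee_fin.
have simple n : \int[mixture_measure]_z (g n z)%:E =
    \int[nu]_(s in D) ((r s)%:E * \int[k s]_z (g n z)%:E).
  have simpleE (mu : {measure set Z -> \bar R}) : \int[mu]_z (g n z)%:E =
      \sum_(y <- fset_set (range (g n))) `|y|%:E * mu (g n @^-1` [set y]).
    rewrite -(integral_comp_nnsfun mu (g n) (h := Num.norm))//.
    by apply: eq_integral => z _; rewrite ger0_norm.
  rewrite simpleE.
  under [RHS]eq_integral do rewrite simpleE.
  rewrite [RHS](eq_integral (fun s => \sum_(y <- fset_set (range (g n)))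
      `|y|%:E * ((r s)%:E * k s (g n @^-1` [set y])))); last first.
    move=> s /set_mem Ds; rewrite ge0_sume_distrr; last first.
      by move=> y _; rewrite mule_ge0.
    by apply: eq_bigr => y _; rewrite muleCA.
  have mky y : measurable_fun setT (fun s => k s (g n @^-1` [set y])).
    by apply: mk; exact: measurable_sfunP.
  rewrite ge0_integral_sum//; last 2 first.
  - by move=> y; apply: measurable_funeM; apply: mrk.
  - by move=> y s Ds; rewrite !mule_ge0// lee_fin r0.
  apply: eq_bigr => y _; rewrite ge0_integralZl_EFin//; last 2 first.
  - by move=> s Ds; rewrite mule_ge0// lee_fin r0.
  - exact: mrk.
have c1 := int_cvg mixture_measure.
have c2 : \int[nu]_(s in D) ((r s)%:E * \int[k s]_z (g n z)%:E) @[n --> \oo] -->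
    \int[nu]_(s in D) ((r s)%:E * \int[k s]_z phi z).
  rewrite (eq_integral (fun s => limn (fun n => (r s)%:E * \int[k s]_z (g n z)%:E))).
    apply: cvg_monotone_convergence => //.
    - by move=> n; exact: mrk.
    - by move=> n s Ds; rewrite mule_ge0// lee_fin r0.
    - by move=> s Ds n j nj; rewrite lee_wpmul2l// ?lee_fin ?r0//; exact: int_nd.
  move=> s /set_mem Ds; apply/esym/cvg_lim => //.
  by apply: cvgeZl => //; exact: int_cvg.
move: c1; under eq_fun do rewrite simple.
by move=> /cvg_unique; apply.
Qed.

End mixture_measures.

Section image_probability.
Context d1 d2 (S : measurableType d1) (U : measurableType d2) (R : realType).
Variables (P : probability S R) (f : S -> U) (mf : measurable_fun setT f).

Definition mfun_of : {mfun S >-> U} := HB.pack f (isMeasurableFun.Build _ _ _ _ f mf).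

Definition image_prob : probability U R := distribution P mfun_of.

Lemma image_probE A : image_prob A = P (f @^-1` A).
Proof. by []. Qed.

End image_probability.

Section density.
Context (R : realType).
Variables (T : set R) (f : R -> R).
Hypothesis mT : measurable T.
Hypothesis mf : measurable_fun T f.
Hypothesis f0 : forall t, T t -> 0 <= f t.
Local Open Scope ereal_scope.

Let mdirac : forall C, measurable C ->
  measurable_fun setT (fun t : R => (\d_t : {measure set R -> \bar R}) C).
Proof.
move=> C mC; rewrite (_ : (fun t => _) = fun t => (\1_C t)%:E).
  by apply/measurable_EFinP; exact: measurable_indic.
by apply/funext => t; rewrite indicE.
Qed.

Definition density_measure : {measure set R -> \bar R} :=
  mixture_measure lebesgue_measure mT mf f0 mdirac.

Lemma density_measureE V : measurable V ->
  density_measure V = \int[lebesgue_measure]_(t in V `&` T) (f t)%:E.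
Proof.
move=> mV; rewrite [LHS]mixtureE integral_mkcondl; apply: eq_integral => t _.
rewrite [X in _ * X](_ : _ = (t \in V)%:R%:E); last by rewrite -indicE.
by rewrite patchE; case: (t \in V); rewrite ?mule1 ?mule0.
Qed.

Lemma integral_density (phi : R -> \bar R) : measurable_fun setT phi ->
  (forall t, 0 <= phi t) -> \int[density_measure]_t phi t =
  \int[lebesgue_measure]_(t in T) ((f t)%:E * phi t).
Proof.
move=> mphi phi0; rewrite [LHS]integral_mixture//; apply: eq_integral => t _.
by rewrite integral_dirac// diracT mul1e.
Qed.

Hypothesis f1 : \int[lebesgue_measure]_(t in T) (f t)%:E = 1.

Definition density_fun := (density_measure : set R -> \bar R).

HB.instance Definition _ := Measure.on density_fun.

Let density1 : density_fun setT = 1.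
Proof. by rewrite /density_fun density_measureE// setTI. Qed.

HB.instance Definition _ := Measure_isProbability.Build _ _ _ density_fun density1.

Definition density_prob : probability R R := density_fun.

Lemma density_probE V : measurable V ->
  density_prob V = \int[lebesgue_measure]_(t in V `&` T) (f t)%:E.
Proof. exact: density_measureE. Qed.

Lemma ev_density (g : R -> R) : measurable_fun setT g ->
  (forall t, 0 <= g t <= 1)%R ->
  (ev density_prob g)%:E = \int[lebesgue_measure]_(t in T) (f t * g t)%:E.
Proof.
move=> mg g01; rewrite EFin_ev; last exact: bmeas01.
rewrite [LHS]integral_density//; first exact/measurable_EFinP.
by move=> t; rewrite lee_fin; case/andP: (g01 t).
Qed.

End density.

Section rate.
Context (R : realType) d (Psi : measurableType d).
Variables (T : set R) (r : R -> R) (G : probability Psi R).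
Hypothesis mT : measurable T.
Hypothesis mr : measurable_fun T r.
Hypothesis r0 : forall t, T t -> 0 <= r t.
Local Notation Z := (measurableTypeR R * Psi)%type.
Local Open Scope ereal_scope.

Let slice (t : R) : {measure set Z -> \bar R} :=
  image_prob G (@measurable_pair1 _ _ (measurableTypeR R) Psi t).

Let slice_fun (C : set Z) : measurable C -> measurable_fun setT (slice ^~ C).
Proof.
move=> mC; rewrite (_ : slice ^~ C = G \o xsection C).
  exact: measurable_fun_xsection.
by apply/funext => t /=; rewrite xsectionE.
Qed.

Definition rate_measure : {measure set Z -> \bar R} :=
  mixture_measure lebesgue_measure mT mr r0 slice_fun.

Lemma rate_measureE C : rate_measure C =
  \int[lebesgue_measure]_(t in T) ((r t)%:E * G (xsection C t)).
Proof.
rewrite [LHS]mixtureE; apply: eq_integral => t _; congr (_ * _).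
by rewrite xsectionE.
Qed.

Lemma integral_rate (phi : Z -> \bar R) : measurable_fun setT phi ->
  (forall z, 0 <= phi z) -> \int[rate_measure]_z phi z =
  \int[lebesgue_measure]_(t in T) ((r t)%:E * \int[G]_q phi (t, q)).
Proof.
move=> mphi phi0; rewrite [LHS]integral_mixture//; apply: eq_integral => t _.
congr (_ * _); rewrite [LHS]ge0_integral_pushforward//.
Qed.

End rate.

(** * The generating functional of a completely random measure *)

Lemma prod_option (R : comPzSemiRingType) (I : finType) (F : option I -> R) :
  \prod_o F o = F None * \prod_i F (Some i).
Proof.
rewrite (bigD1 None)//=; congr (_ * _).
rewrite (reindex_omap Some id)//=; last by case.
by apply: eq_bigl => i; rewrite eqxx.
Qed.

Lemma iprod_finite (R : realType) (u : nat -> R) n :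
  (forall k, 0 <= u k <= 1) -> (forall k, (n <= k)%N -> u k = 1) ->
  iprod u = \prod_(k < n) u k.
Proof.
move=> u01 un1; apply: (cvg_unique _ (iprod_cvg u01)) => //.
apply: cvg_near_cst; exists n => // j /= nj.
rewrite -!(big_mkord xpredT u) (@big_cat_nat _ _ _ n)//= [X in _ * X]big_nat_cond.
by rewrite [X in _ * X]big1 ?mulr1// => k; rewrite andbT => /andP[/un1].
Qed.

Section comparing_pgf.
Context d (Psi : measurableType d) (R : realType).
Hypothesis singletonsP : forall p : Psi, measurable [set p].
Local Notation AM := (atomic_measure Psi R).
Local Notation Z := (measurableTypeR R * Psi)%type.
Local Notation pgf := (pgf singletonsP).
Implicit Types (m : AM) (C D : set Z) (f : Z -> R).

Let measurable_neq1 f : unit_fun f -> measurable [set z | f z != 1].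
Proof.
move=> [mf _]; rewrite (_ : [set z | _] = ~` (f @^-1` [set 1])).
  by apply: measurableC; rewrite -[X in measurable X]setTI; exact: mf.
by apply/seteqP; split => z /= /eqP.
Qed.

(** Atoms at which the function is 1 do not contribute. *)
Lemma pgf_ext m m' f f' : unit_fun f -> unit_fun f' ->
  (forall z, atoms m z -> f z != 1 -> atoms m' z /\ f z = f' z) ->
  (forall z, atoms m' z -> f' z != 1 -> atoms m z /\ f z = f' z) ->
  pgf f m = pgf f' m'.
Proof.
move=> uf uf' ff' f'f.
have [b [z [zI za az _]]] := am_enum singletonsP m.
rewrite (@pgf_enum _ _ _ singletonsP f m [set z | f z != 1]
  (fun k => b k && (f (z k) != 1)) z)//; last 5 first.
- by move=> i j /andP[bi _] /andP[bj _]; exact: zI.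
- by move=> k /andP[bk fk]; split=> //; exact: za.
- by move=> y my fy; have [k bk zk] := az _ my; exists k => //; rewrite bk zk fy.
- exact: measurable_neq1.
- by move=> y /negP; rewrite negbK => /eqP.
rewrite (@pgf_enum _ _ _ singletonsP f' m' [set z | f' z != 1]
  (fun k => b k && (f (z k) != 1)) z)//; last 5 first.
- by move=> i j /andP[bi _] /andP[bj _]; exact: zI.
- move=> k /andP[bk fk]; have [my' fE] := ff' _ (za _ bk) fk.
  by split=> //=; rewrite -fE.
- move=> y my fy; have [my' fE] := f'f _ my fy.
  by have [k bk zk] := az _ my'; exists k => //; rewrite bk zk fE fy.
- exact: measurable_neq1.
- by move=> y /negP; rewrite negbK => /eqP.
apply: iprod_eq => k; case: ifPn => // /andP[bk fk].
by have [_ ->] := ff' _ (za _ bk) fk.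
Qed.

Lemma pgf_fin m f (l : seq Z) : unit_fun f -> uniq l ->
  (forall z, z \in l -> atoms m z) ->
  (forall z, atoms m z -> f z != 1 -> z \in l) ->
  pgf f m = \prod_(z <- l) f z.
Proof.
move=> uf ul la al; pose y0 : Z := point.
have f01 z : 0 <= f z <= 1 by case: uf.
rewrite (@pgf_enum _ _ _ singletonsP f m [set z | f z != 1]
  (fun k => (k < size l)%N && (f (nth y0 l k) != 1)) (nth y0 l))//; last 5 first.
- move=> i j /andP[il _] /andP[jl _] /eqP.
  by rewrite (nth_uniq y0 il jl ul) => /eqP.
- by move=> k /andP[kl fk]; split=> //; apply: la; exact: mem_nth.
- move=> y my fy; have yl := al _ my fy; exists (index y l).
    by rewrite index_mem yl nth_index.
  by rewrite nth_index.
- exact: measurable_neq1.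
- by move=> y /negP; rewrite negbK => /eqP.
rewrite (@iprod_finite _ _ (size l)).
- rewrite (big_nth y0) big_mkord; apply: eq_bigr => k _; rewrite ltn_ord/=.
  by case: eqP => //= ->.
- by move=> k; case: ifP; rewrite ?ler01 ?lexx.
- by move=> k lk; rewrite ltnNge lk.
Qed.

Context d' (Om : measurableType d') (P : probability Om R).
Variables (Theta : Om -> AM) (T : set R) (K : nat) (p : 'I_K -> Psi)
  (f : 'I_K -> R -> R) (mu : {measure set Z -> \bar R})
  (rho : 'I_K -> probability R R).
Hypothesis mTheta : measurable_fun setT Theta.
Hypothesis mT : measurable T.
Hypothesis T_ge0 : forall t, T t -> 0 <= t.
Hypothesis mf : forall k, measurable_fun T (f k).
Hypothesis rhoE : forall k V, measurable V ->
  rho k V = (\int[lebesgue_measure]_(t in V `&` T) (f k t)%:E)%E.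
Hypothesis mup : forall k, mu (setT `*` [set p k]) = 0%E.
Hypothesis crm : crm_with P Theta T p f mu.

(** The intensity does not charge the fixed locations and the weights there are
    positive almost surely, so the atoms of [Theta] are the disjoint union of
    the fixed atoms and of the atoms of the Poisson component; independence
    turns the product over both into a product of expectations. *)
Lemma pgf_crm g : unit_fun g -> ev P (fun w => pgf g (Theta w)) =
  (\prod_k ev (rho k) (fun t => g (t, p k))) *
  expn (\int[mu]_z (1 - g z)%:E)%E.
Proof.
move=> ug; case: crm => pI [tfix [Tord [[mtfix mTord] ThetaE tfixE Tpois Tind]]].
have good_fix k : {ae P, forall w, 0 < tfix k w}.
  exists (tfix k @^-1` (~` T `|` [set 0])); split.
  - rewrite -[X in measurable X]setTI; apply: mtfix => //.
    by apply: measurableU => //; exact: measurableC.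
  - rewrite tfixE; last by apply: measurableU => //; exact: measurableC.
    apply: null_set_integral => //.
    + apply: measurableI => //; apply: measurableU => //; exact: measurableC.
    + by apply/measurable_EFinP; apply: measurable_funS (mf k) => // t [].
    + apply: (@subset_measure0 _ _ _ lebesgue_measure _ [set 0]) => //.
      * by apply: measurableI => //; apply: measurableU => //; exact: measurableC.
      * by move=> t [[|]].
      * exact: lebesgue_measure_set1.
  - move=> w /= h; have [Tw|] := pselect (T (tfix k w)); last by left.
    right => /=; apply/eqP; rewrite eq_le T_ge0// andbT leNgt.
    by apply/negP => /h.
have good_ord k : {ae P, forall w, am_mass (Tord w) (p k) = 0}.
  pose S : set Z := setT `*` [set p k].
  have mS : measurable S by exact: measurableX.
  have mN := measurable_count mTord mS.
  have [Pois _] := Tpois; have := Pois _ mS; rewrite [mu _]mup => /(_ 0%N).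
  rewrite /poisson_prob ltxx diracE mem_set// => N0.
  have mN0 : measurable [set w | atom_count (Tord w) S = 0%:E].
    rewrite (_ : [set w | _] = (fun w => atom_count (Tord w) S) @^-1` [set 0%:E])//.
    by rewrite -[X in measurable X]setTI; exact: mN.
  exists (~` [set w | atom_count (Tord w) S = 0%:E]); split.
  - exact: measurableC.
  - by rewrite probability_setC// N0 subee.
  - move=> w /= h N0w; apply: h; apply/eqP; apply: contraPT N0w => m0.
    have : (atoms (Tord w) `&` S) (am_mass (Tord w) (p k), p k).
      by split=> //; exact/atomsP.
    rewrite /atom_count /counting => a0; case: ifPn => // /asboolP fS.
    move=> /eqP; rewrite eqe pnatr_eq0 cardfs_eq0 => /eqP/fset_set_set0 S0.
    by move: a0; rewrite S0.
(* The parts of [g] at the fixed locations and at the other ones. *)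
pose gA z := if z.2 \in range p then g z else 1.
pose gB z := if z.2 \in range p then 1 else g z.
have mrange : measurable (range p).
  by apply: countable_measurable => //; exact: sub_countable (card_image_le _ _) _.
have mb : measurable_fun setT (fun z : Z => z.2 \in range p).
  apply: (measurable_fun_bool true); rewrite setTI.
  rewrite (_ : _ @^-1` _ = setT `*` range p); first exact: measurableX.
  by apply/seteqP; split => z /=; [move=> /set_mem|move=> [_ /mem_set]].
have [mg g01] := ug.
have uA : unit_fun gA.
  split; first exact: measurable_fun_ifT.
  by move=> z; rewrite /gA; case: ifP; rewrite ?ler01 ?lexx.
have uB : unit_fun gB.
  split; first exact: measurable_fun_ifT.
  by move=> z; rewrite /gB; case: ifP; rewrite ?ler01 ?lexx.
have mgp k : measurable_fun setT (fun t : R => g (t, p k)).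
  by apply: (measurableT_comp mg); exact: measurable_pair2.
have gE : {ae P, forall w,
    pgf g (Theta w) = \prod_k g (tfix k w, p k) * pgf g (Tord w)}.
  have good : {ae P, forall w, forall k, 0 < tfix k w /\ am_mass (Tord w) (p k) = 0}.
    by apply: filter_forall => k; apply: filterS2 (good_fix k) (good_ord k) => w.
  apply: filterS2 good ThetaE => w gw Tw.
  have mass q : am_mass (Theta w) q = \sum_k tfix k w * (q == p k)%:R + am_mass (Tord w) q.
    apply: EFin_inj; rewrite -am_massE Tw// EFinD -am_massE; congr (_ + _)%E.
    rewrite -sumEFin; apply: eq_bigr => k _.
    rewrite EFinM diracE; case: eqP => [->|qp]; first by rewrite mem_set.
    by rewrite memNset// => pq; apply: qp; rewrite -pq.
  have massp k : am_mass (Theta w) (p k) = tfix k w.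
    rewrite mass (bigD1 k)//= eqxx mulr1 big1 ?addr0; last first.
      by move=> j jk; rewrite (inj_eq pI) eq_sym (negbTE jk) mulr0.
    by case: (gw k) => _ ->; rewrite addr0.
  have massN q : ~ range p q -> am_mass (Theta w) q = am_mass (Tord w) q.
    move=> pq; rewrite mass big1 ?add0r// => k _.
    by case: eqP => [qk|]; rewrite ?mulr0//; case: pq; exists k.
  rewrite (_ : pgf g (Theta w) = pgf gA (Theta w) * pgf gB (Theta w)); last first.
    rewrite -pgfM//; congr (pgf _ _); apply/funext => z; rewrite /gA /gB.
    by case: ifP; rewrite ?mulr1 ?mul1r.
  congr (_ * _).
    rewrite (@pgf_fin _ _ [seq (tfix k w, p k) | k <- enum 'I_K])//.
    - rewrite big_map big_enum/=; apply: eq_bigr => k _.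
      by rewrite /gA /= mem_set//; exists k.
    - by rewrite map_inj_uniq ?enum_uniq// => i j [_ /pI].
    - move=> _ /mapP[k _ ->]; apply/atomsP; split => //.
      by rewrite gt_eqF//; case: (gw k).
    - move=> [y q] /atomsP[y0 my]; rewrite /gA /=; case: ifPn => [|_]; last by rewrite eqxx.
      move=> /set_mem[k _ kq] _; apply/mapP; exists k; rewrite ?mem_enum//.
      by rewrite -kq -massp kq my.
  apply: pgf_ext => // -[y q] /atomsP[y0 my].
    rewrite /gB /=; case: ifPn => [|/negP pq]; first by rewrite eqxx.
    by move=> _; split=> //; apply/atomsP; split => //; rewrite -massN// => /mem_set.
  move=> gy; have pq : ~ range p q.
    by move=> [k _ kq]; move: y0; rewrite -my -kq; case: (gw k) => _ ->; rewrite eqxx.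
  split; last by rewrite /gB /= memNset.
  by apply/atomsP; split => //; rewrite massN.
(* [None] is the index of the Poisson component. *)
pose F (o : option 'I_K) w := if o is Some k then g (tfix k w, p k) else pgf g (Tord w).
have mF o : measurable_fun setT (F o).
  case: o => [k|] /=; first exact: (measurableT_comp (mgp k) (mtfix k)).
  by case: (bmeas_pgf_comp singletonsP mTord ug).
have F01 o w : 0 <= F o w <= 1 by case: o => [k|] //=; exact: pgf01.
have bF o : bmeas (F o) by apply: bmeas01.
have -> : ev P (fun w => pgf g (Theta w)) = ev P (fun w => \prod_o F o w).
  apply: ev_ae.
  - by case: (bmeas_pgf_comp singletonsP mTheta ug).
  - by case: (bmeas_prod (index_enum (option 'I_K)) bF).
  - apply: filterS gE => w ->; rewrite prod_option/= mulrC; congr (_ * _).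
have -> : ev P (fun w => \prod_o F o w) = \prod_o ev P (F o).
  apply: (@ev_prod_bspan _ _ _ P _ (fun o => indicators
    [set E | if o is Some k then exists2 V, measurable V & E = tfix k @^-1` V
             else exists2 D, measurable D & E = Tord @^-1` D])).
  - move=> [k|] _ [_ [V mV ->] ->]; apply: bmeas_indic.
      by rewrite -[X in measurable X]setTI; exact: mtfix.
    by rewrite -[X in measurable X]setTI; exact: mTord.
  - move=> H HW.
    have /choice[V VH] : forall k, exists V : set R,
        measurable V /\ H (Some k) = \1_(tfix k @^-1` V).
      by move=> k; have [_ [V mV ->] ->] := HW (Some k); exists V.
    have [_ [D mD ->] HD] := HW None.
    have mVk k : measurable (tfix k @^-1` V k).
      by rewrite -[X in measurable X]setTI; apply: mtfix => //; case: (VH k).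
    have mVall : measurable [set w | forall k, V k (tfix k w)].
      rewrite (_ : [set w | _] = \bigcap_(k in setT) (tfix k @^-1` V k)).
        by apply: fin_bigcap_measurable => // i _; exact: mVk.
      by apply/seteqP; split => w h => [i _|i]; exact: h.
    have mDT : measurable (Tord @^-1` D).
      by rewrite -[X in measurable X]setTI; exact: mTord.
    rewrite /ev_prod prod_option/=.
    rewrite (_ : (fun w => _) =
        \1_([set w | forall k, V k (tfix k w)] `&` Tord @^-1` D)); last first.
      apply/funext => w; rewrite prod_option/= HD indicI mulrC; congr (_ * _).
      rewrite -(prod_indic R (fun k => tfix k @^-1` V k)).
      by apply: eq_bigr => k _; case: (VH k) => _ ->.
    apply: EFin_inj; rewrite ev_indic; last exact: measurableI.
    rewrite Tind//; last by move=> k; case: (VH k).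
    rewrite EFinM HD ev_indic// muleC -prodEFin; congr (_ * _)%E.
    by apply: eq_bigr => k _; case: (VH k) => _ ->; rewrite ev_indic.
  - move=> o; apply: bspan_superlevel => [w|a]; first exact: F01.
    case: o => [k|] /=.
    + exists [set t | a <= g (t, p k)] => //.
      rewrite -[X in measurable X]setTI.
      rewrite (_ : [set t | _] = (fun t => g (t, p k)) @^-1` `[a, +oo[%classic); first exact: mgp.
      by apply/seteqP; split => e /=; rewrite in_itv/= andbT.
    + exists [set m | a <= pgf g m] => //.
      rewrite -[X in measurable X]setTI.
      rewrite (_ : [set t | _] = pgf g @^-1` `[a, +oo[%classic); first exact: measurable_pgf.
      by apply/seteqP; split => e /=; rewrite in_itv/= andbT.
rewrite prod_option/= mulrC; congr (_ * _).
  apply: eq_bigr => k _; rewrite (ev_pushforward (P := P) (mtfix k))//.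
    by move=> V mV; rewrite rhoE// tfixE.
  by apply: bmeas01.
exact: poisson_pgf.
Qed.

End comparing_pgf.

(** * Independent marks *)

Lemma cvg_prodr (R : realType) (I : Type) (s : seq I) (u : I -> nat -> R)
    (l : I -> R) : (forall i, u i n @[n --> \oo] --> l i) ->
  \prod_(i <- s) u i n @[n --> \oo] --> \prod_(i <- s) l i.
Proof.
move=> ul; elim: s => [|i s IH].
  by rewrite big_nil; under eq_fun do rewrite big_nil; exact: cvg_cst.
by rewrite big_cons; under eq_fun do rewrite big_cons; exact: cvgM.
Qed.

Section mixed_generating_function.
Context (R : realType) d (Psi : measurableType d).
Local Notation Z := (measurableTypeR R * Psi)%type.
Variables (h : nat -> R -> R).
Hypothesis mh : forall x, measurable_fun setT (h x).
Hypothesis h0 : forall x t, 0 <= h x t.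
Hypothesis h1 : forall t, (\sum_(x <oo) (h x t)%:E = 1)%E.

Definition mixed_fun (k : Z -> nat -> R) (z : Z) : R :=
  fine (\sum_(x <oo) (h x z.1 * k z x)%:E)%E.

Variable k : Z -> nat -> R.
Hypothesis uk : forall x, unit_fun (k ^~ x).

Let k01 z x : 0 <= k z x <= 1. Proof. by case: (uk x). Qed.

Let hk0 z x : (0 <= (h x z.1 * k z x)%:E)%E.
Proof. by rewrite lee_fin mulr_ge0//; case/andP: (k01 z x). Qed.

Lemma mixed_fun_le1 z : (\sum_(x <oo) (h x z.1 * k z x)%:E <= 1)%E.
Proof.
rewrite -(h1 z.1); apply: lee_nneseries => x _ //; rewrite ?lee_fin ?hk0//.
by rewrite ler_piMr//; case/andP: (k01 z x).
Qed.

Lemma EFin_mixed_fun z :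
  (mixed_fun k z)%:E = (\sum_(x <oo) (h x z.1 * k z x)%:E)%E.
Proof.
rewrite fineK// ge0_fin_numE; first exact: le_lt_trans (mixed_fun_le1 z) (ltry _).
exact: nneseries_ge0.
Qed.

Lemma mixed_fun_cvg z :
  \sum_(x < n) (h x z.1 * k z x) @[n --> \oo] --> mixed_fun k z.
Proof.
have : (\sum_(0 <= x < n) (h x z.1 * k z x)%:E)%E @[n --> \oo] --> (mixed_fun k z)%:E.
  by rewrite EFin_mixed_fun; apply: is_cvg_nneseries => x _ _.
move=> /fine_cvgP[_]; apply: cvg_trans; apply: near_eq_cvg; apply: nearW => n /=.
by rewrite sumEFin big_mkord.
Qed.

Lemma unit_mixed_fun : unit_fun (mixed_fun k).
Proof.
split; last first.
  move=> z; rewrite -!lee_fin EFin_mixed_fun mixed_fun_le1 andbT.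
  exact: nneseries_ge0.
apply: (measurable_fun_cvg
  (h := fun n z => \sum_(x < n) (h x z.1 * k z x))) => [n|z _].
  apply: measurable_sum => x; apply: measurable_funM; last by case: (uk x).
  exact: (measurableT_comp (mh x) measurable_fst).
exact: mixed_fun_cvg.
Qed.

End mixed_generating_function.

(** Marking: averaging over the conditionally independent marks replaces a
    generating function by its mixture over the marks. *)
Section marking.
Context (R : realType) d (Psi : measurableType d).
Context d' (Om : measurableType d') (P : probability Om R).
Local Notation Z := (measurableTypeR R * Psi)%type.
Variables (h : nat -> R -> R).
Hypothesis mh : forall x, measurable_fun setT (h x).
Hypothesis h0 : forall x t, 0 <= h x t.
Hypothesis h1 : forall t, (\sum_(x <oo) (h x t)%:E = 1)%E.
Variables (theta : nat -> Om -> R) (psi : nat -> Om -> Psi)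
  (x : nat -> Om -> nat).
Hypothesis mtheta : forall j, measurable_fun setT (theta j).
Hypothesis mpsi : forall j, measurable_fun setT (psi j).
Hypothesis mx : forall j, measurable_fun setT (x j).
Hypothesis xP : cond_independent_pmf P h theta psi x.

Let atom j w : Z := (theta j w, psi j w).
Let gens := [set F | exists k (C : set Z),
  measurable C /\ F = [set w | C (theta k w, psi k w)]].

Let matom j : measurable_fun setT (atom j).
Proof. by apply: measurable_fun_pair; [exact: mtheta|exact: mpsi]. Qed.

Let h_le1 a t : h a t <= 1.
Proof.
rewrite -lee_fin -(h1 t) (nneseriesD1 (n := a))//; last by move=> *; rewrite lee_fin.
by rewrite leeDl// nneseries_ge0// => *; rewrite lee_fin.
Qed.

Let unit_atom (c : Z -> R) j : unit_fun c -> bmeas (fun w => c (atom j w)).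
Proof.
move=> [mc c01]; apply: bmeas01 => [|w]; last exact: c01.
exact: measurableT_comp mc (matom j).
Qed.

Let bmeas_mark n (a : 'I_n -> nat) :
  measurable [set w | forall i : 'I_n, x i w = a i].
Proof.
rewrite (_ : [set w | _] = \bigcap_(i in setT) (x (i : 'I_n) @^-1` [set a i])).
  apply: fin_bigcap_measurable => // i _.
  by rewrite -[X in measurable X]setTI; exact: mx.
by apply/seteqP; split => w xw => [i _|i]; exact: xw.
Qed.

Let bmeas_h n (a : 'I_n -> nat) : bmeas (fun w => \prod_(i < n) h (a i) (theta i w)).
Proof.
apply: bmeas_prod => i; apply: bmeas01; last by move=> w; rewrite h0 h_le1.
exact: measurableT_comp (mh _) (mtheta _).
Qed.

(** For fixed marks this is conditional independence, extended from events to
    functions of the atoms. *)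
Let mark_fixed n (a : 'I_n -> nat) (c : 'I_n -> Z -> R) :
  (forall i, unit_fun (c i)) ->
  ev P (fun w => (\prod_(i < n) c i (atom i w)) *
                 \1_[set w | forall i : 'I_n, x i w = a i] w) =
  ev P (fun w => (\prod_(i < n) c i (atom i w)) *
                 \prod_(i < n) h (a i) (theta i w)).
Proof.
move=> uc; set B := [set w | _]; pose hw w := \prod_(i < n) h (a i) (theta i w).
have bh : bmeas hw by exact: bmeas_h.
have bB : bmeas (\1_B : Om -> R) by apply: bmeas_indic; exact: bmeas_mark.
have sp : bspan (indicators <<s gens >>) (fun w => \prod_(i < n) c i (atom i w)).
  apply: bspan_superlevel.
    move=> w; apply/andP; split; first by apply: prodr_ge0 => i _; case: (uc i) => _ /(_ (atom i w))/andP[].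
    by apply: prodr_ile1 => i _; case: (uc i).
  move=> b; pose OG := g_sigma_algebraType gens.
  have mG i : measurable_fun setT (fun w : OG => atom i w).
    move=> _ C mC; rewrite setTI; apply: sub_gen_smallest.
    by exists i, C.
  have : measurable_fun setT (fun w : OG => \prod_(i < n) c i (atom i w)).
    apply: measurable_prod => i _.
    by apply: (measurableT_comp _ (mG i)); case: (uc i).
  move=> /(_ measurableT `[b, +oo[%classic (measurable_itv _)); rewrite setTI.
  rewrite (_ : _ @^-1` _ = [set w | b <= \prod_(i < n) c i (atom i w)])//.
  by apply/seteqP; split => w /=; rewrite in_itv/= andbT.
have gensm : <<s gens >> `<=` measurable.
  apply: smallest_sub; first exact: sigma_algebra_measurable.
  move=> _ [j [C [mC ->]]]; rewrite (_ : [set w | _] = atom j @^-1` C)//.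
  by rewrite -[X in measurable X]setTI; exact: matom.
have [] := sp [set F | bmeas F /\ ev P (fun w => F w * \1_B w) = ev P (fun w => F w * hw w)].
- split=> [F F' [bF FE] [bF' F'E]|e F [bF FE]|F F' FE F1 FF'].
  + split; first exact: bmeasD.
    rewrite (_ : (fun w => _ * \1_B w) = fun w => F w * \1_B w + F' w * \1_B w); last first.
      by apply/funext => w; rewrite mulrDl.
    rewrite (_ : (fun w => _ * hw w) = fun w => F w * hw w + F' w * hw w); last first.
      by apply/funext => w; rewrite mulrDl.
    by rewrite !evD ?FE ?F'E//; exact: bmeasM.
  + split; first exact: bmeasZ.
    rewrite (_ : (fun w => _ * \1_B w) = fun w => e * (F w * \1_B w)); last first.
      by apply/funext => w; rewrite mulrA.
    rewrite (_ : (fun w => _ * hw w) = fun w => e * (F w * hw w)); last first.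
      by apply/funext => w; rewrite mulrA.
    by rewrite !evZ ?FE//; exact: bmeasM.
  + have bF n' : bmeas (F n') by case: (FE n').
    split; first exact: bmeas_cvg bF F1 FF'.
    have lim (H : Om -> R) : bmeas H ->
        ev P (fun w => F n w * H w) @[n --> \oo] --> ev P (fun w => F' w * H w).
      move=> bH; case: (bH) => _ [M HM]; apply: (@ev_cvg _ _ _ P _ _ M).
      * by move=> n'; exact: bmeasM.
      * by move=> n' w; rewrite normrM -[leRHS]mul1r ler_pM.
      * by move=> w; exact: cvgMr_tmp (FF' w).
    have := lim _ bB.
    rewrite (_ : (fun n0 => _) = fun n0 => ev P (fun w => F n0 w * hw w)); last first.
      by apply/funext => n'; case: (FE n').
    by move=> /cvg_unique; apply => //; exact: lim.
- move=> _ [E GE ->]; have mE := gensm _ GE; split; first exact: bmeas_indic.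
  rewrite (_ : (fun w => _ * \1_B w) = \1_(E `&` B)); last by apply/funext => w; rewrite indicI.
  apply: EFin_inj; rewrite ev_indic; last by apply: measurableI => //; exact: bmeas_mark.
  rewrite xP// EFin_ev; last by apply: bmeasM => //; exact: bmeas_indic.
  rewrite integral_mkcond; apply: eq_integral => w _.
  by rewrite patchE indicE; case: ifP; rewrite ?mul1r ?mul0r.
- by [].
Qed.

Variable k : Z -> nat -> R.
Hypothesis uk : forall a, unit_fun (k ^~ a).

Let k01 z a : 0 <= k z a <= 1. Proof. by case: (uk a). Qed.

Let mark_bmeas M j : bmeas (fun w => if (x j w < M)%N then k (atom j w) (x j w) else 0).
Proof.
apply: bmeas01; last by move=> w; case: ifP; rewrite ?lexx ?ler01// k01.
rewrite (_ : (fun w => _) = fun w => \sum_(a < M) k (atom j w) a * \1_(x j @^-1` [set (a : nat)]) w).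
  apply: measurable_sum => a; apply: measurable_funM; first by case: (unit_atom j (uk a)).
  by apply: measurable_indic; rewrite -[X in measurable X]setTI; exact: mx.
apply/funext => w; case: ltnP => [xM|Mx].
  rewrite (bigD1 (Ordinal xM))//= indicE mem_set// mulr1 big1 ?addr0// => a ax.
  rewrite indicE memNset ?mulr0//= => xa; move/eqP : ax; case.
  exact: val_inj.
rewrite big1// => a _; rewrite indicE memNset ?mulr0//= => xa.
by move: Mx; rewrite xa leqNgt ltn_ord.
Qed.

(** The product of sums over marks expands into a sum over tuples of marks,
    finite thanks to the truncation. *)
Let mark_truncated n M :
  ev P (fun w => \prod_(j < n) (if (x j w < M)%N then k (atom j w) (x j w) else 0)) =
  ev P (fun w => \prod_(j < n) \sum_(a < M) h a (theta j w) * k (atom j w) a).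
Proof.
transitivity (ev P (fun w => \sum_(a : {ffun 'I_n -> 'I_M})
   (\prod_(j < n) k (atom j w) (a j)) * \1_[set w | forall j : 'I_n, x j w = a j] w)).
  congr (ev P _); apply/funext => w.
  transitivity (\prod_(j < n) \sum_(a < M) k (atom j w) a * (x j w == a)%:R).
    apply: eq_bigr => j _; case: ltnP => [xM|Mx].
      rewrite (bigD1 (Ordinal xM))//= eqxx mulr1 big1 ?addr0// => a ax.
      case: eqP => [xa|]; rewrite ?mulr0//; move/eqP : ax; case.
      exact: val_inj.
    by rewrite big1// => a _; rewrite gtn_eqF ?mulr0// (leq_trans (ltn_ord a)).
  rewrite bigA_distr_bigA/=; apply: eq_bigr => a _; rewrite big_split/=; congr (_ * _).
  rewrite -(prod_indic R (fun j : 'I_n => [set w | x j w = a j])).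
  by apply: eq_bigr => j _; rewrite indicE; case: eqP => xa; [rewrite mem_set|rewrite memNset].
rewrite ev_sum; last first.
  move=> a; apply: bmeasM.
    by apply: bmeas_prod => j; exact: (unit_atom j (uk (a j))).
  by apply: bmeas_indic; exact: (bmeas_mark (fun j => a j)).
rewrite (eq_bigr (fun a : {ffun 'I_n -> 'I_M} => ev P (fun w =>
  \prod_(j < n) (h (a j) (theta j w) * k (atom j w) (a j))))).
  rewrite -ev_sum; last first.
    move=> a; apply: bmeas_prod => j; apply: bmeasM; last exact: (unit_atom j (uk (a j))).
    apply: bmeas01; last by move=> w; rewrite h0 h_le1.
    exact: measurableT_comp (mh _) (mtheta _).
  by congr (ev P _); apply/funext => w; rewrite bigA_distr_bigA.
move=> a _; rewrite (mark_fixed (fun j => a j) (c := fun j z => k z (a j)))//.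
by congr (ev P _); apply/funext => w; rewrite big_split/= mulrC.
Qed.

Let mixed_atom z M : 0 <= \sum_(a < M) h a z.1 * k z a <= 1.
Proof.
rewrite sumr_ge0/=; last by move=> a _; rewrite mulr_ge0//; case/andP: (k01 z a).
rewrite -lee_fin -sumEFin -(h1 z.1) -(big_mkord xpredT (fun a => (h a z.1 * k z a)%:E)).
apply: (@le_trans _ _ (\sum_(0 <= a < M) (h a z.1)%:E)%E).
  by apply: lee_sum => a _; rewrite lee_fin ler_piMr//; case/andP: (k01 z a).
by apply: nneseries_lim_ge => a _; rewrite lee_fin.
Qed.

Let mark_finite n :
  ev P (fun w => \prod_(j < n) k (atom j w) (x j w)) =
  ev P (fun w => \prod_(j < n) mixed_fun h k (atom j w)).
Proof.
have c1 : ev P (fun w => \prod_(j < n) (if (x j w < M)%N then k (atom j w) (x j w) else 0))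
    @[M --> \oo] --> ev P (fun w => \prod_(j < n) k (atom j w) (x j w)).
  apply: (@ev_cvg _ _ _ P _ _ 1).
  - by move=> M; apply: bmeas_prod => j; exact: mark_bmeas.
  - move=> M w; rewrite ger0_norm; last first.
      by apply: prodr_ge0 => j _; case: ifP => // _; case/andP: (k01 (atom j w) (x j w)).
    by apply: prodr_ile1 => j _; case: ifP; rewrite ?lexx ?ler01// k01.
  - move=> w; apply: cvg_near_cst; exists (\max_(j < n) (x j w).+1) => // M /= xM.
    apply: eq_bigr => j _; rewrite ifT//; apply: leq_trans xM.
    exact: (@leq_bigmax _ (fun j : 'I_n => (x j w).+1) j).
have c2 : ev P (fun w => \prod_(j < n) \sum_(a < M) h a (theta j w) * k (atom j w) a)
    @[M --> \oo] --> ev P (fun w => \prod_(j < n) mixed_fun h k (atom j w)).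
  apply: (@ev_cvg _ _ _ P _ _ 1).
  - move=> M; apply: bmeas_prod => j; apply: bmeas_sum => a.
    apply: bmeasM; last exact: (unit_atom j (uk a)).
    apply: bmeas01; last by move=> w; rewrite h0 h_le1.
    exact: measurableT_comp (mh _) (mtheta _).
  - move=> M w; rewrite ger0_norm; last first.
      by apply: prodr_ge0 => j _; case/andP: (mixed_atom (atom j w) M).
    by apply: prodr_ile1 => j _; exact: (mixed_atom (atom j w) M).
  - move=> w; apply: cvg_prodr => j.
    exact: (mixed_fun_cvg h0 h1 uk (z := atom j w)).
move: c1; under eq_fun do rewrite mark_truncated.
by move=> /cvg_unique; apply.
Qed.

Lemma marking :
  ev P (fun w => iprod (fun j => k (theta j w, psi j w) (x j w))) =
  ev P (fun w => iprod (fun j => mixed_fun h k (theta j w, psi j w))).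
Proof.
have lim (u : nat -> Om -> R) : (forall j, bmeas (u j)) ->
    (forall j w, 0 <= u j w <= 1) ->
    ev P (fun w => \prod_(j < n) u j w) @[n --> \oo] --> ev P (fun w => iprod (u ^~ w)).
  move=> bu u01; apply: (@ev_cvg _ _ _ P _ _ 1).
  - by move=> n; exact: bmeas_prod.
  - move=> n w; rewrite ger0_norm; last first.
      by apply: prodr_ge0 => j _; case/andP: (u01 j w).
    by apply: prodr_ile1 => j _; exact: u01.
  - by move=> w; exact: iprod_cvg.
have c1 := lim (fun j w => k (atom j w) (x j w)).
have c2 := lim (fun j w => mixed_fun h k (atom j w)).
have bk j : bmeas (fun w => k (atom j w) (x j w)).
  apply: (bmeas_cvg (M := 1) (mark_bmeas ^~ j)) => [M w|w].
    by rewrite ger0_norm; case: ifP; rewrite ?lexx ?ler01//; case/andP: (k01 (atom j w) (x j w)).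
  apply: cvg_near_cst; exists (x j w).+1 => // M /= xM.
  by rewrite xM.
have um := unit_mixed_fun mh h0 h1 uk.
have bm j : bmeas (fun w => mixed_fun h k (atom j w)) by exact: unit_atom um.
have {}c1 := c1 bk (fun j w => k01 _ _).
have {}c2 := c2 bm (fun j w => um.2 _).
move: c1; under eq_fun do rewrite mark_finite.
by move=> /cvg_unique; apply.
Qed.

End marking.

(** * Restricting an atomic measure and changing one atom *)

Section operations_on_atomic_measures.
Context d (Psi : measurableType d) (R : realType).
Hypothesis singletonsP : forall p : Psi, measurable [set p].
Local Notation AM := (atomic_measure Psi R).
Local Notation Z := (measurableTypeR R * Psi)%type.
Implicit Types (m : AM) (C : set Z) (S : set Psi) (p q : Psi).
Local Open Scope ereal_scope.

Section restriction.
Variables (S : set Psi) (mS : measurable S) (m : AM).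

Let restr_fin p : mrestr m mS [set p] < +oo.
Proof.
apply: le_lt_trans (am_fin m p); apply: le_measure; [apply: mem_set|apply: mem_set|].
- exact: measurableI.
- exact: singletonsP.
- by move=> q [].
Qed.

Let restr_atomic : exists (w : nat -> {nonneg R}) (q : nat -> Psi),
  forall A, measurable A ->
    mrestr m mS A = sum_of_atoms (fun k => (w k)%:num%R) q A.
Proof.
have [w [q mE]] := am_atomic m.
exists (fun k => if q k \in S then w k else 0%:nng%R), q => A mA.
rewrite [LHS]mE; last exact: measurableI.
apply: eq_eseriesr => k _; rewrite !diracE.
have [Sk|Sk] := boolP (q k \in S); last first.
  by rewrite mul0e memNset ?mule0// => -[_] /mem_set; apply/negP.
congr (_ * (nat_of_bool _)%:R%:E); apply/idP/idP => /set_mem h; apply: mem_set.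
  by case: h.
by split=> //; exact: set_mem.
Qed.

Definition am_restr : AM := AtomicMeasure restr_fin restr_atomic.

Lemma am_restrE A : am_restr A = m (A `&` S). Proof. by []. Qed.

Lemma am_mass_restr p : am_mass am_restr p = if p \in S then am_mass m p else 0%R.
Proof.
rewrite /am_mass am_restrE; case: ifPn => [/set_mem Sp|Sp].
  by rewrite setIidl// => _ ->.
rewrite (_ : _ `&` _ = set0) ?measure0//.
by apply/seteqP; split => // q [-> /mem_set]; apply/negP.
Qed.

Lemma atoms_restr : atoms am_restr = atoms m `&` (setT `*` S).
Proof.
apply/seteqP; split => -[y q].
  move=> /atomsP[y0]; rewrite am_mass_restr; case: ifPn => [/set_mem Sq|_] my.
    by split=> //; exact/atomsP.
  by move: y0; rewrite -my eqxx.
move=> [/atomsP[y0 my] [_ /= Sq]]; apply/atomsP; split => //.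
by rewrite am_mass_restr mem_set.
Qed.

Lemma atom_count_restr C :
  atom_count am_restr C = atom_count m (C `&` (setT `*` S)).
Proof. by rewrite /atom_count atoms_restr setIAC setIA. Qed.

End restriction.

Lemma measurable_am_restr S (mS : measurable S) : measurable_fun setT (am_restr mS).
Proof.
apply: measurable_fun_am => // C mC; under eq_fun do rewrite atom_count_restr.
by apply: measurable_atom_count; apply: measurableI => //; exact: measurableX.
Qed.

Section setting_one_atom.
Variables (p : Psi).

Let mpC : measurable (~` [set p]). Proof. exact: measurableC. Qed.

Section fixed.
Variables (t : R) (m : AM).

Let weight : {nonneg R} := (`|t|%:nng)%R.

Let set_measure : {measure set Psi -> \bar R} :=
  measure_add (mscale weight \d_p) (mrestr m mpC).

Let set_measureE A : set_measure A = `|t|%:E * \d_p A + m (A `&` ~` [set p]).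
Proof. exact: measure_addE. Qed.

Let set_fin q : set_measure [set q] < +oo.
Proof.
rewrite set_measureE lte_add_pinfty//; first by rewrite diracE -EFinM ltry.
apply: le_lt_trans (am_fin m q); apply: le_measure; [apply: mem_set|apply: mem_set|].
- exact: measurableI.
- exact: singletonsP.
- by move=> ? [].
Qed.

Let set_atomic : exists (w : nat -> {nonneg R}) (q : nat -> Psi),
  forall A, measurable A ->
    set_measure A = sum_of_atoms (fun k => (w k)%:num%R) q A.
Proof.
have [w [q mE]] := am_atomic (am_restr mpC m).
exists (fun k => if k is j.+1 then w j else weight),
  (fun k => if k is j.+1 then q j else p) => A mA.
have f0 k : 0 <= (if k is j.+1 then w j else weight)%:num%R%:E *
    (\d_(if k is j.+1 then q j else p) A) by rewrite mule_ge0.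
rewrite set_measureE /sum_of_atoms nneseries_recl// -nneseries_addn//.
congr (_ + _); rewrite -[LHS](am_restrE mpC) mE//.
by apply: eq_eseriesr => k _; rewrite addn1.
Qed.

(** The absolute value makes the operation total in [t], so that the weight can be
    drawn from any law. *)
Definition set_atom : AM := AtomicMeasure set_fin set_atomic.

Lemma am_mass_set_atom q :
  am_mass set_atom q = if q == p then `|t|%R else am_mass m q.
Proof.
rewrite /am_mass [_ [set q]]set_measureE diracE; case: eqP => [->|qp].
  by rewrite mem_set// mule1 setICr measure0 adde0.
rewrite memNset ?mule0 ?add0e ?setIidl//; last by move=> pq; apply: qp.
by move=> _ -> /=.
Qed.

Lemma atoms_set_atom : atoms set_atom =
  [set z | t != 0%R /\ z = (`|t|%R, p)] `|` (atoms m `&` (setT `*` ~` [set p])).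
Proof.
apply/seteqP; split => -[y q].
  move=> /atomsP[y0]; rewrite am_mass_set_atom; case: eqP => [-> ty|qp my].
    by left => /=; rewrite ty; split=> //; move: y0; rewrite -ty normr_eq0.
  by right; split => //; exact/atomsP.
move=> [/= [t0 [-> ->]]|[/atomsP[y0 my] [_ /= qp]]]; apply/atomsP.
  by rewrite normr_eq0; split=> //; rewrite am_mass_set_atom eqxx.
by split=> //; rewrite am_mass_set_atom; case: eqP.
Qed.

Lemma atom_count_set_atom C : measurable C -> atom_count set_atom C =
  (\1_(C `&` [set z | z.1 != 0%R]) (`|t|%R, p))%:E +
  atom_count m (C `&` (setT `*` ~` [set p])).
Proof.
move=> mC; rewrite /atom_count atoms_set_atom setIUl.
have mA : measurable (atoms m `&` (setT `*` ~` [set p]) `&` C).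
  apply: measurableI => //; apply: measurableI; first exact: measurable_atoms.
  exact: measurableX.
have mP : measurable ([set z | t != 0%R /\ z = (`|t|%R, p)] `&` C : set Z).
  apply: measurableI => //; have [t0|t0] := pselect (t = 0%R).
    by rewrite (_ : mkset _ = set0)//; apply/seteqP; split => // z [/eqP].
  rewrite (_ : mkset _ = [set (`|t|%R, p)]); first exact: measurable_point.
  by apply/seteqP; split => [z []//|z ->]; split=> //; exact/eqP.
rewrite [LHS](measureU (@counting _ R) mP mA); last first.
  by apply/seteqP; split => // -[y q] [[[_ [_ ->]] _] [[_ [_ /=]]]].
rewrite [in RHS]setIA [in RHS](setIAC _ C); congr (_ + _).
rewrite indicE; have [tC|tC] := boolP (_ \in _).
  rewrite (_ : _ `&` C = [set (`|t|%R, p)]).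
    transitivity (@counting Z R [set (`|t|%R, p)]); first by [].
    by rewrite /counting asboolT ?finite_set1// fset_set1 cardfs1.
  move/set_mem : tC => [tC /=]; rewrite normr_eq0 => t0.
  by apply/seteqP; split => [z [[_ ->]]//|z ->].
rewrite (_ : _ `&` C = set0).
  exact: measure0.
apply/seteqP; split => // z [[t0 ->] tC']; move/negP : tC; apply; apply: mem_set.
by split => //=; rewrite normr_eq0.
Qed.

End fixed.

(** Joint measurability in the weight and the measure makes images of product
    laws available. *)
Lemma measurable_set_atom :
  measurable_fun setT (fun tm : R * AM => set_atom tm.1 tm.2).
Proof.
apply: measurable_fun_am => // C mC; under eq_fun do rewrite atom_count_set_atom//.
apply: emeasurable_funD.
  apply/measurable_EFinP.
  have mD : measurable (C `&` [set z | z.1 != 0%R]).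
    apply: measurableI => //; rewrite (_ : [set z | _] = (~` [set 0%R]) `*` setT).
      by apply: measurableX => //; exact: measurableC.
    by apply/seteqP; split => [z /= /eqP z0|z /= [/eqP]].
  apply: (measurableT_comp (measurable_indic mD)).
  apply: (@measurable_fun_pair _ _ _ _ (measurableTypeR R)).
    by apply: measurableT_comp => //.
  exact: measurable_cst.
apply: (measurableT_comp (measurable_atom_count _)) => //.
by apply: measurableI => //; exact: measurableX.
Qed.

End setting_one_atom.

Lemma atoms_sum_of_atoms m (w : nat -> R) (q : nat -> Psi) :
  (forall k, (0 <= w k)%R) -> injective q ->
  (forall A, measurable A -> m A = sum_of_atoms w q A) ->
  [/\ forall k, am_mass m (q k) = w k,
      forall p, (forall k, q k != p) -> am_mass m p = 0%R &
      forall y p, atoms m (y, p) <-> exists k, [/\ w k != 0%R, y = w k & p = q k]].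
Proof.
move=> w0 qI mE.
have mq k : am_mass m (q k) = w k.
  apply: EFin_inj; rewrite -am_massE mE// /sum_of_atoms.
  rewrite (nneseriesD1 (n := k))//; last by move=> j _; rewrite mule_ge0// lee_fin.
  rewrite diracE mem_set// mule1 eseries0 ?adde0// => j _ /= jk.
  by rewrite diracE memNset ?mule0// => /qI jk'; rewrite jk' eqxx in jk.
have mN p : (forall k, q k != p) -> am_mass m p = 0%R.
  move=> qp; apply: EFin_inj; rewrite -am_massE mE// /sum_of_atoms.
  apply: eseries0 => k _ _; rewrite diracE memNset ?mule0//=.
  by move/eqP : (qp k).
split=> // y p; split.
  move=> /atomsP[y0 my]; have [[k kp]|nq] := pselect (exists k, q k = p).
    by exists k; rewrite -mq kp my y0.
  by move: y0; rewrite -my mN ?eqxx// => k; apply/eqP => kp; apply: nq; exists k.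
by move=> [k [wk -> ->]]; apply/atomsP.
Qed.

End operations_on_atomic_measures.

(** * The conjugate kernels *)

Section conjugate_family.
Context (R : realType) (s : nat) (T : set R) (kappa : nat -> R)
  (eta : R -> 'rV[R]_s) (phi : nat -> 'rV[R]_s) (A : R -> R).
Hypothesis mT : measurable T.
Hypothesis meta : forall i, measurable_fun T (fun t => eta t 0 i).
Hypothesis mA : measurable_fun T A.
Hypothesis kappa_ge0 : forall x, 0 <= kappa x.
Hypothesis pmfP : forall t, T t ->
  (\sum_(x <oo) (likelihood kappa eta phi A x t)%:E = 1)%E.
Local Notation h := (likelihood kappa eta phi A).
Local Notation kernel := (conj_kernel eta A).
Local Notation density := (conj_density T eta A).

Lemma dotC (u v : 'rV[R]_s) : dot u v = dot v u.
Proof. by apply: eq_bigr => i _; rewrite mulrC. Qed.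

Lemma dotDl (u v w : 'rV[R]_s) : dot (u + v) w = dot u w + dot v w.
Proof. by rewrite -big_split; apply: eq_bigr => i _; rewrite mxE mulrDl. Qed.

Lemma measurable_dot v : measurable_fun T (fun t => dot v (eta t)).
Proof. by apply: measurable_sum => i; exact: measurable_funM. Qed.

Lemma measurable_kernel_fun xi lam : measurable_fun T (kernel xi lam).
Proof.
apply: measurableT_comp => //; apply: measurable_funD; first exact: measurable_dot.
by apply: measurable_funM => //; exact: measurableT_comp.
Qed.

Lemma measurable_likelihood x : measurable_fun T (h x).
Proof.
apply: measurable_funM => //; apply: measurableT_comp => //.
apply: measurable_funB => //; under eq_fun do rewrite dotC; exact: measurable_dot.
Qed.

Lemma likelihood_ge0 x t : 0 <= h x t.
Proof. by rewrite mulr_ge0// expR_ge0. Qed.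

(** One term of a series of sum 1. *)
Lemma likelihood_le1 x t : T t -> h x t <= 1.
Proof.
move=> Tt; rewrite -lee_fin -(pmfP Tt) (nneseriesD1 (n := x))//; last first.
  by move=> *; rewrite lee_fin likelihood_ge0.
by rewrite leeDl// nneseries_ge0// => *; rewrite lee_fin likelihood_ge0.
Qed.

Lemma kernel_gt0 xi lam t : 0 < kernel xi lam t.
Proof. exact: expR_gt0. Qed.

(** The conjugate kernel absorbs one observation by a shift of its parameters. *)
Lemma kernel_update xi lam x t :
  kernel xi lam t * h x t = kappa x * kernel (xi + phi x) (lam + 1) t.
Proof.
rewrite /conj_kernel /likelihood mulrCA -expRD; congr (_ * expR _).
by rewrite dotDl (dotC (phi x)); ring.
Qed.

(** The point mass at 0 outside the support makes this a law for every real
    weight. *)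
Definition full_likelihood x t : R := if t \in T then h x t else (x == 0)%N%:R.

Lemma measurable_full_likelihood x : measurable_fun setT (full_likelihood x).
Proof.
rewrite (_ : full_likelihood x = fun t => if t \in T then h x t else (x == 0)%N%:R)//.
apply: measurable_fun_if => //.
- apply: (measurable_fun_bool true); rewrite setTI (_ : _ @^-1` _ = T)//.
  by apply/seteqP; split => t /=; [exact: set_mem|exact: mem_set].
- apply: measurable_funS (measurable_likelihood x) => //.
  by move=> t [_ /=]; exact: set_mem.
Qed.

Lemma full_likelihood_ge0 x t : 0 <= full_likelihood x t.
Proof. by rewrite /full_likelihood; case: ifP => // _; exact: likelihood_ge0. Qed.

Lemma full_likelihood_sum1 t : (\sum_(x <oo) (full_likelihood x t)%:E = 1)%E.
Proof.
rewrite /full_likelihood; have [/set_mem|_] := boolP (t \in T); first exact: pmfP.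
have e0 x : (0 <= ((x == 0)%N%:R : R)%:E)%E by rewrite lee_fin.
rewrite (nneseriesD1 (n := 0%N))// eseries0 ?adde0// => x _ /=.
by move=> /negbTE ->.
Qed.

Lemma full_likelihoodE x t : T t -> full_likelihood x t = h x t.
Proof. by move=> Tt; rewrite /full_likelihood mem_set. Qed.

Section support_of_positive_measure.
Hypothesis Tpos : lebesgue_measure T != 0%E.

(** A positive function with zero integral would make the support null. *)
Lemma integral_kernel_gt0 (f : R -> R) : measurable_fun T f ->
  (forall t, T t -> 0 < f t) ->
  (0 < \int[lebesgue_measure]_(t in T) (f t)%:E)%E.
Proof.
move=> mf f0; rewrite lt_neqAle integral_ge0 ?andbT; last first.
  by move=> t Tt; rewrite lee_fin ltW// f0.
apply/eqP => /esym int0; move/eqP: Tpos; apply.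
have : (\int[lebesgue_measure]_(t in T) `|(f t)%:E| = 0)%E.
  rewrite -[RHS]int0; apply: eq_integral => t /set_mem Tt.
  by rewrite gee0_abs// lee_fin ltW// f0.
have mEf : measurable_fun T (EFin \o f) by exact/measurable_EFinP.
move=> /(ae_eq_integral_abs lebesgue_measure mT mEf)[N [mN N0 TN]].
apply/eqP; rewrite eq_le measure_ge0 andbT -N0; apply: le_measure.
- exact: mem_set.
- exact: mem_set.
- move=> t Tt; apply: TN => /= /(_ Tt) ft0.
  by have := f0 t Tt; rewrite (EFin_inj ft0) ltxx.
Qed.

(** Bayes' rule for one atom: multiplying a positive multiple of a conjugate
    kernel by the likelihood of [x] and normalizing gives the conjugate
    density with updated parameters. *)
Lemma density_update (r : R -> R) a xi lam x c : 0 < a ->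
  (forall t, r t = a * kernel xi lam t) -> 0 < kappa x ->
  (\int[lebesgue_measure]_(t in T) (r t * h x t)%:E = c%:E)%E ->
  [/\ 0 < c,
      forall t, density (xi + phi x) (lam + 1) t = r t * h x t / c &
      (\int[lebesgue_measure]_(t in T)
         (density (xi + phi x) (lam + 1) t)%:E = 1)%E].
Proof.
move=> a0 rE kx cE.
have rhE t : r t * h x t = a * kappa x * kernel (xi + phi x) (lam + 1) t.
  by rewrite rE -[RHS]mulrA -(kernel_update xi lam) -[LHS]mulrA.
have rh0 t : 0 < r t * h x t by rewrite rhE !mulr_gt0// kernel_gt0.
have mrh : measurable_fun T (fun t => r t * h x t).
  under eq_fun do rewrite rhE.
  by apply: measurable_funM => //; exact: measurable_kernel_fun.
have c0 : 0 < c by rewrite -lte_fin -cE; exact: integral_kernel_gt0.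
have ak0 : 0 < a * kappa x by rewrite mulr_gt0.
have densE t : density (xi + phi x) (lam + 1) t = r t * h x t / c.
  rewrite /conj_density expRD expRN -/(kernel (xi + phi x) (lam + 1) t).
  have intE : (\int[lebesgue_measure]_(t' in T)
      (kernel (xi + phi x) (lam + 1) t')%:E = (c / (a * kappa x))%:E)%E.
    rewrite [RHS]EFinM muleC -cE -ge0_integralZl_EFin//.
    - apply: eq_integral => t' _; rewrite -EFinM rhE mulrA mulVf ?mul1r//.
      by rewrite gt_eqF.
    - by move=> t' _; rewrite lee_fin ltW.
    - exact/measurable_EFinP.
    - by rewrite invr_ge0 ltW.
  rewrite /log_partition intE /= lnK; last by rewrite posrE divr_gt0.
  rewrite rhE invf_div; field.
  by rewrite !gt_eqF.
split=> //; under eq_integral do rewrite densE mulrC EFinM.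
rewrite ge0_integralZl_EFin//.
- by rewrite cE -EFinM mulVf// gt_eqF.
- by move=> t' _; rewrite lee_fin ltW.
- exact/measurable_EFinP.
- by rewrite invr_ge0 ltW.
Qed.

End support_of_positive_measure.

End conjugate_family.

(** * Adding independent fixed atoms *)

Section independent_atoms.
Context d (Psi : measurableType d) (R : realType).
Hypothesis singletonsP : forall p : Psi, measurable [set p].
Local Notation AM := (atomic_measure Psi R).
Local Notation Z := (measurableTypeR R * Psi)%type.
Implicit Types (m : AM).

Lemma am_ext m1 m2 : (forall A, m1 A = m2 A) -> m1 = m2.
Proof.
case: m1 m2 => [m1 f1 a1] [m2 f2 a2] /= m12.
have {}m12 : m1 = m2 by apply: eq_measure; apply/funext.
by subst m2; congr AtomicMeasure; exact: Prop_irrelevance.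
Qed.

Lemma measure_fin_set m (L : seq Psi) A : uniq L -> measurable A ->
  (m (A `&` [set` L]) = \sum_(q <- L) (am_mass m q)%:E * \d_q A)%E.
Proof.
move=> + mA; elim: L => [_|q L IH /= /andP[qL uL]].
  by rewrite big_nil set_nil setI0 measure0.
have mL (L' : seq Psi) : measurable [set` L'].
  by apply: countable_measurable => //; apply: finite_set_countable; exact: finite_seq.
have -> : [set` q :: L] = [set q] `|` [set` L].
  apply/seteqP; split => q' /=; rewrite in_cons.
    by move=> /predU1P[->|]; [left|right].
  by move=> [->|qL']; rewrite ?eqxx ?qL' ?orbT.
rewrite big_cons -IH// setIUr measureU//; last 3 first.
- by apply: measurableI.
- by apply: measurableI.
- apply/seteqP; split => // q' [[_ ->] [_ /= qL']].
  by move: qL; rewrite qL'.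
congr (_ + _)%E; rewrite diracE; have [Aq|Aq] := boolP (q \in A).
  rewrite mule1 -am_massE; congr (am_measure m _).
  by apply/seteqP; split => [q' []//|q' ->]; split=> //; exact: set_mem.
rewrite mule0 (_ : _ `&` _ = set0) ?measure0//.
apply/seteqP; split => // q' [Aq' qq']; move/negP : Aq; apply; apply: mem_set.
by rewrite -qq'.
Qed.

Lemma am_restr_set_atom (S : set Psi) (mS : measurable S) q t m : ~ S q ->
  am_restr singletonsP mS (set_atom singletonsP q t m) = am_restr singletonsP mS m.
Proof.
move=> Sq; apply: am_ext => A.
rewrite am_restrE [LHS]measure_addE [X in (X + _)%E](_ : _ = 0%E) ?add0e.
  congr (am_measure m _); rewrite setIidl// => q' [_ Sq'] qq'.
  by apply: Sq; rewrite -qq'.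
rewrite [LHS](_ : _ = (`|t|%:E * \d_q (A `&` S))%E)//.
by rewrite diracE memNset ?mule0// => -[].
Qed.

Variables (B : probability AM R) (rho : Psi -> probability R R).
Hypothesis rho_ge0 : forall q (V : set R), measurable V ->
  rho q [set t : R | V `|t|] = rho q V.

(** Independent weights are set one location at a time, by images of product
    laws. *)
Fixpoint with_atoms (L : seq Psi) : probability AM R :=
  if L is q :: L' then
    image_prob (rho q \x with_atoms L')%E (measurable_set_atom singletonsP q)
  else B.

(** Setting an atom outside [S] does not change the restriction to [S], and
    setting the weight at one location does not change the mass at another. *)
Lemma with_atomsE (L : seq Psi) (S : set Psi) (mS : measurable S)
    (V : Psi -> set R) (D : set AM) : uniq L -> (forall q, q \in L -> ~ S q) ->
  (forall q, measurable (V q)) -> measurable D ->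
  (with_atoms L [set m | (forall q, q \in L -> V q (am_mass m q)) /\
                         D (am_restr singletonsP mS m)] =
  \prod_(q <- L) rho q (V q) * B [set m | D (am_restr singletonsP mS m)])%E.
Proof.
move=> + + mV mD.
have mDr : measurable [set m | D (am_restr singletonsP mS m)].
  rewrite (_ : [set m | _] = am_restr singletonsP mS @^-1` D)//.
  by rewrite -[X in measurable X]setTI; apply: measurable_am_restr.
elim: L => [_ _|q L IH /= /andP[qL uL] LS].
  by rewrite big_nil mul1e; congr (B _); apply/seteqP; split => [m []//|m]; split.
rewrite image_probE.
pose E := [set m | (forall q, q \in L -> V q (am_mass m q)) /\
                   D (am_restr singletonsP mS m)].
rewrite (_ : _ @^-1` _ = [set t : R | V q `|t|] `*` E); last first.
  apply/seteqP; split => -[t m] /=.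
    move=> [mV']; rewrite am_restr_set_atom; last by apply: LS; rewrite mem_head.
    move=> Dm; split => /=.
      by have := mV' q (mem_head _ _); rewrite am_mass_set_atom eqxx.
    split=> // q' q'L; have := mV' q'; rewrite in_cons q'L orbT => /(_ isT).
    by rewrite am_mass_set_atom; case: eqP => // q'q; rewrite -q'q q'L in qL.
  move=> [/= Vt [mV' Dm]]; split; last first.
    by rewrite am_restr_set_atom//; apply: LS; rewrite mem_head.
  move=> q'; rewrite in_cons am_mass_set_atom => /predU1P[->|q'L]; first by rewrite eqxx.
  by case: eqP => [q'q|_]; [rewrite -q'q q'L in qL|exact: mV'].
have mE : measurable E.
  rewrite (_ : E = (\bigcap_(q in [set` L]) ((fun m => am_mass m q) @^-1` V q)) `&`
     [set m | D (am_restr singletonsP mS m)]); last first.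
    by apply/seteqP; split => m [h1 h2].
  apply: measurableI => //; apply: fin_bigcap_measurable.
    exact: finite_seq.
  by move=> q' _; rewrite -[X in measurable X]setTI; exact: measurable_am_mass.
have mVq : measurable [set t : R | V q `|t|].
  rewrite (_ : [set t | _] = Num.norm @^-1` V q)//.
  by rewrite -[X in measurable X]setTI; exact: normr_measurable.
rewrite [LHS]product_measure1E// big_cons -muleA -IH//; last first.
  by move=> q' q'L; apply: LS; rewrite in_cons q'L orbT.
  by congr (_ * _)%E; exact: rho_ge0.
exact: measurable_id.
Qed.

Variables (L : seq Psi) (T : set R) (f : Psi -> R -> R) (mu : set Z -> \bar R).
Hypothesis uL : uniq L.
Hypothesis mT : measurable T.
Hypothesis rhoE : forall q V, q \in L -> measurable V ->
  rho q V = (\int[lebesgue_measure]_(t in V `&` T) (f q t)%:E)%E.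
Hypothesis mLC : measurable (~` [set` L]).
Hypothesis Bpois : poisson_process B
  (fun m => atom_count (am_restr singletonsP mLC m)) mu.

(** The fixed weights are the masses at the locations in [L], and the ordinary
    component is the restriction to the other locations, which is the same
    as under [B]. *)
Lemma crm_with_atoms : crm_with (with_atoms L) (@idfun AM) T
  (tnth (in_tuple L)) (fun k => f (tnth (in_tuple L) k)) mu.
Proof.
have LN q : q \in L -> ~ (~` [set` L]) q by move=> qL /=; apply.
have tL k : tnth (in_tuple L) k \in L by exact: mem_tnth.
have tI : injective (tnth (in_tuple L)) by exact/tuple_uniqP.
have prodE (V : 'I_(size L) -> set R) (F : Psi -> set R -> \bar R) :
    (\prod_(q <- L) F q (if [pick k | tnth (in_tuple L) k == q] is Some k then V k else setT) =
     \prod_(k < size L) F (tnth (in_tuple L) k) (V k))%E.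
  rewrite big_tnth; apply: eq_bigr => k _; congr (F _ _).
  by case: pickP => [j /eqP/tI ->//|/(_ k)]; rewrite eqxx.
have setE (V : 'I_(size L) -> set R) m :
    (forall q, q \in L -> (if [pick k | tnth (in_tuple L) k == q] is Some k then V k else setT)
       (am_mass m q)) <-> forall k, V k (am_mass m (tnth (in_tuple L) k)).
  split=> [h k|h q qL].
    have := h _ (tL k); case: pickP => [j /eqP/tI ->//|/(_ k)]; by rewrite eqxx.
  by case: pickP => // k /eqP <-.
have mVp (V : 'I_(size L) -> set R) : (forall k, measurable (V k)) ->
    forall q, measurable (if [pick k | tnth (in_tuple L) k == q] is Some k then V k else setT).
  by move=> mV q; case: pickP.
have joint (V : 'I_(size L) -> set R) (D : set AM) : (forall k, measurable (V k)) ->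
    measurable D ->
    (with_atoms L [set m | (forall k, V k (am_mass m (tnth (in_tuple L) k))) /\
                           D (am_restr singletonsP mLC m)] =
    \prod_(k < size L) rho (tnth (in_tuple L) k) (V k) *
      B [set m | D (am_restr singletonsP mLC m)])%E.
  move=> mV mD; rewrite -(prodE V (fun q W => rho q W)) -with_atomsE//; last exact: mVp.
  by congr (with_atoms L _); apply/seteqP; split => m [/setE h1 h2].
have law k V : measurable V ->
    with_atoms L [set m | V (am_mass m (tnth (in_tuple L) k))] =
    rho (tnth (in_tuple L) k) V.
  move=> mV; have := joint (fun j => if j == k then V else setT) setT.
  rewrite (_ : [set m | _ /\ setT _] = [set m | V (am_mass m (tnth (in_tuple L) k))]).
    move=> -> //; last by move=> j; case: ifP.
    rewrite (_ : [set m | setT _] = setT)// [X in (_ * X)%E]probability_setT mule1.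
    rewrite (bigD1 k)//= eqxx big1 ?mule1// => j /negbTE ->.
    exact: probability_setT.
  apply/seteqP; split => m /=; first by move=> [/(_ k)]; rewrite eqxx.
  by move=> Vm; split=> // j; case: eqP => [->|].
have ordlaw D : measurable D ->
    with_atoms L [set m | D (am_restr singletonsP mLC m)] =
    B [set m | D (am_restr singletonsP mLC m)].
  move=> mD; have := joint (fun=> setT) D.
  rewrite (_ : [set m | _ /\ _] = [set m | D (am_restr singletonsP mLC m)]).
    move=> -> //; rewrite big1 ?mul1e// => k _; exact: probability_setT.
  by apply/seteqP; split => m /=; [move=> []|].
split=> //; exists (fun k m => am_mass m (tnth (in_tuple L) k)), (am_restr singletonsP mLC).
split.
- by split=> [k|]; [exact: measurable_am_mass|exact: measurable_am_restr].
- apply: aeW => m A mA.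
  rewrite am_restrE -(big_tnth _ _ L xpredT (fun q => (am_mass m q)%:E * \d_q A)%E).
  have mLs : measurable [set` L] by rewrite -[X in measurable X]setCK; exact: measurableC.
  by rewrite -measure_fin_set// addeC -setDE -(measureDI m mA mLs).
- by move=> k V mV; rewrite -rhoE ?tL// -law.
- split.
    move=> C mC; have := Bpois.1 C mC; case: (mu C) => [r Br n|Br|//].
      rewrite -Br; apply: (ordlaw [set m | atom_count m C = n%:R%:E]).
      rewrite (_ : [set m | _] = (fun m => atom_count m C) @^-1` [set n%:R%:E])//.
      by rewrite -[X in measurable X]setTI; exact: measurable_atom_count.
    apply: etrans Br; apply: (ordlaw [set m | atom_count m C = +oo%E]).
    rewrite (_ : [set m | _] = (fun m => atom_count m C) @^-1` [set +oo%E])//.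
    by rewrite -[X in measurable X]setTI; exact: measurable_atom_count.
  move=> n C V mC tC mV; have mCV i : measurable [set m : AM | V i (atom_count m (C i))].
    rewrite (_ : [set m | _] = (fun m => atom_count m (C i)) @^-1` V i)//.
    by rewrite -[X in measurable X]setTI; exact: measurable_atom_count.
  transitivity (B [set m | forall i, V i (atom_count (am_restr singletonsP mLC m) (C i))]).
    apply: (ordlaw [set m | forall i, V i (atom_count m (C i))]).
    rewrite (_ : [set m | _] = \bigcap_(i in setT) [set m : AM | V i (atom_count m (C i))]).
      by apply: fin_bigcap_measurable => // i _; exact: mCV.
    by apply/seteqP; split => m h => [i _|i]; exact: h.
  rewrite Bpois.2//; apply: eq_bigr => i _; apply/esym.
  by apply: (ordlaw [set m | V i (atom_count m (C i))]); exact: mCV.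
- move=> V D mV mD; rewrite [LHS]joint// -ordlaw//; congr (_ * _)%E.
  by apply: eq_bigr => k _; rewrite -law.
Qed.

End independent_atoms.

(** * Integrals of functions of marks *)

(** All subsets of a countable set are measurable. *)
Lemma measurable_countable_change d (X : measurableType d) (R : realType)
    (u v : X -> R) (F : set X) : (forall x : X, measurable [set x]) ->
  countable F -> measurable_fun setT u -> (forall x, ~ F x -> v x = u x) ->
  measurable_fun setT v.
Proof.
move=> X1 cF mu vu _ V mV; rewrite setTI.
have mF (S : set X) : S `<=` F -> measurable S.
  move=> SF; apply: countable_measurable => //.
  exact: sub_countable (subset_card_le SF) cF.
rewrite (_ : v @^-1` V = (u @^-1` V `&` ~` F) `|` (v @^-1` V `&` F)).
  apply: measurableU; last by apply: mF => x [].
  apply: measurableI; last by apply: measurableC; exact: mF.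
  by rewrite -[X in measurable X]setTI; exact: mu.
apply/seteqP; split => x /=.
  by move=> Vx; have [Fx|Fx] := pselect (F x); [right|left; rewrite -vu].
by move=> [[Vx Fx]|[]//]; rewrite vu.
Qed.

(** The parameter takes countably many values, which can be treated
    separately. *)
Lemma measurable_nat_param d (X : measurableType d) (R : realType)
    (u : nat -> X -> R) : (forall n, measurable_fun setT (u n)) ->
  measurable_fun setT (fun z : measurableTypeR R * X =>
    if z.1 == (Num.truncn (z.1 : R))%:R then u (Num.truncn (z.1 : R)) z.2 else 1).
Proof.
move=> mu; set v := (fun z => _) => _ V mV; rewrite setTI.
have mn (n : nat) : measurable ([set n%:R] : set (measurableTypeR R)).
  exact: measurable_set1.
rewrite (_ : v @^-1` V = (\bigcup_n ([set n%:R] `*` (u n @^-1` V))) `|`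
    ((~` range (fun n : nat => n%:R)) `*` (if 1 \in V then setT else set0))).
  apply: measurableU.
    apply: bigcup_measurable => n _; apply: measurableX => //.
    by rewrite -[X in measurable X]setTI; exact: mu.
  apply: measurableX; last by case: ifP.
  apply: measurableC; rewrite (_ : range _ = \bigcup_n [set n%:R]).
    by apply: bigcup_measurable => n _; exact: mn.
  by apply/seteqP; split => [y [n _ <-]|y [n _ ->]]; exists n.
apply/seteqP; split => -[y q]; rewrite /v /=.
  case: eqP => [yE Vu|yE V1]; first by left; exists (Num.truncn (y : R)).
  right; split; last by rewrite (mem_set V1).
  by move=> [n _ ny]; apply: yE; rewrite -ny /= natrK.
move=> [[n _ [/= -> Vn]]|[yN]]; first by rewrite natrK eqxx.
case: ifPn => // /set_mem V1 _; case: eqP => // yE.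
by exfalso; apply: yN; rewrite yE; exists (Num.truncn (y : R)).
Qed.

(** Over an injective enumeration, an infinite product with finitely many
    factors other than 1 is a product over a finite list of labels. *)
Lemma iprod_seq (R : realType) (X : eqType) (q : nat -> X) (L : seq X)
    (u : nat -> R) (v : X -> R) : injective q -> uniq L ->
  (forall l, l \in L -> exists j, q j = l) ->
  (forall j, 0 <= u j <= 1) -> (forall j, q j \notin L -> u j = 1) ->
  (forall j, q j \in L -> u j = v (q j)) ->
  iprod u = \prod_(l <- L) v l.
Proof.
move=> qI uL Lq u01 u1 uv.
have [n nL] : exists n, forall l, l \in L -> exists2 j, (j < n)%N & q j = l.
  elim: L Lq {uL u1 uv} => [_|l L IH Lq]; first by exists 0%N.
  have [l' l'L|n nL] := IH; first by apply: Lq; rewrite in_cons l'L orbT.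
  have [j jl] := Lq l (mem_head _ _); exists (maxn n j.+1) => l'.
  rewrite in_cons => /predU1P[->|/nL[i ni il]].
    by exists j => //; rewrite leq_max ltnSn orbT.
  by exists i => //; rewrite leq_max ni.
rewrite (@iprod_finite _ _ n)//; last first.
  move=> j nj; apply: u1; apply/negP => /nL[i ni /qI ij].
  by move: nj; rewrite -ij leqNgt ni.
have -> : \prod_(j < n) u j = \prod_(j <- iota 0 n | q j \in L) v (q j).
  rewrite -(big_mkord xpredT u) [RHS]big_mkcond /index_iota subn0.
  by apply: eq_bigr => j _; case: ifPn => [/uv|/u1].
rewrite -big_filter -(big_map q xpredT v); apply: perm_big; apply: uniq_perm => //.
  by rewrite map_inj_uniq; [exact/filter_uniq/iota_uniq|exact: qI].
move=> l; apply/mapP/idP => [[j]|lL].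
  by rewrite mem_filter => /andP[jL _] ->.
have [j jn jl] := nL _ lL; exists j => //.
by rewrite mem_filter jl lL mem_iota.
Qed.

Section mixture_exponents.
Context (R : realType) d (Psi : measurableType d).
Local Notation Z := (measurableTypeR R * Psi)%type.
Variables (h : nat -> R -> R).
Hypothesis mh : forall x, measurable_fun setT (h x).
Hypothesis h0 : forall x t, 0 <= h x t.
Hypothesis h1 : forall t, (\sum_(x <oo) (h x t)%:E = 1)%E.
Variables (T : set R) (mT : measurable T).
Local Open Scope ereal_scope.

Lemma integral_mixed (w : R -> R) (k : Z -> nat -> R) (q : Psi) :
  measurable_fun T w -> (forall t, T t -> (0 <= w t)%R) ->
  (forall x, unit_fun (k ^~ x)) ->
  \int[lebesgue_measure]_(t in T) (w t * mixed_fun h k (t, q))%:E =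
  \sum_(x <oo) \int[lebesgue_measure]_(t in T) (w t * h x t * k (t, q) x)%:E.
Proof.
move=> mw w0 uk.
have k0 x t : (0 <= k (t, q) x)%R by case: (uk x) => _ /(_ (t, q))/andP[].
rewrite -integral_nneseries//; last 2 first.
- move=> x; apply/measurable_EFinP; apply: measurable_funM.
    by apply: measurable_funM; [exact: mw|apply: measurable_funTS; exact: mh].
  apply: measurable_funTS; case: (uk x) => mk _.
  by apply: (measurableT_comp mk); exact: measurable_pair2.
- by move=> x t Tt; rewrite lee_fin !mulr_ge0// w0.
apply: eq_integral => t /set_mem Tt; rewrite EFinM (EFin_mixed_fun h0 h1 uk).
rewrite -nneseriesZl//; last by move=> x _; rewrite lee_fin mulr_ge0.
by apply: eq_eseriesr => x _; rewrite -EFinM mulrA.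
Qed.

Variables (G : probability Psi R).

(** The marks have total probability 1, so 1 is a mixture too. *)
Lemma onem_mixed_fun (k : Z -> nat -> R) z : (forall x, unit_fun (k ^~ x)) ->
  (1 - mixed_fun h k z)%:E = \sum_(x <oo) (h x z.1 * (1 - k z x))%:E.
Proof.
move=> uk; have k01 x : (0 <= k z x <= 1)%R by case: (uk x).
have hk0 x : 0 <= (h x z.1 * k z x)%:E.
  by rewrite lee_fin mulr_ge0//; case/andP: (k01 x).
have hk1 x : 0 <= (h x z.1 * (1 - k z x))%:E.
  by rewrite lee_fin mulr_ge0// subr_ge0; case/andP: (k01 x).
rewrite EFinB (EFin_mixed_fun h0 h1 uk) -(h1 z.1).
rewrite [X in X - _](_ : _ = \sum_(x <oo) (h x z.1 * (1 - k z x))%:E +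
    \sum_(x <oo) (h x z.1 * k z x)%:E).
  by rewrite addeK// -(EFin_mixed_fun h0 h1 uk).
rewrite -nneseriesD//; apply: eq_eseriesr => x _; rewrite -EFinD -mulrDr.
by rewrite subrK mulr1.
Qed.

Variables (r : R -> R).
Hypothesis mr : measurable_fun T r.
Hypothesis r0 : forall t, T t -> (0 <= r t)%R.

(** The marks split the integral against a rate measure into one integral for
    each mark, weighted by the likelihood of the mark. *)
Lemma rate_mixed (k : Z -> nat -> R) : (forall x, unit_fun (k ^~ x)) ->
  \int[rate_measure G mT mr r0]_z (1 - mixed_fun h k z)%:E =
  \sum_(x <oo) \int[lebesgue_measure]_(t in T)
    ((r t * h x t)%:E * \int[G]_q (1 - k (t, q) x)%:E).
Proof.
move=> uk; have k01 x z : (0 <= k z x <= 1)%R by case: (uk x).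
have um := unit_mixed_fun mh h0 h1 uk.
have mk1 x : measurable_fun setT (fun z => (1 - k z x)%:E).
  by apply/measurable_EFinP; apply: measurable_funB => //; case: (uk x).
have k1 x z : 0 <= (1 - k z x)%:E by rewrite lee_fin subr_ge0; case/andP: (k01 x z).
rewrite integral_rate; last 2 first.
- by apply/measurable_EFinP; apply: measurable_funB => //; case: um.
- by move=> z; rewrite lee_fin subr_ge0; case: um => _ /(_ z)/andP[].
rewrite -integral_nneseries//; last 2 first.
- move=> x; apply: emeasurable_funM.
    by apply/measurable_EFinP; apply: measurable_funM; [exact: mr|apply: measurable_funTS; exact: mh].
  apply: measurable_funTS.
  exact: (@measurable_fun_fubini_tonelli_F _ _ _ _ R G _ (mk1 x) (k1 x)).
- move=> x t Tt; rewrite mule_ge0//; first by rewrite lee_fin mulr_ge0// r0.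
  by apply: integral_ge0 => q _.
apply: eq_integral => t /set_mem Tt.
under eq_integral do rewrite (onem_mixed_fun _ uk)/=.
rewrite integral_nneseries//; last 2 first.
- move=> x; apply/measurable_EFinP; apply: measurable_funM => //.
  apply: measurable_funB => //; case: (uk x) => mk _.
  by apply: (measurableT_comp mk); exact: measurable_pair1.
- by move=> x q _; rewrite lee_fin mulr_ge0// -lee_fin.
rewrite -nneseriesZl//; last first.
  by move=> x _; apply: integral_ge0 => q _; rewrite lee_fin mulr_ge0// -lee_fin.
apply: eq_eseriesr => x _; rewrite EFinM -muleA; congr (_ * _).
under eq_integral do rewrite EFinM.
rewrite ge0_integralZl_EFin//.
by apply: (measurableT_comp (mk1 x)); exact: measurable_pair1.
Qed.

End mixture_exponents.

Lemma tonelli_weight (R : realType) d (Psi : measurableType d)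
    (G : probability Psi R) (T : set R) (w : R -> R)
    (phi : measurableTypeR R * Psi -> \bar R) : measurable T ->
  measurable_fun T w -> (forall t, T t -> 0 <= w t) ->
  measurable_fun setT phi -> (forall z, 0 <= phi z)%E ->
  (\int[lebesgue_measure]_(t in T) ((w t)%:E * \int[G]_q phi (t, q)) =
   \int[G]_q \int[lebesgue_measure]_(t in T) ((w t)%:E * phi (t, q)))%E.
Proof.
move=> mT mw w0 mphi phi0; pose wT := w \_ T.
have mwT : measurable_fun setT wT by apply/(measurable_restrictT w mT).
have wT0 t : 0 <= wT t by rewrite /wT patchE; case: ifPn => // /set_mem /w0.
have := @fubini_tonelli _ _ _ _ R lebesgue_measure G
  (fun z => ((wT z.1)%:E * phi z)%E).
move=> /(_ _ _) h; transitivity (\int[lebesgue_measure]_t \int[G]_q ((wT t)%:E * phi (t, q)))%E.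
  rewrite integral_mkcond; apply: eq_integral => t _; rewrite patchE.
  rewrite ge0_integralZl_EFin//; last first.
    by apply: (measurableT_comp mphi); exact: measurable_pair1.
  by rewrite /wT patchE; case: ifP => // _; rewrite mul0e.
rewrite h; last 2 first.
- apply: emeasurable_funM => //; apply/measurable_EFinP.
  exact: (measurableT_comp mwT measurable_fst).
- by move=> z; rewrite mule_ge0// lee_fin.
apply: eq_integral => q _; rewrite [RHS]integral_mkcond.
apply: eq_integral => t _; rewrite patchE /wT patchE.
by case: ifP => // _; rewrite mul0e.
Qed.

(** * Parameters of the posterior *)

Lemma diffuse_seq d (X : measurableType d) (R : realType) (G : probability X R)
    (L : seq X) : (forall x : X, measurable [set x]) ->
  (forall x, G [set x] = 0%E) -> G [set` L] = 0%E.
Proof.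
move=> X1 G0; have mL (L' : seq X) : measurable [set` L'].
  by apply: countable_measurable => //; apply: finite_set_countable; exact: finite_seq.
elim: L => [|x L IH]; first by rewrite set_nil measure0.
have -> : [set` x :: L] = [set x] `|` [set` L].
  apply/seteqP; split => y /=; rewrite in_cons.
    by move=> /predU1P[->|]; [left|right].
  by move=> [->|yL]; rewrite ?eqxx ?yL ?orbT.
have le0 : (G ([set x] `|` [set` L]) <= G [set x] + G [set` L])%E by exact: measureU2.
have ge0 : (0 <= G ([set x] `|` [set` L]))%E by exact: measure_ge0.
by apply: le_anti; rewrite ge0 andbT (le_trans le0)// G0 IH adde0.
Qed.

Section posterior_parameters.
Context (R : realType) d (Psi : measurableType d).
Hypothesis singletonsP : forall p : Psi, measurable [set p].
Context (s : nat) (T : set R) (kappa : nat -> R)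
  (eta : R -> 'rV[R]_s) (phi : nat -> 'rV[R]_s) (A : R -> R).
Hypothesis mT : measurable T.
Hypothesis meta : forall i, measurable_fun T (fun t => eta t 0 i).
Hypothesis mA : measurable_fun T A.
Hypothesis kappa_ge0 : forall x, 0 <= kappa x.
Hypothesis pmfP : forall t, T t ->
  (\sum_(x <oo) (likelihood kappa eta phi A x t)%:E = 1)%E.
Context (G : probability Psi R).
Hypothesis G_diffuse : forall p : Psi, G [set p] = 0%E.
Context (K : nat) (p : 'I_K -> Psi) (xifix : 'I_K -> 'rV[R]_s)
  (lamfix : 'I_K -> R) (gamma : R) (xi : 'rV[R]_s) (lam : R).
Hypothesis fix1 : forall k, (\int[lebesgue_measure]_(t in T)
  (conj_density T eta A (xifix k) (lamfix k) t)%:E = 1)%E.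
Hypothesis gamma_gt0 : 0 < gamma.
Local Notation rate := (conj_weight_rate eta A gamma xi lam).
Local Notation L := (likelihood kappa eta phi A).
Local Notation h := (full_likelihood T kappa eta phi A).
Local Notation density := (conj_density T eta A).
Local Notation Z := (measurableTypeR R * Psi)%type.
Hypothesis rate_infinite : (\int[lebesgue_measure]_(t in T) (rate t)%:E = +oo)%E.
Hypothesis rate_finite : (\sum_(1 <= x <oo)
  \int[lebesgue_measure]_(t in T) (rate t * L x t)%:E < +oo)%E.

Let mh x : measurable_fun setT (h x).
Proof. exact: measurable_full_likelihood. Qed.

Let h0 x t : 0 <= h x t.
Proof. exact: full_likelihood_ge0. Qed.

Let h1 t : (\sum_(x <oo) (h x t)%:E = 1)%E.
Proof. exact: full_likelihood_sum1. Qed.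

(** The integral of the weight rate over a null support would vanish. *)
Lemma support_not_null : lebesgue_measure T != 0%E.
Proof.
apply/eqP => T0; move: rate_infinite; rewrite null_set_integral//.
apply/measurable_EFinP; apply: measurable_funM => //.
exact: measurable_kernel_fun.
Qed.

Lemma rate_gt0 t : 0 < rate t.
Proof. by rewrite mulr_gt0//; exact: kernel_gt0. Qed.

Lemma measurable_rate : measurable_fun T rate.
Proof. by apply: measurable_funM => //; exact: measurable_kernel_fun. Qed.

Let rate_ge0 t : 0 <= rate t. Proof. by rewrite ltW// rate_gt0. Qed.

Let L0 x t : 0 <= L x t. Proof. exact: likelihood_ge0. Qed.

Let mL x : measurable_fun T (L x). Proof. exact: measurable_likelihood. Qed.

Let mrateL x : measurable_fun T (fun t => (rate t * L x t)%:E).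
Proof.
by apply/measurable_EFinP; apply: measurable_funM; [exact: measurable_rate|exact: mL].
Qed.

Let intrL_ge0 x : (0 <= \int[lebesgue_measure]_(t in T) (rate t * L x t)%:E)%E.
Proof. by apply: integral_ge0 => t _; rewrite lee_fin mulr_ge0. Qed.

(** One term of a convergent series of nonnegative terms. *)
Lemma rate_mark_fin x : (0 < x)%N ->
  (\int[lebesgue_measure]_(t in T) (rate t * L x t)%:E < +oo)%E.
Proof.
move=> x0; apply: le_lt_trans rate_finite.
have := @nneseries_lim_ge R (fun x => \int[lebesgue_measure]_(t in T) (rate t * L x t)%:E)%E
  xpredT 1 x.+1 (fun n _ _ => intrL_ge0 n).
apply: le_trans; rewrite big_nat_recr//= leeDr// sume_ge0//.
Qed.

(** The likelihoods of all marks sum to 1 and the total rate is infinite, while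
    the positive marks only have a finite rate. *)
Lemma rate_unmarked : (\int[lebesgue_measure]_(t in T) (rate t * L 0 t)%:E = +oo)%E.
Proof.
apply: contrapT => /eqP; rewrite -ltey => fin0.
suff : (\int[lebesgue_measure]_(t in T) (rate t)%:E < +oo)%E by rewrite rate_infinite.
have -> : (\int[lebesgue_measure]_(t in T) (rate t)%:E =
    \sum_(x <oo) \int[lebesgue_measure]_(t in T) (rate t * L x t)%:E)%E.
  rewrite -integral_nneseries//; last by move=> x t _; rewrite lee_fin mulr_ge0.
  apply: eq_integral => t /set_mem Tt.
  under eq_eseriesr do rewrite EFinM.
  by rewrite nneseriesZl ?pmfP ?mule1// => x _; rewrite lee_fin.
by rewrite nneseries_recl// lte_add_pinfty.
Qed.

(** Otherwise the likelihood of the mark 0 vanishes, contradicting the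
    infinite rate of unmarked atoms. *)
Lemma kappa0_gt0 : 0 < kappa 0.
Proof.
rewrite lt_neqAle kappa_ge0 andbT; apply/eqP => k0.
have := rate_unmarked; under eq_integral do rewrite /likelihood -k0 mul0r mulr0.
by rewrite integral0.
Qed.

Definition prior_xi (q : Psi) : 'rV[R]_s :=
  if [pick k | p k == q] is Some k then xifix k else xi.

Definition prior_lam (q : Psi) : R :=
  if [pick k | p k == q] is Some k then lamfix k else lam.

(** The density at a fixed location and the weight rate elsewhere can be updated
    alike: both are positive multiples of a conjugate kernel. *)
Definition prior_weight (q : Psi) : R -> R :=
  if [pick k | p k == q] is Some k then density (xifix k) (lamfix k) else rate.

Definition post_density (n : nat) (q : Psi) : R -> R :=
  density (prior_xi q + phi n) (prior_lam q + 1).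

(** A mark of positive probability leaves a fixed atom in the posterior: any
    such mark at a fixed location, and a positive one elsewhere. *)
Definition observable (n : nat) (q : Psi) : bool :=
  ((q \in range p) || (0 < n)%N) && (0 < kappa n).

Let prior_weight_multiple q : exists2 a, 0 < a & forall t,
  prior_weight q t = a * conj_kernel eta A (prior_xi q) (prior_lam q) t.
Proof.
rewrite /prior_weight /prior_xi /prior_lam; case: pickP => [k _|_].
  exists (expR (- log_partition T eta A (xifix k) (lamfix k))).
    exact: expR_gt0.
  by move=> t; rewrite /conj_density /conj_kernel expRD mulrC.
by exists gamma.
Qed.

Lemma prior_weight_ge0 q t : 0 <= prior_weight q t.
Proof.
have [a a0 ->] := prior_weight_multiple q.
by rewrite mulr_ge0// ltW//; exact: kernel_gt0.
Qed.

Lemma measurable_prior_weight q : measurable_fun T (prior_weight q).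
Proof.
have [a a0 aE] := prior_weight_multiple q.
rewrite (_ : prior_weight q = fun t =>
   a * conj_kernel eta A (prior_xi q) (prior_lam q) t); last exact/funext.
by apply: measurable_funM => //; exact: measurable_kernel_fun.
Qed.

Lemma measurable_density xi' lam' : measurable_fun T (density xi' lam').
Proof.
rewrite (_ : density xi' lam' = fun t =>
    conj_kernel eta A xi' lam' t * expR (- log_partition T eta A xi' lam')).
  by apply: measurable_funM => //; exact: measurable_kernel_fun.
by apply/funext => t; rewrite /conj_density expRD.
Qed.

Let density_ge0 xi' lam' t : 0 <= density xi' lam' t.
Proof. exact: expR_ge0. Qed.

Definition mark_mass (n : nat) (q : Psi) : R :=
  fine (\int[lebesgue_measure]_(t in T) (prior_weight q t * L n t)%:E)%E.

(** At a fixed location the mass is at most that of the prior density, and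
    elsewhere the positive marks have a finite rate. *)
Lemma mark_massE n q : observable n q ->
  (\int[lebesgue_measure]_(t in T) (prior_weight q t * L n t)%:E = (mark_mass n q)%:E)%E.
Proof.
move=> /andP[qn kn]; rewrite /mark_mass fineK// ge0_fin_numE; last first.
  by apply: integral_ge0 => t _; rewrite lee_fin mulr_ge0// prior_weight_ge0.
rewrite /prior_weight; case: pickP => [k _|nk].
  apply: (@le_lt_trans _ _ (\int[lebesgue_measure]_(t in T)
      (density (xifix k) (lamfix k) t)%:E)%E); last by rewrite fix1 ltry.
  apply: ge0_le_integral => //.
  - by move=> t _; rewrite lee_fin mulr_ge0.
  - by apply/measurable_EFinP; apply: measurable_funM; [exact: measurable_density|exact: mL].
  - by apply/measurable_EFinP; exact: measurable_density.
  - by move=> t Tt; rewrite lee_fin; apply: ler_piMr;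
      [exact: density_ge0|exact: (likelihood_le1 kappa_ge0 pmfP)].
apply: rate_mark_fin; move: qn => /orP[/set_mem[k _ kq]|//].
by have := nk k; rewrite kq eqxx.
Qed.

Lemma post_densityE n q : observable n q ->
  [/\ 0 < mark_mass n q,
      forall t, post_density n q t = prior_weight q t * L n t / mark_mass n q &
      (\int[lebesgue_measure]_(t in T) (post_density n q t)%:E = 1)%E].
Proof.
move=> nq; have [a a0 aE] := prior_weight_multiple q.
have /andP[_ kn] := nq.
exact: (density_update mT meta mA support_not_null a0 aE kn (mark_massE nq)).
Qed.

(** Mean of [f] at the location [q] under the posterior weight law, given the
    mark [n]; locations without a posterior atom contribute a factor 1. *)
Definition post_mean (f : Z -> R) (n : nat) (q : Psi) : R :=
  if observable n q then
    fine (\int[lebesgue_measure]_(t in T) (post_density n q t * f (t, q))%:E)%E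
  else 1.

Section post_mean.
Variable f : Z -> R.
Hypothesis uf : unit_fun f.

Let f0 z : 0 <= f z. Proof. by case: uf => _ /(_ z)/andP[]. Qed.

Let mfq q : measurable_fun setT (fun t : R => f (t, q)).
Proof. by case: uf => mf _; apply: (measurableT_comp mf); exact: measurable_pair2. Qed.

Let mpost n q : measurable_fun T (fun t => (post_density n q t * f (t, q))%:E).
Proof.
apply/measurable_EFinP; apply: measurable_funM; first exact: measurable_density.
exact: measurable_funTS.
Qed.

Let post_mean_le n q : observable n q ->
  (0 <= \int[lebesgue_measure]_(t in T) (post_density n q t * f (t, q))%:E <= 1)%E.
Proof.
move=> nq; have [_ _ <-] := post_densityE nq; apply/andP; split.
  by apply: integral_ge0 => t _; rewrite lee_fin mulr_ge0//; exact: density_ge0.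
apply: ge0_le_integral => //.
- by move=> t _; rewrite lee_fin mulr_ge0//; exact: density_ge0.
- exact: mpost.
- by apply/measurable_EFinP; exact: measurable_density.
- move=> t _; rewrite lee_fin ler_piMr//; first exact: density_ge0.
  by case: uf => _ /(_ (t, q))/andP[].
Qed.

Lemma EFin_post_mean n q : observable n q -> (post_mean f n q)%:E =
  (\int[lebesgue_measure]_(t in T) (post_density n q t * f (t, q))%:E)%E.
Proof.
move=> nq; rewrite /post_mean nq fineK//.
have /andP[i0 i1] := post_mean_le nq.
by rewrite ge0_fin_numE//; exact: le_lt_trans i1 (ltry _).
Qed.

Lemma post_mean01 n q : 0 <= post_mean f n q <= 1.
Proof.
have [nq|nq] := boolP (observable n q); last by rewrite /post_mean (negbTE nq) ler01 lexx.
by rewrite -!lee_fin EFin_post_mean// post_mean_le.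
Qed.

(** The parameters depend on the location only through finitely many
    exceptions. *)
Lemma measurable_post_mean n : measurable_fun setT (post_mean f n).
Proof.
pose u q : R := if (0 < n)%N && (0 < kappa n) then
  fine (\int[lebesgue_measure]_t ((density (xi + phi n) (lam + 1) \_ T) t * f (t, q))%:E)%E
  else 1.
apply: (@measurable_countable_change _ _ _ u _ (range p) singletonsP).
- exact: sub_countable (card_image_le _ _) _.
- rewrite /u; have [_|_] := boolP ((0 < n)%N && _); last exact: measurable_cst.
  apply: (measurableT_comp (@fine_measurable R _ measurableT)).
  apply: (@measurable_fun_fubini_tonelli_G _ _ _ _ R lebesgue_measure
    (fun z => ((density (xi + phi n) (lam + 1) \_ T) z.1 * f z)%:E)).
    apply/measurable_EFinP; apply: measurable_funM; last by case: uf.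
    apply: measurableT_comp measurable_fst.
    by apply/(measurable_restrictT _ mT); exact: measurable_density.
  move=> z; rewrite lee_fin; apply: mulr_ge0; last exact: f0.
  by rewrite patchE; case: ifP => // _; exact: density_ge0.
- move=> q qp; rewrite /post_mean /observable /u memNset//=.
  case: ifP => // _; congr fine; rewrite integral_mkcond; apply: eq_integral => t _.
  rewrite !patchE /post_density /prior_xi /prior_lam.
  case: pickP => [k /eqP kq|_]; first by exfalso; apply: qp; exists k.
  by case: ifP => // _; rewrite mul0r.
Qed.

Lemma mark_integral n q : (q \in range p) || (0 < n)%N ->
  (\int[lebesgue_measure]_(t in T) (prior_weight q t * h n t * f (t, q))%:E =
  (mark_mass n q * post_mean f n q)%:E)%E.
Proof.
move=> qn; have hL t : t \in T -> h n t = L n t.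
  by move=> /set_mem; exact: full_likelihoodE.
have [kn|] := boolP (0 < kappa n); last first.
  rewrite -leNgt => kn; have L00 t : L n t = 0.
    by rewrite /likelihood (_ : kappa n = 0) ?mul0r//; apply/eqP; rewrite eq_le kn kappa_ge0.
  rewrite /mark_mass; under [in RHS]eq_integral do rewrite L00 mulr0.
  rewrite integral0 mul0r integral0_eq// => t Tt.
  by rewrite hL ?mem_set// L00 mulr0 mul0r.
have nq : observable n q by rewrite /observable qn kn.
have [m0 pE _] := post_densityE nq.
rewrite EFinM EFin_post_mean// -ge0_integralZl_EFin//.
- apply: eq_integral => t tT; rewrite -EFinM pE hL//; congr _%:E.
  by field; rewrite gt_eqF.
- by move=> t _; rewrite lee_fin mulr_ge0//; exact: density_ge0.
- exact: mpost.
- exact: ltW.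
Qed.

End post_mean.

(** The mark at the location [q] seen by a functional [g] of the observation:
    the mark 0 leaves no atom. *)
Definition mark_fun (g : Z -> R) (x : nat) (q : Psi) : R :=
  if x == 0%N then 1 else g (x%:R, q).

Lemma mark_fun01 g x q : unit_fun g -> 0 <= mark_fun g x q <= 1.
Proof. by move=> [_ g01]; rewrite /mark_fun; case: ifP; rewrite ?ler01 ?lexx. Qed.

Lemma unit_mark_fun g x : unit_fun g -> unit_fun (fun z : Z => mark_fun g x z.2).
Proof.
move=> ug; split; last by move=> z; exact: mark_fun01.
rewrite /mark_fun; case: (x == 0%N); first exact: measurable_cst.
case: ug => mg _; apply: (measurableT_comp mg).
by apply: measurable_fun_pair => //; exact: measurable_cst.
Qed.

Lemma unit_post_mean f n : unit_fun f -> unit_fun (fun z : Z => post_mean f n z.2).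
Proof.
move=> uf; split; last by move=> z; exact: post_mean01.
exact: (measurableT_comp (measurable_post_mean uf n) measurable_snd).
Qed.

Section joint_functionals.
Variables f g : Z -> R.
Hypothesis uf : unit_fun f.
Hypothesis ug : unit_fun g.

Definition joint_fun (z : Z) (x : nat) : R := f z * mark_fun g x z.2.

Definition bayes_fun (z : Z) (x : nat) : R := mark_fun g x z.2 * post_mean f x z.2.

Lemma unit_joint_fun x : unit_fun (joint_fun ^~ x).
Proof. by apply: unit_funM => //; exact: unit_mark_fun. Qed.

Lemma unit_bayes_fun x : unit_fun (bayes_fun ^~ x).
Proof. by apply: unit_funM; [exact: unit_mark_fun|exact: unit_post_mean]. Qed.

(** Bayes' rule for one location and one mark. *)
Let joint_mark x q : (q \in range p) || (0 < x)%N ->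
  (\int[lebesgue_measure]_(t in T) (prior_weight q t * h x t * joint_fun (t, q) x)%:E =
  \int[lebesgue_measure]_(t in T) (prior_weight q t * h x t * bayes_fun (t, q) x)%:E)%E.
Proof.
move=> qx; have /andP[g0 g1] := mark_fun01 x q ug.
have /andP[F0 F1] := post_mean01 uf x q.
have f0 z : 0 <= f z by case: uf => _ /(_ z)/andP[].
have [kx|kx] := boolP (0 < kappa x); last first.
  have hx t : T t -> h x t = 0.
    move=> Tt; rewrite full_likelihoodE// /likelihood (_ : kappa x = 0) ?mul0r//.
    by apply/eqP; rewrite eq_le kappa_ge0 leNgt kx.
  by rewrite !integral0_eq// => t Tt; rewrite hx// mulr0 mul0r.
have qx' : observable x q by rewrite /observable qx kx.
have pw0 t : 0 <= prior_weight q t * h x t by rewrite mulr_ge0// prior_weight_ge0.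
have mpw : measurable_fun T (fun t => prior_weight q t * h x t).
  apply: measurable_funM; first exact: measurable_prior_weight.
  by apply: measurable_funTS; exact: mh.
have mfq : measurable_fun T (fun t : R => f (t, q)).
  apply: measurable_funTS; case: uf => mf _.
  by apply: (measurableT_comp mf); exact: measurable_pair2.
have scale (c : R) (u : R -> R) : 0 <= c -> measurable_fun T u ->
    (forall t, 0 <= u t) ->
    (\int[lebesgue_measure]_(t in T) (c * u t)%:E =
     c%:E * \int[lebesgue_measure]_(t in T) (u t)%:E)%E.
  move=> c0 mu u0; under eq_integral do rewrite EFinM.
  rewrite ge0_integralZl_EFin//; last exact/measurable_EFinP.
  by move=> t _; rewrite lee_fin.
have lhs := scale (mark_fun g x q) (fun t => prior_weight q t * h x t * f (t, q)) g0
  (measurable_funM mpw mfq) (fun t => mulr_ge0 (pw0 t) (f0 (t, q))).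
have rhs := scale (mark_fun g x q * post_mean f x q) _ (mulr_ge0 g0 F0) mpw pw0.
transitivity (\int[lebesgue_measure]_(t in T)
    (mark_fun g x q * (prior_weight q t * h x t * f (t, q)))%:E)%E.
  by apply: eq_integral => t _; congr _%:E; rewrite /joint_fun /=; ring.
rewrite lhs mark_integral//.
transitivity (\int[lebesgue_measure]_(t in T)
    (mark_fun g x q * post_mean f x q * (prior_weight q t * h x t))%:E)%E; last first.
  by apply: eq_integral => t _; congr _%:E; rewrite /bayes_fun /=; ring.
have intH : (\int[lebesgue_measure]_(t in T) (prior_weight q t * h x t)%:E =
    (mark_mass x q)%:E)%E.
  rewrite -mark_massE//; apply: eq_integral => t /set_mem Tt.
  by rewrite full_likelihoodE.
by rewrite rhs intH -!EFinM; congr _%:E; ring.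
Qed.

Lemma bayes_fixed q : q \in range p ->
  (\int[lebesgue_measure]_(t in T) (prior_weight q t * mixed_fun h joint_fun (t, q))%:E =
   \int[lebesgue_measure]_(t in T) (prior_weight q t * mixed_fun h bayes_fun (t, q))%:E)%E.
Proof.
move=> qp; rewrite !(integral_mixed mh h0 h1)//.
- by apply: eq_eseriesr => x _; apply: joint_mark; rewrite qp.
- exact: measurable_prior_weight.
- by move=> t _; exact: prior_weight_ge0.
- exact: unit_bayes_fun.
- exact: measurable_prior_weight.
- by move=> t _; exact: prior_weight_ge0.
- exact: unit_joint_fun.
Qed.

Definition post_rate : R -> R :=
  conj_weight_rate eta A (gamma * kappa 0) (xi + phi 0) (lam + 1).

(** The weight rate thinned to the unmarked atoms is of conjugate form. *)
Lemma post_rateE t : post_rate t = rate t * L 0 t.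
Proof.
by rewrite /post_rate /conj_weight_rate -mulrA -kernel_update [LHS]mulrA.
Qed.

Lemma measurable_post_rate : measurable_fun T post_rate.
Proof. by apply: measurable_funM => //; exact: measurable_kernel_fun. Qed.

Lemma post_rate_ge0 t : 0 <= post_rate t.
Proof. by rewrite post_rateE mulr_ge0. Qed.

Definition prior_intensity : {measure set Z -> \bar R} :=
  rate_measure G mT measurable_rate (fun t _ => rate_ge0 t).

Definition post_intensity : {measure set Z -> \bar R} :=
  rate_measure G mT measurable_post_rate (fun t _ => post_rate_ge0 t).

Let range_seq : range p = [set` [seq p k | k <- enum 'I_K]].
Proof.
apply/seteqP; split => q /=; first by move=> [k _ <-]; apply/map_f; rewrite mem_enum.
by move=> /mapP[k _ ->]; exists k.
Qed.

Let ae_not_fixed : {ae G, forall q, ~ range p q}.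
Proof.
exists (range p); split.
- by apply: countable_measurable => //; exact: sub_countable (card_image_le _ _) _.
- by rewrite range_seq; exact: diffuse_seq.
- by move=> q /= /contrapT.
Qed.

Let mrh x : measurable_fun T (fun t => rate t * h x t).
Proof.
by apply: measurable_funM; [exact: measurable_rate|apply: measurable_funTS; exact: mh].
Qed.

Let rh0 x t : 0 <= rate t * h x t. Proof. exact: mulr_ge0. Qed.

(** Both integrals complement those of [joint_mark] to the rate of the mark,
    which is finite. The fixed locations are null since [G] is diffuse. *)
Let slice_marked x : (0 < x)%N ->
  (\int[lebesgue_measure]_(t in T) ((rate t * h x t)%:E * \int[G]_q (1 - joint_fun (t, q) x)%:E) =
   \int[lebesgue_measure]_(t in T) ((rate t * h x t)%:E * \int[G]_q (1 - bayes_fun (t, q) x)%:E))%E.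
Proof.
move=> x0.
have comp (k : Z -> nat -> R) : unit_fun (k ^~ x) ->
    measurable_fun setT (fun z => (1 - k z x)%:E) /\ (forall z, 0 <= (1 - k z x)%:E)%E.
  move=> [mk k01]; split.
    by apply/measurable_EFinP; exact: measurable_funB.
  by move=> z; rewrite lee_fin subr_ge0; case/andP: (k01 z).
have [mj j0] := comp _ (unit_joint_fun x).
have [mb b0] := comp _ (unit_bayes_fun x).
have slice_fin (k : Z -> nat -> R) : (forall y, unit_fun (k ^~ y)) ->
    forall q, [/\ measurable_fun T (fun t => (rate t * h x t)%:E * (1 - k (t, q) x)%:E)%E,
      (forall t, 0 <= (rate t * h x t)%:E * (1 - k (t, q) x)%:E)%E,
      measurable_fun T (fun t => (rate t * h x t * k (t, q) x)%:E) &
      forall t, (0 <= (rate t * h x t * k (t, q) x)%:E)%E].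
  move=> uk q; case: (uk x) => mk k01.
  have mkq : measurable_fun T (fun t : R => k (t, q) x).
    apply: measurable_funTS; apply: (measurableT_comp mk); exact: measurable_pair2.
  split.
  - apply/measurable_EFinP; apply: measurable_funM; first exact: mrh.
    exact: measurable_funB.
  - by move=> t; rewrite -EFinM lee_fin mulr_ge0// subr_ge0; case/andP: (k01 (t, q)).
  - by apply/measurable_EFinP; apply: measurable_funM; first exact: mrh.
  - by move=> t; rewrite lee_fin mulr_ge0//; case/andP: (k01 (t, q)).
pose slice (k : Z -> nat -> R) q := (\int[lebesgue_measure]_(t in T)
   ((rate t * h x t)%:E * (1 - k (t, q) x)%:E))%E.
have sliceD (k : Z -> nat -> R) q : (forall y, unit_fun (k ^~ y)) ->
   (slice k q + \int[lebesgue_measure]_(t in T) (rate t * h x t * k (t, q) x)%:E =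
    \int[lebesgue_measure]_(t in T) (rate t * h x t)%:E)%E.
  move=> uk; have [m1 p1 m2 p2] := slice_fin _ uk q.
  rewrite /slice -ge0_integralD//; apply: eq_integral => t _.
  by rewrite -EFinM -EFinD -mulrDr subrK mulr1.
have mslice (k : Z -> nat -> R) : (forall y, unit_fun (k ^~ y)) ->
    measurable_fun setT (slice k).
  move=> uk; have [mk k0] := comp _ (uk x).
  rewrite (_ : slice k = fun q => (\int[lebesgue_measure]_t
      ((((fun t => rate t * h x t) \_ T) t)%:E * (1 - k (t, q) x)%:E))%E).
    apply: (@measurable_fun_fubini_tonelli_G _ _ _ _ R lebesgue_measure
      (fun z => ((((fun t => rate t * h x t) \_ T) z.1)%:E * (1 - k z x)%:E)%E)).
      apply: emeasurable_funM => //; apply/measurable_EFinP.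
      apply: measurableT_comp measurable_fst.
      by apply/(measurable_restrictT _ mT); exact: mrh.
    by move=> z; rewrite mule_ge0// lee_fin patchE; case: ifP.
  apply/funext => q; rewrite /slice integral_mkcond; apply: eq_integral => t _.
  by rewrite !patchE; case: ifP => // _; rewrite mul0e.
have tonelli (k : Z -> nat -> R) : (forall y, unit_fun (k ^~ y)) ->
    (\int[lebesgue_measure]_(t in T) ((rate t * h x t)%:E * \int[G]_q (1 - k (t, q) x)%:E) =
     \int[G]_q slice k q)%E.
  move=> uk; have [mk k0] := comp _ (uk x).
  exact: (tonelli_weight G mT (mrh x) (fun t _ => rh0 x t) mk k0).
rewrite (tonelli _ unit_joint_fun) (tonelli _ unit_bayes_fun).
have slice0 (k : Z -> nat -> R) q : (forall y, unit_fun (k ^~ y)) -> (0 <= slice k q)%E.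
  by move=> uk; have [_ p1 _ _] := slice_fin _ uk q; exact: integral_ge0.
apply: ge0_ae_eq_integral => //.
- exact: (mslice _ unit_joint_fun).
- exact: (mslice _ unit_bayes_fun).
- by move=> q _; exact: (slice0 _ _ unit_joint_fun).
- by move=> q _; exact: (slice0 _ _ unit_bayes_fun).
move: ae_not_fixed; apply: filterS => q qp _.
have pwE : prior_weight q = rate.
  by rewrite /prior_weight; case: pickP => // k /eqP kq; exfalso; apply: qp; exists k.
have jb := @joint_mark x q; rewrite x0 orbT pwE in jb.
have := sliceD _ q unit_joint_fun; rewrite -(sliceD _ q unit_bayes_fun) (jb isT).
have [_ _ m2 p2] := slice_fin _ unit_bayes_fun q.
have fin : (\int[lebesgue_measure]_(t in T) (rate t * h x t * bayes_fun (t, q) x)%:E \is a fin_num)%E.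
  rewrite ge0_fin_numE; last by apply: integral_ge0.
  apply: le_lt_trans (rate_mark_fin x0); apply: ge0_le_integral => //.
  - exact: mrateL.
  - move=> t Tt; rewrite lee_fin -(full_likelihoodE _ _ _ _ x Tt).
    have /andP[_ b1] : 0 <= bayes_fun (t, q) x <= 1 by case: (unit_bayes_fun x).
    exact: ler_piMr (rh0 x t) b1.
by move=> /(congr1 (fun y => y - (\int[lebesgue_measure]_(t in T) (rate t * h x t * bayes_fun (t, q) x)%:E))%E);
  rewrite !addeK.
Qed.

Let unmarked_joint :
  (\int[lebesgue_measure]_(t in T) ((rate t * h 0 t)%:E * \int[G]_q (1 - joint_fun (t, q) 0)%:E) =
   \int[post_intensity]_z (1 - f z)%:E)%E.
Proof.
have [mf f01] := uf.
rewrite /post_intensity integral_rate; last 2 first.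
- by apply/measurable_EFinP; exact: measurable_funB.
- by move=> z; rewrite lee_fin subr_ge0; case/andP: (f01 z).
apply: eq_integral => t /set_mem Tt; rewrite full_likelihoodE// -post_rateE.
by congr (_ * _)%E; apply: eq_integral => q _; rewrite /joint_fun /mark_fun eqxx mulr1.
Qed.

Let unmarked_bayes :
  (\int[lebesgue_measure]_(t in T) ((rate t * h 0 t)%:E * \int[G]_q (1 - bayes_fun (t, q) 0)%:E) = 0)%E.
Proof.
rewrite integral0_eq// => t _; rewrite (_ : (\int[G]_q _)%E = 0%E) ?mule0//.
have [mb b01] := unit_bayes_fun 0.
rewrite -(integral0 G setT); apply: ge0_ae_eq_integral => //.
- apply/measurable_EFinP; apply: measurable_funB => //.
  by apply: (measurableT_comp mb); exact: measurable_pair1.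
- by move=> q _; rewrite lee_fin subr_ge0; case/andP: (b01 (t, q)).
move: ae_not_fixed; apply: filterS => q qp _.
by rewrite /bayes_fun /mark_fun eqxx /post_mean /observable memNset//= mulr1 subrr.
Qed.

(** The ordinary atoms contribute to the joint functional what they contribute
    through their posterior means, plus the part of those left unmarked. *)
Lemma bayes_rate :
  (\int[prior_intensity]_z (1 - mixed_fun h joint_fun z)%:E =
   \int[prior_intensity]_z (1 - mixed_fun h bayes_fun z)%:E +
   \int[post_intensity]_z (1 - f z)%:E)%E.
Proof.
have slice0 (k : Z -> nat -> R) y : (forall y, unit_fun (k ^~ y)) ->
    (0 <= \int[lebesgue_measure]_(t in T) ((rate t * h y t)%:E * \int[G]_q (1 - k (t, q) y)%:E))%E.
  move=> uk; apply: integral_ge0 => t _; rewrite mule_ge0 ?lee_fin//.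
  apply: integral_ge0 => q _; rewrite lee_fin subr_ge0.
  by case: (uk y) => _ /(_ (t, q))/andP[].
pose term (k : Z -> nat -> R) y := (\int[lebesgue_measure]_(t in T)
  ((rate t * h y t)%:E * \int[G]_q (1 - k (t, q) y)%:E))%E.
have expand (k : Z -> nat -> R) : (forall y, unit_fun (k ^~ y)) ->
    (\int[prior_intensity]_z (1 - mixed_fun h k z)%:E =
     term k 0%N + \sum_(1 <= y <oo) term k y)%E.
  move=> uk; have E1 := @rate_mixed _ _ _ h mh h0 h1 T mT G rate
    measurable_rate (fun t _ => rate_ge0 t) k uk.
  apply: (etrans E1); apply: (@nneseries_recl R xpredT (term k)) => // y _.
  exact: slice0.
have j0 : term joint_fun 0%N = (\int[post_intensity]_z (1 - f z)%:E)%E := unmarked_joint.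
have b0 : term bayes_fun 0%N = 0%E := unmarked_bayes.
have tE y : (0 < y)%N -> term joint_fun y = term bayes_fun y := @slice_marked y.
have ej := expand _ unit_joint_fun; have eb := expand _ unit_bayes_fun.
clearbody term; clear expand slice0; rewrite b0 add0e in eb; rewrite j0 addeC in ej.
apply: (etrans ej); congr (_ + _)%E; apply/esym/(etrans eb).
by rewrite eseries_cond [RHS]eseries_cond; apply: eq_eseriesr => y /= y0; rewrite tE.
Qed.

End joint_functionals.

End posterior_parameters.

(** * From generating classes to posterior kernels *)

(** Bayes' rule can be checked on generating classes of functionals of the
    parameter and of the observation. *)
Section posterior_kernels.
Context (R : realType) d' (Om : measurableType d') (P : probability Om R).
Context d1 d2 (M : measurableType d1) (Y : measurableType d2).
Variables (Theta : Om -> M) (X : Om -> Y).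
Hypothesis mTheta : measurable_fun setT Theta.
Hypothesis mX : measurable_fun setT X.
Variables (W : set (M -> R)) (V : set (Y -> R)).
Hypothesis Wb : W `<=` bmeas (R := R).
Hypothesis Vb : V `<=` bmeas (R := R).
Hypothesis Wspan : forall D : set M, measurable D -> bspan W \1_D.
Hypothesis Vspan : forall E : set Y, measurable E -> bspan V \1_E.
Variable Q : Y -> probability M R.
Hypothesis mQ : forall f, W f -> measurable_fun setT (fun y => ev (Q y) f).

Definition bayes_rule (f : M -> R) (g : Y -> R) : Prop :=
  ev P (fun w => f (Theta w) * g (X w)) =
  ev P (fun w => ev (Q (X w)) f * g (X w)).

Hypothesis WVrule : forall f g, W f -> V g -> bayes_rule f g.

Let bound_ev (f : M -> R) (c : R) : bmeas f -> (forall m, `|f m| <= c) ->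
  forall y, `|ev (Q y) f| <= c.
Proof.
move=> bf fc y; rewrite ler_norml -[X in X <= _](ev_cst (Q y)) -[X in _ && (_ <= X)](ev_cst (Q y)).
apply/andP; split; apply: ev_le => //; try exact: bmeas_cst.
- by move=> m /=; have := fc m; rewrite ler_norml => /andP[].
- by move=> m /=; have := fc m; rewrite ler_norml => /andP[].
Qed.

Let bmeas_ev (f : M -> R) : bmeas f ->
  measurable_fun setT (fun y => ev (Q y) f) -> bmeas (fun y => ev (Q y) f).
Proof.
move=> bf mf; split=> //; case: (bf) => _ [c fc]; exists c; exact: bound_ev bf fc.
Qed.

Let bmeas_comp d (U : measurableType d) (Z : Om -> U) (f : U -> R) :
  measurable_fun setT Z -> bmeas f -> bmeas (f \o Z).
Proof.
by move=> mZ [mf [c fc]]; split; [exact: measurableT_comp|exists c => w; exact: fc].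
Qed.

(* The functional of the parameter is extended first, for all [g] in [V]. *)
Let good : set (M -> R) := [set f | [/\ bmeas f,
  measurable_fun setT (fun y => ev (Q y) f) & forall g, V g -> bayes_rule f g]].

Let bclosed_good : bclosed good.
Proof.
split=> [f1 f2 [b1 m1 r1] [b2 m2 r2]|c f [bf mf rf]|F f GF F1 Ff].
- have evE y : ev (Q y) (fun x => f1 x + f2 x) = ev (Q y) f1 + ev (Q y) f2 by exact: evD.
  split; first exact: bmeasD.
    by under eq_fun do rewrite evE; exact: measurable_funD.
  move=> g Vg; rewrite /bayes_rule; have bg := bmeas_comp mX (Vb Vg).
  transitivity (ev P (fun w => f1 (Theta w) * g (X w) + f2 (Theta w) * g (X w))).
    by congr (ev P _); apply/funext => w; rewrite mulrDl.
  rewrite evD; [|exact: (bmeasM (bmeas_comp mTheta b1) bg)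
                |exact: (bmeasM (bmeas_comp mTheta b2) bg)].
  rewrite (r1 _ Vg) (r2 _ Vg) -evD.
  - by congr (ev P _); apply/funext => w; rewrite evE mulrDl.
  - exact: (bmeasM (bmeas_comp mX (bmeas_ev b1 m1)) bg).
  - exact: (bmeasM (bmeas_comp mX (bmeas_ev b2 m2)) bg).
- have evE y : ev (Q y) (fun x => c * f x) = c * ev (Q y) f by exact: evZ.
  split; first exact: bmeasZ.
    by under eq_fun do rewrite evE; exact: measurable_funM.
  move=> g Vg; rewrite /bayes_rule; have bg := bmeas_comp mX (Vb Vg).
  transitivity (ev P (fun w => c * (f (Theta w) * g (X w)))).
    by congr (ev P _); apply/funext => w; rewrite mulrA.
  rewrite evZ; last exact: (bmeasM (bmeas_comp mTheta bf) bg).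
  rewrite (rf _ Vg) -evZ; last exact: (bmeasM (bmeas_comp mX (bmeas_ev bf mf)) bg).
  by congr (ev P _); apply/funext => w; rewrite evE mulrA.
- have bF n : bmeas (F n) by case: (GF n).
  have evF y : ev (Q y) (F n) @[n --> \oo] --> ev (Q y) f by exact: ev_cvg bF F1 Ff.
  split; first exact: bmeas_cvg bF F1 Ff.
    apply: (measurable_fun_cvg _ (fun y _ => evF y)) => n.
    by case: (GF n).
  move=> g Vg; rewrite /bayes_rule; have bg := bmeas_comp mX (Vb Vg).
  case: (bg) => _ [c gc].
  have bound (u : R) w : `|u| <= 1 -> `|u * g (X w)| <= c.
    by move=> u1; rewrite normrM -[leRHS]mul1r ler_pM//; exact: gc.
  have lhs : ev P (fun w => F n (Theta w) * g (X w)) @[n --> \oo] -->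
      ev P (fun w => f (Theta w) * g (X w)).
    apply: (@ev_cvg _ _ _ P _ _ c) => [n|n w|w]; last exact: cvgMr_tmp (Ff (Theta w)).
      exact: (bmeasM (bmeas_comp mTheta (bF n)) bg).
    exact/bound/F1.
  have rhs : ev P (fun w => ev (Q (X w)) (F n) * g (X w)) @[n --> \oo] -->
      ev P (fun w => ev (Q (X w)) f * g (X w)).
    apply: (@ev_cvg _ _ _ P _ _ c) => [n|n w|w]; last exact: cvgMr_tmp (evF (X w)).
      case: (GF n) => _ mn _; exact: (bmeasM (bmeas_comp mX (bmeas_ev (bF n) mn)) bg).
    exact/bound/bound_ev.
  have same : (fun n => ev P (fun w => F n (Theta w) * g (X w))) =
      (fun n => ev P (fun w => ev (Q (X w)) (F n) * g (X w))).
    by apply/funext => n; case: (GF n) => _ _; apply.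
  by rewrite same in lhs; apply: (cvg_unique _ lhs rhs).
Qed.

Let indic_good (D : set M) : measurable D -> good \1_D.
Proof.
move=> mD; apply: (Wspan mD bclosed_good) => f Wf.
by split; [exact: Wb|exact: mQ|move=> g; exact: WVrule].
Qed.

Let indic_rule (D : set M) (E : set Y) : measurable D -> measurable E ->
  bayes_rule \1_D \1_E.
Proof.
move=> mD mE; have [bD mQD rD] := indic_good mD.
have bT := bmeas_comp mTheta bD; have bQ := bmeas_comp mX (bmeas_ev bD mQD).
suff : [set g | bmeas g /\ bayes_rule \1_D g] \1_E by case.
apply: (Vspan mE); last by move=> g Vg; split; [exact: Vb|exact: rD].
rewrite /bayes_rule; split=> [g1 g2 [b1 r1] [b2 r2]|c g [bg rg]|F g GF F1 Fg].
- split; first exact: bmeasD.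
  have split (u : Om -> R) : bmeas u ->
      ev P (fun w => u w * (g1 (X w) + g2 (X w))) =
      ev P (fun w => u w * g1 (X w)) + ev P (fun w => u w * g2 (X w)).
    move=> bu; rewrite -evD; last 2 first.
    - exact: (bmeasM bu (bmeas_comp mX b1)).
    - exact: (bmeasM bu (bmeas_comp mX b2)).
    by congr (ev P _); apply/funext => w; rewrite mulrDr.
  by rewrite (split _ bT) (split _ bQ) r1 r2.
- split; first exact: bmeasZ.
  have scale (u : Om -> R) : bmeas u ->
      ev P (fun w => u w * (c * g (X w))) = c * ev P (fun w => u w * g (X w)).
    move=> bu; rewrite -evZ; last exact: (bmeasM bu (bmeas_comp mX bg)).
    by congr (ev P _); apply/funext => w; rewrite mulrCA.
  by rewrite (scale _ bT) (scale _ bQ) rg.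
- have bF n : bmeas (F n) by case: (GF n).
  split; first exact: bmeas_cvg bF F1 Fg.
  have lim (u : Om -> R) : bmeas u ->
      ev P (fun w => u w * F n (X w)) @[n --> \oo] --> ev P (fun w => u w * g (X w)).
    move=> bu; case: (bu) => _ [c uc].
    apply: (@ev_cvg _ _ _ P _ _ c).
    - by move=> n; exact: (bmeasM bu (bmeas_comp mX (bF n))).
    - by move=> n w; rewrite normrM -[leRHS]mulr1 ler_pM.
    - by move=> w; exact: cvgMl_tmp (Fg (X w)).
  have same : (fun n => ev P (fun w => (\1_D \o Theta) w * F n (X w))) =
      (fun n => ev P (fun w => ev (Q (X w)) \1_D * F n (X w))).
    by apply/funext => n; case: (GF n).
  have lhs := lim _ bT; rewrite same in lhs.
  by apply: (cvg_unique _ lhs (lim _ bQ)).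
Qed.

Definition posterior_law (y : Y) : {measure set M -> \bar R} := Q y.

Let measurable_posterior_law (D : set M) : measurable D ->
  measurable_fun setT (posterior_law ^~ D).
Proof.
move=> mD; have [_ mQD _] := indic_good mD.
rewrite (_ : (posterior_law ^~ D) = fun y => (ev (Q y) \1_D)%:E).
  exact/measurable_EFinP.
by apply/funext => y; rewrite ev_indic.
Qed.

HB.instance Definition _ := isKernel.Build _ _ _ _ _ posterior_law
  measurable_posterior_law.

Let posterior_law1 y : posterior_law y setT = 1%E.
Proof. exact: (@probability_setT _ _ _ (Q y)). Qed.

HB.instance Definition _ := Kernel_isProbability.Build _ _ _ _ _
  posterior_law posterior_law1.

Lemma exists_posterior : exists Qk : R.-pker Y ~> M,
  posterior_kernel P Theta X Qk /\ forall y, Qk y = Q y :> {measure set M -> \bar R}.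
Proof.
exists posterior_law; split=> // D E mD mE.
have mTD : measurable (Theta @^-1` D) by rewrite -[X in measurable X]setTI; exact: mTheta.
have mXE : measurable (X @^-1` E) by rewrite -[X in measurable X]setTI; exact: mX.
have [bD mQD _] := indic_good mD.
rewrite -ev_indic; last exact: measurableI.
have bQE : bmeas (fun w => ev (Q (X w)) \1_D * \1_E (X w)).
  apply: bmeasM; first exact: (bmeas_comp mX (bmeas_ev bD mQD)).
  exact: (bmeas_comp mX (bmeas_indic _ mE)).
transitivity (ev P (fun w => ev (Q (X w)) \1_D * \1_E (X w)))%:E.
  rewrite -(indic_rule mD mE); congr (ev P _)%:E; apply/funext => w.
  by rewrite indicI.
rewrite EFin_ev// [RHS]integral_mkcond; apply: eq_integral => w _.
rewrite EFinM ev_indic// patchE indicE.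
rewrite (_ : (X w \in E) = (w \in X @^-1` E)); last by apply/idP/idP => /set_mem/mem_set.
by case: ifP; rewrite ?mule1 ?mule0.
Qed.

End posterior_kernels.

(** * Marked random measures *)

Lemma bmeas_iprod d (Om : measurableType d) (R : realType) (u : nat -> Om -> R) :
  (forall j, bmeas (u j)) -> (forall j w, 0 <= u j w <= 1) ->
  bmeas (fun w => iprod (u ^~ w)).
Proof.
move=> bu u01.
apply: (@bmeas_cvg _ _ _ (fun n w => \prod_(k < n) u k w) _ 1) => [n|n w|w].
- by apply: bmeas_prod => i; exact: bu.
- have /andP[p0 p1] : 0 <= \prod_(k < n) u k w <= 1.
    by rewrite prodr_ge0 ?prodr_ile1// => i _; case/andP: (u01 i w).
  by rewrite ger0_norm.
- by apply: iprod_cvg => k; exact: u01.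
Qed.

(** The mark takes countably many values. *)
Lemma measurable_mark d1 d2 (Om : measurableType d1) (Z : measurableType d2)
    (R : realType) (z : Om -> Z) (n : Om -> nat) (k : Z -> nat -> R) :
  measurable_fun setT z -> measurable_fun setT n ->
  (forall a, measurable_fun setT (k ^~ a)) ->
  measurable_fun setT (fun w => k (z w) (n w)).
Proof.
move=> mz mn mk _ V mV; rewrite setTI.
rewrite (_ : _ @^-1` V = \bigcup_a
    ((n @^-1` [set a]) `&` ((fun w => k (z w) a) @^-1` V))).
  apply: bigcup_measurable => a _; apply: measurableI.
    by rewrite -[X in measurable X]setTI; exact: mn.
  rewrite -[X in measurable X]setTI.
  exact: (measurableT_comp (mk a) mz).
apply/seteqP; split => w /=; first by move=> Vw; exists (n w).
by move=> [a _ [<-]].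
Qed.

Section marked_random_measures.
Context (R : realType) d (Psi : measurableType d).
Hypothesis singletonsP : forall p : Psi, measurable [set p].
Context d' (Om : measurableType d') (P : probability Om R).
Local Notation AM := (atomic_measure Psi R).
Local Notation Z := (measurableTypeR R * Psi)%type.
Local Notation pgf := (pgf singletonsP).
Variables (h : nat -> R -> R).
Hypothesis mh : forall x, measurable_fun setT (h x).
Hypothesis h0 : forall x t, 0 <= h x t.
Hypothesis h1 : forall t, (\sum_(x <oo) (h x t)%:E = 1)%E.
Variables (theta : nat -> Om -> R) (psi : nat -> Om -> Psi)
  (x : nat -> Om -> nat).
Hypothesis mtheta : forall j, measurable_fun setT (theta j).
Hypothesis mpsi : forall j, measurable_fun setT (psi j).
Hypothesis mx : forall j, measurable_fun setT (x j).
Hypothesis xP : cond_independent_pmf P h theta psi x.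
Variables (Theta X : Om -> AM).
Hypothesis mTheta : measurable_fun setT Theta.
Hypothesis mX : measurable_fun setT X.

(** Almost every outcome is of this kind. As a predicate on outcomes it makes the
    lemmas on atoms deterministic. *)
Definition marked (w : Om) : Prop :=
  [/\ (forall j, 0 < theta j w) /\ injective (fun j => psi j w),
      forall S, measurable S ->
        Theta w S = sum_of_atoms (fun j => theta j w) (fun j => psi j w) S &
      forall S, measurable S ->
        X w S = sum_of_atoms (fun j => (x j w)%:R) (fun j => psi j w) S].

Hypothesis marked_ae : {ae P, forall w, marked w}.

Local Notation atom j w := (theta j w, psi j w).

Let matom j : measurable_fun setT (fun w => atom j w).
Proof. by apply: measurable_fun_pair; [exact: mtheta|exact: mpsi]. Qed.

Lemma atoms_Theta w z : marked w ->
  atoms (Theta w) z <-> exists j, z = atom j w.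
Proof.
move=> [[t0 pI] TE _]; have [_ _ ta] := atoms_sum_of_atoms singletonsP
  (fun j => ltW (t0 j)) pI TE.
case: z => y q; split=> [/ta[j [_ -> ->]]|[j [-> ->]]]; first by exists j.
by apply/ta; exists j; rewrite gt_eqF.
Qed.

Lemma mass_X w : marked w ->
  (forall j, am_mass (X w) (psi j w) = (x j w)%:R) /\
  (forall q, (forall j, psi j w != q) -> am_mass (X w) q = 0).
Proof.
move=> [[_ pI] _ XE]; have [xa x0 _] := atoms_sum_of_atoms singletonsP
  (fun j => ler0n R (x j w)) pI XE; by split.
Qed.

Lemma atoms_X w z : marked w ->
  atoms (X w) z <-> exists2 j, x j w != 0%N & z = ((x j w)%:R, psi j w).
Proof.
move=> [[_ pI] _ XE]; have [_ _ xa] := atoms_sum_of_atoms singletonsP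
  (fun j => ler0n R (x j w)) pI XE.
case: z => y q; split=> [/xa[j [xj -> ->]]|[j xj [-> ->]]].
  by exists j => //; rewrite -(@pnatr_eq0 R).
by apply/xa; exists j; rewrite pnatr_eq0.
Qed.

Lemma pgf_Theta f w : unit_fun f -> marked w ->
  pgf f (Theta w) = iprod (fun j => f (atom j w)).
Proof.
move=> uf mw; apply: (@pgf_enum _ _ _ singletonsP f (Theta w) setT xpredT (fun j => atom j w)) => //.
- move=> i j _ _ [_]; case: mw => -[_ pI] _ _; exact: pI.
- by move=> k _; split=> //; apply/(atoms_Theta _ mw); exists k.
- by move=> y /(atoms_Theta _ mw)[j ->] _; exists j.
- by move=> y /(_ I).
Qed.

Lemma pgf_X g w : unit_fun g -> marked w ->
  pgf g (X w) = iprod (fun j => mark_fun g (x j w) (psi j w)).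
Proof.
move=> ug mw; rewrite (@pgf_enum _ _ _ singletonsP g (X w) setT
  (fun j => x j w != 0%N) (fun j => ((x j w)%:R, psi j w)))//.
- by apply: iprod_eq => j; rewrite /mark_fun; case: eqP.
- move=> i j _ _ [_]; case: mw => -[_ pI] _ _; exact: pI.
- by move=> k xk; split=> //; apply/(atoms_X _ mw); exists k.
- by move=> y /(atoms_X _ mw)[j xj ->] _; exists j.
- by move=> y /(_ I).
Qed.

Section marking_functionals.
Variable k : Z -> nat -> R.
Hypothesis uk : forall a, unit_fun (k ^~ a).

Lemma bmeas_marks : bmeas (fun w => iprod (fun j => k (atom j w) (x j w))).
Proof.
have k01 z a : 0 <= k z a <= 1 by case: (uk a).
apply: (@bmeas_iprod _ _ _ (fun j w => k (atom j w) (x j w))) => [j|j w]; last exact: k01.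
apply: bmeas01 => [|w]; last exact: k01.
by apply: measurable_mark => // a; case: (uk a).
Qed.

Lemma marked_pgf : ev P (fun w => iprod (fun j => k (atom j w) (x j w))) =
  ev P (fun w => pgf (mixed_fun h k) (Theta w)).
Proof.
have um := unit_mixed_fun mh h0 h1 uk.
rewrite (marking mh h0 h1 mtheta mpsi mx xP uk); apply: ev_ae.
- have [] // := @bmeas_iprod _ _ _ (fun j w => mixed_fun h k (atom j w)) _ _.
  - move=> j; apply: bmeas01 => [|w]; last by case: um.
    by case: um => mm _; exact: measurableT_comp (matom j).
  - by move=> j w; case: um.
- exact: measurableT_comp (measurable_pgf singletonsP um) mTheta.
- by apply: filterS marked_ae => w mw; rewrite pgf_Theta.
Qed.

End marking_functionals.

(** The mark 0 leaves no atom, so it contributes the factor 1 to the functional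
    of [X]. *)
Lemma joint_pgf f g : unit_fun f -> unit_fun g ->
  ev P (fun w => pgf f (Theta w) * pgf g (X w)) =
  ev P (fun w => pgf (mixed_fun h (joint_fun f g)) (Theta w)).
Proof.
move=> uf ug; have uj := unit_joint_fun uf ug.
rewrite -(marked_pgf uj); apply: ev_ae.
- apply: measurable_funM.
    exact: measurableT_comp (measurable_pgf singletonsP uf) mTheta.
  exact: measurableT_comp (measurable_pgf singletonsP ug) mX.
- by case: (bmeas_marks uj).
apply: filterS marked_ae => w mw; rewrite pgf_Theta// pgf_X// -iprodM.
- exact: iprod_eq.
- by move=> j; case: uf.
- by move=> j; exact: mark_fun01.
Qed.

Lemma ev_pgf_X g : unit_fun g -> ev P (fun w => pgf g (X w)) =
  ev P (fun w => pgf (mixed_fun h (fun z n => mark_fun g n z.2)) (Theta w)).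
Proof.
move=> ug; have um n := unit_mark_fun n ug.
rewrite -(marked_pgf um); apply: ev_ae.
- exact: measurableT_comp (measurable_pgf singletonsP ug) mX.
- by case: (bmeas_marks um).
by apply: filterS marked_ae => w mw; rewrite pgf_X.
Qed.

Section unmarked_atoms.
Variable good : set Om.
Hypothesis mgood : measurable good.
Hypothesis good_marked : good `<=` marked.
Hypothesis good_ae : {ae P, forall w, good w}.

Let massless w : set Psi := ~` [set q | am_mass (X w) q != 0].

Let mmassless w : measurable (massless w).
Proof.
apply: measurableC; apply: countable_measurable => //.
exact: countable_locations.
Qed.

(** The atoms are only controlled on [good], so measurability requires a
    default value elsewhere. *)
Definition unmarked w : AM :=
  if w \in good then am_restr singletonsP (mmassless w) (Theta w) else point.

Definition unmarked_fun (f : Z -> R) (z : Z) (n : nat) : R := if n == 0%N then f z else 1.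

Lemma unit_unmarked_fun f a : unit_fun f -> unit_fun (unmarked_fun f ^~ a).
Proof.
move=> uf; rewrite /unmarked_fun; case: (a == 0%N) => //; exact: unit_fun_cst1.
Qed.

Lemma pgf_unmarked f w : unit_fun f -> good w ->
  pgf f (unmarked w) = iprod (fun j => unmarked_fun f (atom j w) (x j w)).
Proof.
move=> uf gw; have mw := good_marked gw; have [xm _] := mass_X mw.
have ma j : massless w (psi j w) <-> x j w == 0%N.
  rewrite /massless /= xm pnatr_eq0.
  by split=> [/negP|xj]; [rewrite negbK|rewrite xj].
rewrite /unmarked mem_set//.
rewrite (@pgf_enum _ _ _ singletonsP f _ setT
  (fun j => x j w == 0%N) (fun j => atom j w))//.
- move=> i j _ _ [_]; case: mw => -[_ pI] _ _; exact: pI.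
- move=> k xk; split=> //; rewrite atoms_restr; split.
    by apply/(atoms_Theta _ mw); exists k.
  by split=> //; apply/ma.
- move=> y; rewrite atoms_restr => -[/(atoms_Theta _ mw)[j ->] [_ mj]] _.
  by exists j => //; exact/ma.
- by move=> y /(_ I).
Qed.

(** The generating functionals are infinite products over all atoms of
    measurable factors, equal to 1 for the marked atoms. *)
Lemma measurable_unmarked : measurable_fun setT unmarked.
Proof.
apply: (@measurable_fun_pgf _ _ _ singletonsP _ _ unmarked) => f uf.
rewrite (_ : pgf f \o unmarked = fun w => if w \in good
    then iprod (fun j => unmarked_fun f (atom j w) (x j w)) else pgf f point).
  apply: measurable_fun_ifT => //.
    apply: (measurable_fun_bool true); rewrite setTI (_ : _ @^-1` _ = good)//.
    by apply/seteqP; split => w /=; [exact: set_mem|exact: mem_set].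
  by have [] := bmeas_marks (fun a => unit_unmarked_fun a uf).
apply/funext => w /=; case: ifPn => [/set_mem gw|/negbTE nw].
  exact: pgf_unmarked.
by rewrite /unmarked nw.
Qed.

Lemma ev_pgf_unmarked f : unit_fun f -> ev P (fun w => pgf f (unmarked w)) =
  ev P (fun w => pgf (mixed_fun h (unmarked_fun f)) (Theta w)).
Proof.
move=> uf; have uu a := unit_unmarked_fun a uf.
rewrite -(marked_pgf uu); apply: ev_ae.
- exact: measurableT_comp (measurable_pgf singletonsP uf) measurable_unmarked.
- by case: (bmeas_marks uu).
by apply: filterS good_ae => w gw; rewrite pgf_unmarked.
Qed.

End unmarked_atoms.

End marked_random_measures.

(** * Almost sure statements from generating functionals *)

(** Markov's inequality. *)
Lemma ae_not_of_ev d (Om : measurableType d) (R : realType) (P : probability Om R)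
    (A : set Om) : measurable A ->
  (forall e : R, 0 < e -> exists F : Om -> R, [/\ bmeas F, (forall w, 0 <= F w),
     (forall w, A w -> 1 <= F w) & ev P F <= e]) ->
  {ae P, forall w, ~ A w}.
Proof.
move=> mA small; exists A; split=> //; last by move=> w /= /contrapT.
rewrite -ev_indic//; congr _%:E; apply/eqP; rewrite eq_le; apply/andP; split; last first.
  by apply: ev_ge0 => w; rewrite indicE.
apply/ler_addgt0Pl => e e0; rewrite addr0.
have [F [bF F0 F1 Fe]] := small e e0; apply: le_trans Fe.
apply: ev_le => //; first exact: bmeas_indic.
by move=> w; rewrite indicE; have [/set_mem/F1|_] := boolP (w \in A).
Qed.

Section finite_counts.
Context (R : realType) d (Psi : measurableType d).
Local Notation AM := (atomic_measure Psi R).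
Local Notation Z := (measurableTypeR R * Psi)%type.
Implicit Types (m : AM) (C : set Z).

Lemma atom_count_fin m C : (atom_count m C < +oo)%E -> finite_set (atoms m `&` C).
Proof. by rewrite /atom_count /counting; case: ifPn => [/asboolP|]. Qed.

Lemma atom_count_eq0 m C z : atom_count m C = 0%E -> atoms m z -> ~ C z.
Proof.
rewrite /atom_count /counting; case: ifPn => [/asboolP fin|//] h mz Cz.
have /eqP := EFin_inj h; rewrite pnatr_eq0 cardfs_eq0 => /eqP F0.
have : z \in fset_set (atoms m `&` C) by rewrite in_fset_set// mem_set.
by rewrite F0.
Qed.

End finite_counts.

Section counts_from_pgf.
Context (R : realType) d (Psi : measurableType d).
Hypothesis singletonsP : forall p : Psi, measurable [set p].
Context d' (Om : measurableType d') (P : probability Om R).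
Local Notation AM := (atomic_measure Psi R).
Local Notation Z := (measurableTypeR R * Psi)%type.
Local Notation pgf := (pgf singletonsP).
Variables (X : Om -> AM) (C : set Z).
Hypothesis mX : measurable_fun setT X.
Hypothesis mC : measurable C.

Let mcount (V : set (\bar R)) : measurable V -> measurable [set w | V (atom_count (X w) C)].
Proof.
move=> mV; rewrite (_ : [set w | _] = (fun w => atom_count (X w) C) @^-1` V)//.
rewrite -[X in measurable X]setTI.
exact: (measurableT_comp (measurable_atom_count mC) mX).
Qed.

Let bmeas_step u : 0 <= u <= 1 -> bmeas (fun w => pgf (step_fun u C) (X w)).
Proof.
move=> u01; have uu := unit_step_fun mC u01.
apply: bmeas01 => [|w]; last exact: pgf01.
exact: (measurableT_comp (measurable_pgf singletonsP uu) mX).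
Qed.

(** The generating function at [u] vanishes where the count is infinite and,
    under the hypothesis, its expectation tends to 1 with [u]. *)
Lemma ae_count_fin (c : R) : 0 <= c -> (forall u, 0 < u < 1 ->
    1 - (1 - u) * c <= ev P (fun w => pgf (step_fun u C) (X w))) ->
  {ae P, forall w, (atom_count (X w) C < +oo)%E}.
Proof.
move=> c0 low.
have : {ae P, forall w, ~ [set w | (atom_count (X w) C) = +oo%E] w}.
  apply: ae_not_of_ev; first exact: (mcount (emeasurable_set1 _)).
  (* Any [u = 1 - v] with [v * c <= e] makes the bound small enough. *)
  move=> e e0; pose v := Num.min 2^-1 (e / (c + 1)).
  have c1 : 0 < c + 1 by rewrite ltr_wpDl.
  have v0 : 0 < v by rewrite lt_min invr_gt0 ltr0n divr_gt0.
  have v1 : v < 1.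
    by rewrite (@le_lt_trans _ _ 2^-1) ?ge_min ?lexx// invf_lt1 ?ltr1n.
  have u01 : 0 < 1 - v < 1 by rewrite subr_gt0 v1 gtrBl v0.
  have u01' : 0 < 1 - v <= 1 by case/andP: u01 => -> /ltW ->.
  have u01'' : 0 <= 1 - v <= 1 by case/andP: u01 => /ltW -> /ltW ->.
  have bs := bmeas_step u01''.
  exists (fun w => 1 - pgf (step_fun (1 - v) C) (X w)).
  have p01 w := pgf01 singletonsP (X w) (unit_step_fun mC u01'').
  split.
  - by have := bmeasD (bmeas_cst _ 1) (bmeasZ (-1) bs); congr bmeas;
      apply/funext => w; rewrite mulN1r.
  - by move=> w; rewrite subr_ge0; case/andP: (p01 w).
  - move=> w /= Xoo; rewrite pgf_step_fun// Xoo gt0_muley ?subr0//.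
    rewrite lte_fin oppr_gt0 ln_lt0//.
  - rewrite evB//; last exact: bmeas_cst.
    rewrite ev_cst lerBlDl -lerBlDr (le_trans _ (low _ u01))// lerB//.
    rewrite opprB addrCA subrr addr0 (@le_trans _ _ (e / (c + 1) * c))//.
      by rewrite ler_wpM2r// ge_min lexx orbT.
    by rewrite mulrAC ler_pdivrMr// ler_wpM2l ?(ltW e0)// lerDl.
apply: filterS => w /= Xoo; rewrite ltey; exact/eqP.
Qed.

(** The generating function at [u] is at most [u] where the count is not 0. *)
Lemma ae_count0 u : 0 < u < 1 ->
  ev P (fun w => pgf (step_fun u C) (X w)) = 1 ->
  {ae P, forall w, atom_count (X w) C = 0%E}.
Proof.
move=> u01 ev1; have : {ae P, forall w, ~ [set w | (atom_count (X w) C) != 0%E] w}.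
  apply: ae_not_of_ev.
    apply: (mcount (V := [set e | e != 0%E])).
    rewrite (_ : [set e | _] = ~` [set 0%E]); last by apply/seteqP; split => e /= /eqP.
    by apply: measurableC; exact: emeasurable_set1.
  move=> e e0.
  have /andP[u0 u1] := u01.
  have u01' : 0 < u <= 1 by rewrite u0 ltW.
  have u01'' : 0 <= u <= 1 by rewrite !ltW.
  have bs := bmeas_step u01''.
  have p01 w := pgf01 singletonsP (X w) (unit_step_fun mC u01'').
  have bd : bmeas (fun w => 1 - pgf (step_fun u C) (X w)).
    by have := bmeasD (bmeas_cst _ 1) (bmeasZ (-1) bs); congr bmeas;
      apply/funext => w; rewrite mulN1r.
  exists (fun w => (1 - u)^-1 * (1 - pgf (step_fun u C) (X w))).
  have u1' : 0 < 1 - u by rewrite subr_gt0.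
  split.
  - exact: bmeasZ.
  - by move=> w; rewrite mulr_ge0 ?invr_ge0 ?(ltW u1')// subr_ge0; case/andP: (p01 w).
  - move=> w /= X0; rewrite ler_pdivlMl// mulr1 lerB// pgf_step_fun//.
    case: (atom_count_range (X w) C) => [[n nE]|->]; last first.
      by rewrite gt0_muley ?(ltW u0)// lte_fin oppr_gt0 ln_lt0.
    rewrite nE -EFinM /= mulNr opprK mulrC -ln_powR.
    have n0 : n != 0%N by apply: contraNneq X0 => n0; rewrite nE n0.
    rewrite lnK ?posrE ?powR_gt0// powR_mulrn ?(ltW u0)//.
    by case: n n0 {nE} => // n _; rewrite exprS ler_piMr ?(ltW u0)// exprn_ile1// ltW.
  - by rewrite evZ// evB//; [rewrite ev_cst ev1 subrr mulr0 ltW|exact: bmeas_cst].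
by apply: filterS => w /= X0; apply/eqP/negPn/negP.
Qed.

(** The functional vanishes exactly where there is an atom in [C]. *)
Lemma ae_atom : ev P (fun w => pgf (step_fun 0 C) (X w)) = 0 ->
  {ae P, forall w, exists2 z, atoms (X w) z & C z}.
Proof.
move=> ev0; have u01 : 0 <= (0 : R) <= 1 by rewrite lexx ler01.
have us := unit_step_fun mC u01; have [mstep bstep] := bmeas_step u01.
have : {ae P, forall w, ~ [set w | pgf (step_fun 0 C) (X w) = 1] w}.
  apply: ae_not_of_ev.
    rewrite (_ : [set w | _] = (fun w => pgf (step_fun 0 C) (X w)) @^-1` [set 1])//.
    by rewrite -[X in measurable X]setTI; exact: mstep.
  move=> e e0; exists (fun w => pgf (step_fun 0 C) (X w)).
  split; [exact: bmeas_step|by move=> w; case/andP: (pgf01 singletonsP (X w) us)| |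
          by rewrite ev0 ltW].
  by move=> w /= ->.
apply: filterS => w /= X1; apply: contrapT => noatom; apply: X1.
rewrite (@pgf_ext _ _ _ singletonsP _ (X w) _ (cst 1)) ?pgf_cst1//.
- exact: unit_fun_cst1.
- move=> z az; rewrite /step_fun; case: ifPn; rewrite ?eqxx// => /set_mem Cz _.
  by exfalso; apply: noatom; exists z.
- by move=> z _; rewrite eqxx.
Qed.

End counts_from_pgf.

(** * Bayes' rule for generating functionals *)

Lemma mixed_fun_eq1 (R : realType) d (Psi : measurableType d) (h : nat -> R -> R)
    (k : measurableTypeR R * Psi -> nat -> R) z :
  (forall t, \sum_(x <oo) (h x t)%:E = 1)%E ->
  (forall a, h a z.1 = 0 \/ k z a = 1) -> mixed_fun h k z = 1.
Proof.
move=> h1 hk; rewrite /mixed_fun -[RHS]/(fine 1%E) -(h1 z.1); congr fine.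
by apply: eq_eseriesr => a _; case: (hk a) => ->; rewrite ?mul0r ?mulr1.
Qed.

Section bayesian_update.
Context (R : realType) d (Psi : measurableType d).
Hypothesis singletonsP : forall p : Psi, measurable [set p].
Context (s : nat) (T : set R) (kappa : nat -> R)
  (eta : R -> 'rV[R]_s) (phi : nat -> 'rV[R]_s) (A : R -> R).
Hypothesis mT : measurable T.
Hypothesis T_ge0 : forall t, T t -> 0 <= t.
Hypothesis meta : forall i, measurable_fun T (fun t => eta t 0 i).
Hypothesis mA : measurable_fun T A.
Hypothesis kappa_ge0 : forall x, 0 <= kappa x.
Hypothesis pmfP : forall t, T t ->
  (\sum_(x <oo) (likelihood kappa eta phi A x t)%:E = 1)%E.
Context (G : probability Psi R).
Hypothesis G_diffuse : forall p : Psi, G [set p] = 0%E.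
Context (K : nat) (p : 'I_K -> Psi) (xifix : 'I_K -> 'rV[R]_s)
  (lamfix : 'I_K -> R) (gamma : R) (xi : 'rV[R]_s) (lam : R).
Hypothesis fix1 : forall k, (\int[lebesgue_measure]_(t in T)
  (conj_density T eta A (xifix k) (lamfix k) t)%:E = 1)%E.
Hypothesis gamma_gt0 : 0 < gamma.
Local Notation rate := (conj_weight_rate eta A gamma xi lam).
Local Notation L := (likelihood kappa eta phi A).
Local Notation h := (full_likelihood T kappa eta phi A).
Local Notation density := (conj_density T eta A).
Local Notation Z := (measurableTypeR R * Psi)%type.
Local Notation AM := (atomic_measure Psi R).
Local Notation pgf := (pgf singletonsP).
Hypothesis rate_infinite : (\int[lebesgue_measure]_(t in T) (rate t)%:E = +oo)%E.
Hypothesis rate_finite : (\sum_(1 <= x <oo)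
  \int[lebesgue_measure]_(t in T) (rate t * L x t)%:E < +oo)%E.
Local Notation prior := (prior_intensity mT meta mA G xi lam gamma_gt0).
Local Notation post :=
  (post_intensity phi mT meta mA kappa_ge0 G xi lam gamma_gt0).
Local Notation bayes := (bayes_fun T kappa eta phi A p xifix lamfix xi lam).
Context d' (Om : measurableType d') (P : probability Om R).
Variables (theta : nat -> Om -> R) (psi : nat -> Om -> Psi)
  (x : nat -> Om -> nat) (Theta X : Om -> AM).
Hypothesis mtheta : forall j, measurable_fun setT (theta j).
Hypothesis mpsi : forall j, measurable_fun setT (psi j).
Hypothesis mx : forall j, measurable_fun setT (x j).
Hypothesis mTheta : measurable_fun setT Theta.
Hypothesis mX : measurable_fun setT X.
Hypothesis xP : cond_independent_pmf P h theta psi x.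
Variable good : set Om.
Hypothesis mgood : measurable good.
Hypothesis good_marked : good `<=` marked theta psi x Theta X.
Hypothesis good_ae : {ae P, forall w, good w}.
Hypothesis crm : crm_with P Theta T p
  (fun k => density (xifix k) (lamfix k)) prior.

Let marked_ae : {ae P, forall w, marked theta psi x Theta X w}.
Proof. by apply: filterS good_ae. Qed.

Let mh a : measurable_fun setT (h a).
Proof. exact: measurable_full_likelihood. Qed.

Let h0 a t : 0 <= h a t.
Proof. exact: full_likelihood_ge0. Qed.

Let h1 t : (\sum_(a <oo) (h a t)%:E = 1)%E.
Proof. exact: full_likelihood_sum1. Qed.

Let density_ge0 xi' lam' t : T t -> 0 <= density xi' lam' t.
Proof. by move=> _; exact: expR_ge0. Qed.

Definition prior_law (k : 'I_K) : probability R R :=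
  density_prob mT (measurable_density meta mA (xifix k) (lamfix k))
    (@density_ge0 (xifix k) (lamfix k)) (fix1 k).

Let null_points (r : R -> R) (mr : measurable_fun T r)
    (r0 : forall t, T t -> 0 <= r t) (S : set Psi) : G S = 0%E ->
  rate_measure G mT mr r0 (setT `*` S) = 0%E.
Proof.
move=> GS; rewrite rate_measureE integral0_eq// => t _.
by rewrite in_xsectionX ?GS ?mule0//; exact: mem_set.
Qed.

Lemma pgf_prior g : unit_fun g -> ev P (fun w => pgf g (Theta w)) =
  (\prod_k ev (prior_law k) (fun t => g (t, p k))) *
  expn (\int[prior]_z (1 - g z)%:E)%E.
Proof.
move=> ug; apply: (pgf_crm singletonsP mTheta mT T_ge0 _ _ _ crm ug).
- by move=> k; exact: measurable_density.
- by move=> k V mV; exact: density_probE.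
- by move=> k; exact: null_points.
Qed.

Let unit_bayes f g : unit_fun f -> unit_fun g -> forall a, unit_fun (bayes f g ^~ a).
Proof.
move=> uf ug a; exact: (unit_bayes_fun singletonsP mT meta mA kappa_ge0 pmfP p fix1
  gamma_gt0 rate_infinite rate_finite uf ug).
Qed.

Let prior_law_mixed (k : Z -> nat -> R) i : injective p ->
  (forall a, unit_fun (k ^~ a)) ->
  (ev (prior_law i) (fun t => mixed_fun h k (t, p i)))%:E =
  (\int[lebesgue_measure]_(t in T)
    (prior_weight T eta A p xifix lamfix gamma xi lam (p i) t *
     mixed_fun h k (t, p i))%:E)%E.
Proof.
move=> pI uk; have [mm m01] := unit_mixed_fun mh h0 h1 uk.
rewrite ev_density.
- by rewrite /prior_weight; case: pickP => [j /eqP/pI ->//|/(_ i)]; rewrite eqxx.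
- exact: (measurableT_comp mm (measurable_pair2 _)).
- by move=> t; exact: m01.
Qed.

(** On the right-hand side, the weight has been averaged under its law given
    the mark. *)
Lemma fixed_factors f g : unit_fun f -> unit_fun g ->
  \prod_k ev (prior_law k) (fun t => mixed_fun h (joint_fun f g) (t, p k)) =
  \prod_k ev (prior_law k) (fun t => mixed_fun h (bayes f g) (t, p k)).
Proof.
move=> uf ug; have pI : injective p by case: crm.
have uj := unit_joint_fun uf ug; have ub := unit_bayes uf ug.
apply: eq_bigr => k _; apply: EFin_inj.
apply: (etrans (prior_law_mixed k pI uj)).
apply: etrans (esym (prior_law_mixed k pI ub)).
apply: (bayes_fixed singletonsP mT meta mA kappa_ge0 pmfP fix1 gamma_gt0
    rate_infinite rate_finite uf ug).
by apply: mem_set; exists k.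
Qed.

(** Bayes' rule for the generating functionals: conditionally on the marks,
    every marked or fixed location contributes its posterior mean, and the
    unmarked atoms form an independent Poisson process. *)
Lemma joint_pgf_bayes f g : unit_fun f -> unit_fun g ->
  ev P (fun w => pgf f (Theta w) * pgf g (X w)) =
  ev P (fun w => iprod (fun j => bayes f g (theta j w, psi j w) (x j w))) *
  expn (\int[post]_z (1 - f z)%:E)%E.
Proof.
move=> uf ug; have uj := unit_joint_fun uf ug; have ub := unit_bayes uf ug.
have mj := unit_mixed_fun mh h0 h1 uj; have mb := unit_mixed_fun mh h0 h1 ub.
have lhs := joint_pgf singletonsP mh h0 h1 mtheta mpsi mx xP mTheta mX marked_ae uf ug.
have rhs := marked_pgf singletonsP mh h0 h1 mtheta mpsi mx xP mTheta marked_ae ub.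
have rateE := bayes_rate singletonsP mT meta mA kappa_ge0 pmfP G_diffuse p fix1
  gamma_gt0 rate_infinite rate_finite uf ug.
have b0 : (0 <= \int[prior]_z (1 - mixed_fun h (bayes f g) z)%:E)%E.
  by apply: integral_ge0 => z _; rewrite lee_fin subr_ge0; case: mb => _ /(_ z)/andP[].
have f0 : (0 <= \int[post]_z (1 - f z)%:E)%E.
  by apply: integral_ge0 => z _; rewrite lee_fin subr_ge0; case: uf => _ /(_ z)/andP[].
apply: (etrans lhs); apply: (etrans (pgf_prior mj)).
apply: (etrans (congr1 (fun y => y * _) (fixed_factors uf ug))).
apply: (etrans (congr1 (fun y => _ * expn y) rateE)).
apply: (etrans (congr1 (fun y => _ * y) (expnD b0 f0))).
apply: (etrans (mulrA _ _ _)).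
exact: (congr1 (fun y => y * _) (esym (etrans rhs (pgf_prior mb)))).
Qed.

Local Notation Theta0 := (unmarked singletonsP Theta X good).

Let mTheta0 : measurable_fun setT Theta0.
Proof. exact: (measurable_unmarked singletonsP mtheta mpsi mx mgood good_marked). Qed.

(** The unmarked atoms away from the fixed locations carry the ordinary part of
    the posterior, whatever the observation is. *)
Definition base_law : probability AM R := image_prob P mTheta0.

Let rate_unmarked_fun f : unit_fun f ->
  (\int[prior]_z (1 - mixed_fun h (unmarked_fun f) z)%:E =
   \int[post]_z (1 - f z)%:E)%E.
Proof.
move=> uf; have uu a := unit_unmarked_fun a uf.
have [mm m01] := unit_mixed_fun mh h0 h1 uu; have [mf f01] := uf.
have mf1 : measurable_fun setT (fun z => (1 - f z)%:E).
  by apply/measurable_EFinP; exact: measurable_funB.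
have f1 z : (0 <= (1 - f z)%:E)%E by rewrite lee_fin subr_ge0; case/andP: (f01 z).
apply: (etrans (integral_rate G mT _ _ _ _)).
- by apply/measurable_EFinP; exact: measurable_funB.
- by move=> z; rewrite lee_fin subr_ge0; case/andP: (m01 z).
apply: (etrans _ (esym (integral_rate G mT _ _ mf1 f1))).
apply: eq_integral => t /set_mem Tt; rewrite post_rateE [in RHS]EFinM -[RHS]muleA.
congr (_ * _)%E.
have L0t : 0 <= L 0 t by exact: likelihood_ge0.
rewrite -ge0_integralZl_EFin//; last first.
  by apply: (measurableT_comp mf1); exact: measurable_pair1.
apply: eq_integral => q _; rewrite (onem_mixed_fun h0 h1 _ uu).
rewrite (nneseriesD1 (n := 0%N))//; last first.
  move=> a _; rewrite lee_fin mulr_ge0// subr_ge0.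
  by case: (uu a) => _ /(_ (t, q))/andP[].
rewrite eseries0 ?adde0 => [|a _ /= /negbTE a0]; last first.
  by rewrite /unmarked_fun a0 subrr mulr0.
by rewrite -EFinM /unmarked_fun eqxx full_likelihoodE.
Qed.

(** The mark 0 thins the intensity by its likelihood, and the functions
    considered ignore the fixed locations. *)
Lemma pgf_unmarked_law f : unit_fun f -> (forall z, range p z.2 -> f z = 1) ->
  ev P (fun w => pgf f (Theta0 w)) = expn (\int[post]_z (1 - f z)%:E)%E.
Proof.
move=> uf fp; have uu a := unit_unmarked_fun a uf.
have E := ev_pgf_unmarked singletonsP mh h0 h1 mtheta mpsi mx xP mTheta marked_ae
  mgood good_marked good_ae uf.
apply: (etrans E); apply: (etrans (pgf_prior (unit_mixed_fun mh h0 h1 uu))).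
apply: (etrans (congr1 (fun y => _ * expn y) (rate_unmarked_fun uf))).
have prod1 : \prod_k ev (prior_law k) (fun t => mixed_fun h (unmarked_fun f) (t, p k)) = 1.
  apply: big1 => k _; apply: etrans (ev_cst (prior_law k) 1); congr (ev _ _).
  apply/funext => t; apply: (mixed_fun_eq1 h1) => a; right; rewrite /unmarked_fun.
  by case: (a == 0%N); [apply: fp; exists k|].
exact: (etrans (congr1 (fun y => y * _) prod1) (mul1r _)).
Qed.

(** Removing finitely many further locations changes nothing, as they are null
    for the intensity. *)
Lemma base_poisson (l : seq Psi) (ml : measurable (~` [set` l])) :
  range p `<=` [set` l] ->
  poisson_process base_law (fun m => atom_count (am_restr singletonsP ml m)) post.
Proof.
move=> pl; pose D : set Z := setT `*` ~` [set` l].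
have mD : measurable D by apply: measurableX.
have mid : measurable_fun setT (@idfun AM) by exact: measurable_id.
have law f : unit_fun f -> (forall z, ~ D z -> f z = 1) ->
    ev base_law (fun m => pgf f (idfun m)) = expn (\int[post]_z (1 - f z)%:E)%E.
  move=> uf f1; apply: etrans (pgf_unmarked_law uf _).
    exact: (@ev_pushforward _ _ _ _ _ P base_law Theta0 mTheta0
      (fun B _ => image_probE P mTheta0 B) _ (bmeas_pgf singletonsP uf)).
  by move=> z pz; apply: f1 => -[_]; apply; exact: pl.
have pp := pgf_poisson mid mD law.
rewrite (_ : (fun m => atom_count (am_restr singletonsP ml m)) =
    (fun m C => atom_count (idfun m) (C `&` D))); last first.
  by apply/funext => m; apply/funext => C; rewrite atom_count_restr.
suff postD C : measurable C -> post (C `&` D) = post C.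
  case: pp => p1 p2; split=> // C mC; rewrite -(postD C mC); exact: p1.
move=> mC; have mDC : measurable (setT `*` [set` l] : set Z).
  apply: measurableX => //; apply: countable_measurable => //.
  by apply: finite_set_countable; exact: finite_seq.
have null : post (setT `*` [set` l]) = 0%E by apply: null_points; exact: diffuse_seq.
have CD : C `\` (setT `*` [set` l]) = C `&` D.
  apply/seteqP; split => -[t q] /= [Ct]; last by move=> [_ ql]; split=> // -[].
  by move=> tl; split=> //; split=> // ql; apply: tl.
have le0 : (post (C `&` (setT `*` [set` l])) <= post (setT `*` [set` l]))%E.
  by apply: le_measure; rewrite ?in_setE//; exact: measurableI.
have ge0 : (0 <= post (C `&` (setT `*` [set` l])))%E by exact: measure_ge0.
rewrite null in le0; have C0 : post (C `&` (setT `*` [set` l])) = 0%E.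
  by apply: le_anti; rewrite le0 ge0.
apply: esym; apply: (etrans (measureDI post mC mDC)).
apply: (etrans (congr1 (fun y => _ + y)%E C0)).
exact: (etrans (adde0 _) (congr1 _ CD)).
Qed.

(** The weights at the fixed locations are positive, so each of these is the
    location of some atom of [Theta]. *)
Lemma ae_fixed_location : {ae P, forall w, forall k, exists j, psi j w = p k}.
Proof.
apply: filter_forall => k; pose C : set Z := setT `*` [set p k].
have mC : measurable C by apply: measurableX.
have u0 : unit_fun (step_fun 0 C : Z -> R) by apply: unit_step_fun => //; rewrite lexx ler01.
have ev0 : ev P (fun w => pgf (step_fun 0 C) (Theta w)) = 0.
  apply: (etrans (pgf_prior u0)).
  have F0 : ev (prior_law k) (fun t => step_fun 0 C (t, p k)) = 0.
    apply: etrans (ev_cst (prior_law k) 0); congr (ev _ _); apply/funext => t.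
    by rewrite /step_fun mem_set.
  have prod0 : \prod_i ev (prior_law i) (fun t => step_fun 0 C (t, p i)) = 0.
    by apply: (etrans (bigD1 k _)) => //=; apply: (etrans (congr1 (fun y => y * _) F0)); exact: mul0r.
  exact: (etrans (congr1 (fun y => y * _) prod0) (mul0r _)).
have := ae_atom mTheta mC ev0.
move=> H; apply: filterS2 H good_ae => w [z az [_ zk]] gw.
have [j zj] := (atoms_Theta singletonsP z (good_marked gw)).1 az.
by exists j; rewrite -zk zj.
Qed.

(** The observed atoms avoid this set almost surely. *)
Definition impossible : set Z :=
  ~` ((\bigcup_(n in [set n | 0 < kappa n]) [set (n%:R : measurableTypeR R)]) `*` setT).

Definition elsewhere : set Z := setT `*` ~` range p.

Let m_impossible : measurable impossible.
Proof.
apply: measurableC; apply: measurableX => //.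
by apply: bigcup_measurable => n _; exact: measurable_set1.
Qed.

Let m_elsewhere : measurable elsewhere.
Proof.
apply: measurableX => //; apply: measurableC; apply: countable_measurable => //.
exact: sub_countable (card_image_le _ _) _.
Qed.

(** Where a mark has probability 0 its likelihood vanishes, so averaging over
    the marks turns a functional that tests only such marks into 1. *)
Lemma ae_possible : {ae P, forall w, atom_count (X w) impossible = 0%E}.
Proof.
have u01 : 0 < (2^-1 : R) < 1 by rewrite invr_gt0 ltr0n invf_lt1 ?ltr1n.
have us : unit_fun (step_fun 2^-1 impossible : Z -> R).
  by apply: unit_step_fun => //; case/andP: u01 => /ltW -> /ltW ->.
apply: (@ae_count0 _ _ _ singletonsP _ _ P X impossible mX m_impossible _ u01).
apply: (etrans (ev_pgf_X singletonsP mh h0 h1 mtheta mpsi mx xP mTheta mX marked_ae us)).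
apply: etrans (ev_cst P 1); congr (ev _ _); apply/funext => w.
apply: etrans (pgf_cst1 singletonsP (Theta w)); congr (pgf _ _).
apply/funext => z; apply: (mixed_fun_eq1 h1) => a.
have [ka|ka] := boolP (0 < kappa a).
  right; rewrite /mark_fun; case: (a == 0%N) => //.
  by rewrite /step_fun memNset// => -[]; split=> //; exists a.
have [->|a0] := eqVneq a 0%N; [by right|left].
rewrite /full_likelihood (negbTE a0); case: ifP => // _.
rewrite /likelihood (_ : kappa a = 0) ?mul0r//.
by apply/eqP; rewrite eq_le kappa_ge0 leNgt ka.
Qed.

Let marked_rate : R :=
  fine (\sum_(1 <= a <oo) \int[lebesgue_measure]_(t in T) (rate t * L a t)%:E)%E.

Let rate0 t : 0 <= rate t.
Proof. by rewrite ltW//; exact: rate_gt0. Qed.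

Let rateL_ge0 a : (0 <= \int[lebesgue_measure]_(t in T) (rate t * L a t)%:E)%E.
Proof.
by apply: integral_ge0 => t _; rewrite lee_fin mulr_ge0//; exact: likelihood_ge0.
Qed.

Let marked_rateE :
  (\sum_(1 <= a <oo) \int[lebesgue_measure]_(t in T) (rate t * L a t)%:E =
  marked_rate%:E)%E.
Proof.
rewrite /marked_rate fineK// ge0_fin_numE//.
by apply: nneseries_ge0 => a _ _; exact: rateL_ge0.
Qed.

(** The mark 0 leaves no atom, and a positive one costs at most [1 - u]. *)
Let rate_step u : 0 < u < 1 ->
  (\int[prior]_z (1 - mixed_fun h (fun z a => mark_fun (step_fun u elsewhere) a z.2) z)%:E
   <= ((1 - u) * marked_rate)%:E)%E.
Proof.
move=> /andP[u0 u1]; have us : unit_fun (step_fun u elsewhere : Z -> R).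
  by apply: unit_step_fun => //; rewrite !ltW.
have um a := unit_mark_fun a us.
have u1' : 0 <= 1 - u by rewrite subr_ge0 ltW.
have mrate := measurable_rate meta mA gamma xi lam.
apply: (le_trans (y := (\sum_(a <oo) (if a == 0%N then 0 else
  (1 - u)%:E * \int[lebesgue_measure]_(t in T) (rate t * L a t)%:E))%E)); last first.
  rewrite nneseries_recl//; last first.
    by move=> a _; case: ifP => // _; apply: mule_ge0; rewrite ?lee_fin.
  rewrite eqxx add0e EFinM -marked_rateE -nneseriesZl//.
  rewrite eseries_cond [leRHS]eseries_cond le_eqVlt; apply/orP; left; apply/eqP.
  by apply: eq_eseriesr => -[].
apply: (le_trans (y := (\sum_(a <oo) \int[lebesgue_measure]_(t in T)
    ((rate t * h a t)%:E * \int[G]_q (1 - mark_fun (step_fun u elsewhere) a q)%:E))%E)).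
  have E := @rate_mixed _ _ _ h mh h0 h1 T mT G rate mrate (fun t _ => rate0 t) _ um.
  exact: (eq_ind _ (fun y => (_ <= y)%E) (lexx _) _ E).
apply: lee_nneseries.
  move=> a _ _; apply: integral_ge0 => t _; apply: mule_ge0.
    by rewrite lee_fin mulr_ge0.
  apply: integral_ge0 => q _; rewrite lee_fin subr_ge0.
  by case: (um a) => _ /(_ (0, q))/andP[].
move=> a _; have [->|a0] := eqVneq a 0%N.
  rewrite integral0_eq// => t _; rewrite integral0_eq ?mule0// => q _.
  by rewrite /mark_fun eqxx subrr.
rewrite -ge0_integralZl_EFin//; last 2 first.
- by move=> t _; rewrite lee_fin mulr_ge0//; exact: likelihood_ge0.
- by apply/measurable_EFinP; apply: measurable_funM => //; exact: measurable_likelihood.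
apply: ge0_le_integral => //.
- move=> t _; apply: mule_ge0; first by rewrite lee_fin mulr_ge0.
  apply: integral_ge0 => q _; rewrite lee_fin subr_ge0.
  by case: (um a) => _ /(_ (0, q))/andP[].
- apply: emeasurable_funM => //; apply/measurable_EFinP; apply: measurable_funM => //.
  by apply: measurable_funTS; exact: mh.
- apply: emeasurable_funM => //; apply/measurable_EFinP; apply: measurable_funM => //.
  exact: measurable_likelihood.
move=> t Tt; rewrite full_likelihoodE// muleC.
apply: lee_wpmul2r.
  by rewrite lee_fin mulr_ge0//; exact: likelihood_ge0.
rewrite -[leRHS]mule1 -(@probability_setT _ _ _ G) -integral_cst//.
apply: ge0_le_integral => //.
- move=> q _; rewrite lee_fin subr_ge0.
  by case: (um a) => _ /(_ (0, q))/andP[].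
- apply/measurable_EFinP; apply: measurable_funB => //.
  case: (um a) => mm _.
  exact: (measurableT_comp mm (@measurable_pair1 _ _ (measurableTypeR R) Psi (0 : R))).
- move=> q _; rewrite lee_fin lerB// /mark_fun (negbTE a0) /step_fun.
  by case: ifP => // _; exact: ltW.
Qed.

(** The expected number of marked atoms away from the fixed locations is finite:
    it is the total rate of the positive marks. *)
Lemma ae_finite : {ae P, forall w, (atom_count (X w) elsewhere < +oo)%E}.
Proof.
have c0 : 0 <= marked_rate.
  by apply: fine_ge0; apply: nneseries_ge0 => a _ _; exact: rateL_ge0.
apply: (@ae_count_fin _ _ _ singletonsP _ _ P X elsewhere mX m_elsewhere _ c0) => u u01.
have us : unit_fun (step_fun u elsewhere : Z -> R).
  by apply: unit_step_fun => //; case/andP: u01 => /ltW -> /ltW ->.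
have um a := unit_mark_fun a us.
have E := ev_pgf_X singletonsP mh h0 h1 mtheta mpsi mx xP mTheta mX marked_ae us.
have prod1 : \prod_k ev (prior_law k) (fun t =>
    mixed_fun h (fun z a => mark_fun (step_fun u elsewhere) a z.2) (t, p k)) = 1.
  apply: big1 => k _; apply: etrans (ev_cst (prior_law k) 1); congr (ev _ _).
  apply/funext => t; apply: (mixed_fun_eq1 h1) => a; right.
  rewrite /mark_fun; case: (a == 0%N); first reflexivity.
  rewrite /step_fun memNset; first reflexivity.
  by move=> [_ /=]; apply; exists k.
have {}E := etrans E (etrans (pgf_prior (unit_mixed_fun mh h0 h1 um))
  (etrans (congr1 (fun y => y * _) prod1) (mul1r _))).
apply: (eq_ind _ (fun y => _ <= y) _ _ (esym E)).
have le := rate_step u01.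
have ge0 : (0 <= \int[prior]_z (1 - mixed_fun h
    (fun z a => mark_fun (step_fun u elsewhere) a z.2) z)%:E)%E.
  apply: integral_ge0 => z _; rewrite lee_fin subr_ge0.
  by case: (unit_mixed_fun mh h0 h1 um) => _ /(_ z)/andP[].
move: le ge0; case: (\int[prior]_z _)%E => [y|//|//].
rewrite !lee_fin /expn => yc _; apply: le_trans (expR_ge1Dx _).
by rewrite lerD2l lerN2.
Qed.

End bayesian_update.

(** * The posterior law *)

Section posterior_family.
Context (R : realType) d (Psi : measurableType d).
Hypothesis singletonsP : forall p : Psi, measurable [set p].
Context (s : nat) (T : set R) (kappa : nat -> R)
  (eta : R -> 'rV[R]_s) (phi : nat -> 'rV[R]_s) (A : R -> R).
Hypothesis mT : measurable T.
Hypothesis T_ge0 : forall t, T t -> 0 <= t.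
Hypothesis meta : forall i, measurable_fun T (fun t => eta t 0 i).
Hypothesis mA : measurable_fun T A.
Hypothesis kappa_ge0 : forall x, 0 <= kappa x.
Hypothesis pmfP : forall t, T t ->
  (\sum_(x <oo) (likelihood kappa eta phi A x t)%:E = 1)%E.
Context (G : probability Psi R).
Hypothesis G_diffuse : forall p : Psi, G [set p] = 0%E.
Context (K : nat) (p : 'I_K -> Psi) (xifix : 'I_K -> 'rV[R]_s)
  (lamfix : 'I_K -> R) (gamma : R) (xi : 'rV[R]_s) (lam : R).
Hypothesis pI : injective p.
Hypothesis fix1 : forall k, (\int[lebesgue_measure]_(t in T)
  (conj_density T eta A (xifix k) (lamfix k) t)%:E = 1)%E.
Hypothesis gamma_gt0 : 0 < gamma.
Local Notation rate := (conj_weight_rate eta A gamma xi lam).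
Local Notation L := (likelihood kappa eta phi A).
Local Notation Z := (measurableTypeR R * Psi)%type.
Local Notation AM := (atomic_measure Psi R).
Local Notation pgf := (pgf singletonsP).
Hypothesis rate_infinite : (\int[lebesgue_measure]_(t in T) (rate t)%:E = +oo)%E.
Hypothesis rate_finite : (\sum_(1 <= x <oo)
  \int[lebesgue_measure]_(t in T) (rate t * L x t)%:E < +oo)%E.
Local Notation post :=
  (post_intensity phi mT meta mA kappa_ge0 G xi lam gamma_gt0).
Local Notation post_dens := (post_density T eta phi A p xifix lamfix xi lam).
Local Notation mean := (post_mean T kappa eta phi A p xifix lamfix xi lam).
Variable base : probability AM R.
Hypothesis base_poisson : forall (l : seq Psi) (ml : measurable (~` [set` l])),
  range p `<=` [set` l] ->
  poisson_process base (fun m => atom_count (am_restr singletonsP ml m)) post.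
Implicit Types (m : AM) (n : nat) (q : Psi).

(** Almost surely satisfied by the observation; elsewhere the posterior law is
    arbitrary. *)
Definition possible m : Prop :=
  atom_count m (impossible kappa) = 0%E /\ (atom_count m (elsewhere p) < +oo)%E.

(** The weight of an observed atom is a natural number, its mark. *)
Definition mark_count m q : nat := Num.truncn (am_mass m q).

Lemma mark_countE m q : possible m ->
  am_mass m q = (mark_count m q)%:R /\ 0 < kappa (mark_count m q).
Proof.
move=> [m0 _]; rewrite /mark_count; have [q0|q0] := eqVneq (am_mass m q) 0.
  rewrite q0 (natrK 0); split=> //.
  exact: (kappa0_gt0 mT meta mA kappa_ge0 pmfP gamma_gt0 rate_infinite rate_finite).
have mq : atoms m (am_mass m q, q) by apply/(atomsP m).
have [n kn mn] : exists2 n, 0 < kappa n & am_mass m q = n%:R.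
  have /contrapT := atom_count_eq0 m0 mq.
  by move=> [[n kn mn] _]; exists n.
by rewrite mn natrK.
Qed.

Definition locations m : seq Psi :=
  [seq p k | k <- enum 'I_K] ++
  enum_fset (fset_set [set q | ~ range p q /\ am_mass m q != 0]).

Let fixed_seq q : (q \in [seq p k | k <- enum 'I_K]) <-> range p q.
Proof.
split=> [/mapP[k _ ->]|[k _ <-]]; first by exists k.
by apply: map_f; rewrite mem_enum.
Qed.

Let finite_marked m : possible m ->
  finite_set [set q | ~ range p q /\ am_mass m q != 0].
Proof.
move=> [_ /atom_count_fin fin]; apply: sub_finite_set (finite_image snd fin).
move=> q [qp q0]; exists (am_mass m q, q) => //; split.
  exact/(atomsP m).
by split.
Qed.

Let in_marked m q : possible m ->
  (q \in enum_fset (fset_set [set q | ~ range p q /\ am_mass m q != 0])) <->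
  ~ range p q /\ am_mass m q != 0.
Proof.
move=> /finite_marked fin.
rewrite -[_ \in enum_fset _]/(q \in fset_set _) in_fset_set//.
by split=> [/set_mem|/mem_set].
Qed.

Lemma mem_locations m q : possible m ->
  q \in locations m <-> range p q \/ am_mass m q != 0.
Proof.
move=> pm; rewrite mem_cat; split.
  by move=> /orP[/fixed_seq|/(in_marked _ pm)[]]; [left|right].
have [qp _|qp [//|q0]] := pselect (range p q).
  by rewrite (fixed_seq q).2.
by apply/orP; right; apply/(in_marked _ pm).
Qed.

Lemma uniq_locations m : possible m -> uniq (locations m).
Proof.
move=> pm; rewrite cat_uniq map_inj_uniq ?enum_uniq//= fset_uniq andbT.
by apply/hasPn => q /(in_marked _ pm)[qp _]; apply/negP => /fixed_seq.
Qed.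

Lemma observable_locations m q : possible m -> q \in locations m ->
  observable kappa p (mark_count m q) q.
Proof.
move=> pm /(mem_locations _ pm) qm; have [mq kq] := mark_countE q pm.
rewrite /observable kq andbT; case: qm => [qp|]; first by rewrite mem_set.
by rewrite mq pnatr_eq0 lt0n orbC => ->.
Qed.

Let post_density1 n q (nq : observable kappa p n q) :
  (\int[lebesgue_measure]_(t in T) (post_dens n q t)%:E = 1)%E.
Proof.
by have [] := post_densityE mT meta mA kappa_ge0 pmfP fix1 gamma_gt0
  rate_infinite rate_finite nq.
Qed.

Let post_density_ge0 n q t : T t -> 0 <= post_dens n q t.
Proof. by move=> _; exact: expR_ge0. Qed.

Let measurable_post_density n q : measurable_fun T (post_dens n q).
Proof. exact: measurable_density. Qed.

(** For marks that are not observable any law of a nonnegative weight will do. *)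
Definition weight_law n q : probability R R :=
  match pselect (observable kappa p n q) with
  | left nq => density_prob mT (measurable_post_density n q)
      (post_density_ge0 n q) (post_density1 nq)
  | right _ => \d_(1 : R)
  end.

Lemma weight_lawE n q V : observable kappa p n q -> measurable V ->
  weight_law n q V = (\int[lebesgue_measure]_(t in V `&` T) (post_dens n q t)%:E)%E.
Proof.
by move=> nq mV; rewrite /weight_law; case: pselect => // nq'; exact: density_probE.
Qed.

(** The support consists of nonnegative numbers, so the absolute value in
    [set_atom] is harmless. *)
Lemma weight_law_norm n q V : measurable V ->
  weight_law n q [set t : R | V `|t|] = weight_law n q V.
Proof.
move=> mV; rewrite /weight_law; case: pselect => [nq|_].
  have mV' : measurable [set t : R | V `|t|].
    rewrite (_ : [set t | _] = Num.norm @^-1` V)//.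
    by rewrite -[X in measurable X]setTI; exact: normr_measurable.
  apply: (etrans (density_probE mT _ _ _ mV')).
  apply: (etrans _ (esym (density_probE mT _ _ _ mV))).
  congr (integral _ _ _); apply/seteqP; split => t /= [Vt Tt]; split=> //.
    by move: Vt; rewrite ger0_norm//; exact: T_ge0.
  by rewrite ger0_norm//; exact: T_ge0.
rewrite /= !diracE; congr (nat_of_bool _)%:R%:E.
by apply/idP/idP => /set_mem V1; apply: mem_set; move: V1; rewrite /= normr1.
Qed.

Lemma ev_weight_law f n q : unit_fun f -> observable kappa p n q ->
  ev (weight_law n q) (fun t => f (t, q)) = mean f n q.
Proof.
move=> uf nq; apply: EFin_inj.
apply: (etrans _ (esym (EFin_post_mean mT meta mA kappa_ge0 pmfP fix1 gamma_gt0
  rate_infinite rate_finite uf nq))).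
rewrite /weight_law; case: pselect => // nq'; apply: ev_density.
  by case: uf => mf _; exact: (measurableT_comp mf (measurable_pair2 _)).
by move=> t; case: uf.
Qed.

Definition posterior m : probability AM R :=
  if pselect (possible m) then
    with_atoms singletonsP base (fun q => weight_law (mark_count m q) q) (locations m)
  else base.

Let m_unlocated m : measurable (~` [set` locations m]).
Proof.
apply: measurableC; apply: countable_measurable => //.
by apply: finite_set_countable; exact: finite_seq.
Qed.

Lemma posterior_crm m : possible m -> crm_with (posterior m) (@idfun AM) T
  (tnth (in_tuple (locations m)))
  (fun k => post_dens (mark_count m (tnth (in_tuple (locations m)) k))
                      (tnth (in_tuple (locations m)) k))
  post.
Proof.
move=> pm; rewrite /posterior; case: pselect => // pm'.
apply: (@crm_with_atoms _ _ _ singletonsP base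
  (fun q => weight_law (mark_count m q) q) _ (locations m) T
  (fun q => post_dens (mark_count m q) q) post _ _ (m_unlocated m)).
- by move=> q V; exact: weight_law_norm.
- exact: uniq_locations.
- move=> q V ql mV; apply: weight_lawE => //; exact: observable_locations.
- apply: base_poisson => q qp; apply/(mem_locations _ pm); by left.
Qed.

(** The marks 0 still have infinite rate, and the likelihood of 0 is at most 1,
    so the rate of the positive marks under the posterior is bounded by that
    under the prior. *)
Lemma posterior_conj m : possible m ->
  conj_prior T kappa eta phi A G (posterior m) (@idfun AM).
Proof.
move=> pm; pose l := in_tuple (locations m).
have lm k : tnth l k \in locations m by exact: mem_tnth.
have L0 := likelihood_ge0 eta phi A kappa_ge0.
have rateE := post_rateE kappa eta phi A gamma xi lam.
have k0 := kappa0_gt0 mT meta mA kappa_ge0 pmfP gamma_gt0 rate_infinite rate_finite.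
have mrate := measurable_rate meta mA gamma xi lam.
have mpost : measurable_fun T (post_rate kappa eta phi A gamma xi lam).
  exact: measurable_post_rate.
have mL a := measurable_likelihood kappa phi meta mA a.
have r0 t : 0 <= rate t by rewrite ltW//; exact: rate_gt0.
exists (size (locations m)), (tnth l),
  (fun k => prior_xi p xifix xi (tnth l k) + phi (mark_count m (tnth l k))),
  (fun k => prior_lam p lamfix lam (tnth l k) + 1),
  (gamma * kappa 0), (xi + phi 0), (lam + 1); split.
- by move=> k; apply: post_density1; exact: observable_locations.
- exact: mulr_gt0.
- apply: etrans (rate_unmarked mT meta mA kappa_ge0 pmfP gamma_gt0 rate_infinite rate_finite).
  by apply: eq_integral => t _; rewrite -rateE.
- apply: le_lt_trans rate_finite; apply: lee_nneseries.
    move=> a _ _; apply: integral_ge0 => t _; rewrite lee_fin mulr_ge0//.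
    by rewrite -[X in 0 <= X]/(post_rate kappa eta phi A gamma xi lam t) rateE mulr_ge0.
  move=> a _; apply: ge0_le_integral => //.
  + move=> t _; rewrite lee_fin mulr_ge0//.
    by rewrite -[X in 0 <= X]/(post_rate kappa eta phi A gamma xi lam t) rateE mulr_ge0.
  + apply/measurable_EFinP; apply: measurable_funM; [exact: mpost|exact: mL].
  + by apply/measurable_EFinP; apply: measurable_funM; [exact: mrate|exact: mL].
  + move=> t Tt; rewrite lee_fin ler_wpM2r//.
    rewrite -[X in X <= _]/(post_rate kappa eta phi A gamma xi lam t) rateE ler_piMr//.
    exact: (likelihood_le1 kappa_ge0 pmfP).
- rewrite (_ : conj_rate _ _ _ _ _ _ _ = post); first exact: posterior_crm.
  by apply/funext => C; apply/esym; exact: rate_measureE.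
Qed.

Lemma pgf_posterior m f : possible m -> unit_fun f -> ev (posterior m) (pgf f) =
  (\prod_(q <- locations m) mean f (mark_count m q) q) *
  expn (\int[post]_z (1 - f z)%:E)%E.
Proof.
move=> pm uf; pose l := in_tuple (locations m).
have lm k : tnth l k \in locations m by exact: mem_tnth.
have mid : measurable_fun setT (@idfun AM) by exact: measurable_id.
have nullp k : post (setT `*` [set tnth l k]) = 0%E.
  apply: (etrans (rate_measureE G mT _ _ _)); apply: integral0_eq => t _.
  by rewrite in_xsectionX ?G_diffuse ?mule0//; exact: mem_set.
have E := @pgf_crm _ _ _ singletonsP _ _ (posterior m) idfun T (size (locations m))
  (tnth l) (fun k => post_dens (mark_count m (tnth l k)) (tnth l k)) post
  (fun k => weight_law (mark_count m (tnth l k)) (tnth l k)) mid mT T_ge0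
  (fun k => measurable_post_density _ _)
  (fun k V => weight_lawE (observable_locations pm (lm k))) nullp
  (posterior_crm pm) f uf.
apply: (etrans E); congr (_ * _); apply: etrans (esym (big_tnth _ _ _ _ _)).
by apply: eq_bigr => k _; apply: ev_weight_law => //; exact: observable_locations.
Qed.

Lemma measurable_possible : measurable [set m | possible m].
Proof.
have mfix : measurable (range p).
  by apply: countable_measurable => //; exact: sub_countable (card_image_le _ _) _.
have mimp : measurable (impossible kappa : set Z).
  apply: measurableC; apply: measurableX => //.
  by apply: bigcup_measurable => n _; exact: measurable_set1.
have mels : measurable (elsewhere p : set Z).
  by apply: measurableX => //; exact: measurableC.
rewrite (_ : [set m | _] = ((fun m => atom_count m (impossible kappa)) @^-1` [set 0%E]) `&`
   ((fun m => atom_count m (elsewhere p)) @^-1` [set e | e < +oo]%E)).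
  apply: measurableI; rewrite -[X in measurable X]setTI.
    by apply: measurable_atom_count => //; exact: emeasurable_set1.
  apply: measurable_atom_count => //.
  rewrite (_ : [set e | _] = ~` [set +oo%E]).
    by apply: measurableC; exact: emeasurable_set1.
  by apply/seteqP; split => e /=; rewrite ltey => /eqP.
by [].
Qed.

(** Locations outside the list carry the mark 0 and contribute the factor 1. *)
Lemma posterior_of_marks d' (Om : measurableType d') (theta : nat -> Om -> R)
    (psi : nat -> Om -> Psi) (x : nat -> Om -> nat) (Theta X : Om -> AM) w f :
  unit_fun f -> marked theta psi x Theta X w -> possible (X w) ->
  (forall k, exists j, psi j w = p k) ->
  \prod_(q <- locations (X w)) mean f (mark_count (X w) q) q =
  iprod (fun j => mean f (x j w) (psi j w)).
Proof.
move=> uf mw pm fixed; have [xm x0] := mass_X singletonsP mw.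
have [[_ psiI] _ _] := mw.
have xE j : mark_count (X w) (psi j w) = x j w by rewrite /mark_count xm natrK.
apply/esym; apply: (@iprod_seq _ _ (fun j => psi j w)).
- exact: psiI.
- exact: uniq_locations.
- move=> q /(mem_locations _ pm)[[k _ <-]|]; first exact: fixed.
  move=> q0; apply: contrapT => nj; move: q0; rewrite x0 ?eqxx// => j.
  by apply/eqP => jq; apply: nj; exists j.
- move=> j; exact: (post_mean01 mT meta mA kappa_ge0 pmfP p fix1 gamma_gt0
    rate_infinite rate_finite uf).
- move=> j jl; rewrite /post_mean ifF//; apply/negbTE; apply: contra jl.
  move=> /andP[/orP[/set_mem qp|xj] _]; apply/(mem_locations _ pm); first by left.
  by right; rewrite xm pnatr_eq0 -lt0n.
- by move=> j _; rewrite xE.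
Qed.

Section measurable_posterior.
Variable f : Z -> R.
Hypothesis uf : unit_fun f.

Let nat_mean (z : Z) : R :=
  if z.1 == (Num.truncn (z.1 : R))%:R then mean f (Num.truncn (z.1 : R)) z.2 else 1.

Let marked_mean (z : Z) : R := if z.2 \in range p then 1 else nat_mean z.

Let mean01 n q : 0 <= mean f n q <= 1.
Proof.
exact: (post_mean01 mT meta mA kappa_ge0 pmfP p fix1 gamma_gt0 rate_infinite rate_finite uf).
Qed.

Let unit_nat_mean : unit_fun nat_mean.
Proof.
split.
  apply: measurable_nat_param => n.
  exact: (measurable_post_mean singletonsP kappa phi mT meta mA p xifix lamfix xi lam uf n).
by move=> z; rewrite /nat_mean; case: ifP => // _; rewrite ler01 lexx.
Qed.

Let unit_marked_mean : unit_fun marked_mean.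
Proof.
have [mn n01] := unit_nat_mean; split.
  apply: measurable_fun_ifT => //.
  apply: (measurable_fun_bool true); rewrite setTI.
  rewrite (_ : _ @^-1` _ = setT `*` range p); last first.
    by apply/seteqP; split => z /=; [move=> /set_mem|move=> [_ /mem_set]].
  apply: measurableX => //.
  by apply: countable_measurable => //; exact: sub_countable (card_image_le _ _) _.
by move=> z; rewrite /marked_mean; case: ifP => // _; rewrite ler01 lexx.
Qed.

Let nat_meanE m q : possible m -> nat_mean (am_mass m q, q) = mean f (mark_count m q) q.
Proof.
by move=> pm; rewrite /nat_mean /= -/(mark_count m q) (mark_countE q pm).1 eqxx.
Qed.

(** The product over the locations of the observation is a functional of its
    atoms, except at the fixed locations, where the mark may be 0. *)
Let posterior_factors m : possible m ->
  \prod_(q <- locations m) mean f (mark_count m q) q =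
  (\prod_k nat_mean (am_mass m (p k), p k)) * pgf marked_mean m.
Proof.
move=> pm; rewrite big_cat big_map big_enum /=; congr (_ * _).
  by apply: eq_bigr => k _; rewrite nat_meanE.
set l := enum_fset _; rewrite (@pgf_fin _ _ _ singletonsP m marked_mean
  [seq (am_mass m q, q) : Z | q <- l])//.
- rewrite big_map; rewrite big_seq [RHS]big_seq; apply: eq_bigr => q ql.
  have [qp _] := (in_marked q pm).1 ql.
  by rewrite /marked_mean /= memNset// nat_meanE.
- by rewrite map_inj_uniq; [exact: fset_uniq|move=> q q' []].
- by move=> z /mapP[q ql ->]; have [_ q0] := (in_marked q pm).1 ql; exact/(atomsP m).
- move=> [y q] /(atomsP m)[y0 my]; rewrite /marked_mean /=.
  case: ifPn => [_|qp _]; first by rewrite eqxx.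
  apply/mapP; exists q; last by rewrite my.
  apply/(in_marked _ pm); split; first by move=> rq; move: qp; rewrite mem_set.
  by rewrite my.
Qed.

(** The list of locations varies with the observation, but the functional of
    the posterior depends on it only through products over atoms. *)
Lemma measurable_posterior : measurable_fun setT (fun m => ev (posterior m) (pgf f)).
Proof.
pose E := expn (\int[post]_z (1 - f z)%:E)%E.
rewrite (_ : (fun m => _) = fun m => if m \in [set m | possible m] then
    (\prod_k nat_mean (am_mass m (p k), p k)) * pgf marked_mean m * E
    else ev base (pgf f)).
  apply: measurable_fun_ifT => //.
    apply: (measurable_fun_bool true); rewrite setTI.
    rewrite (_ : _ @^-1` _ = [set m | possible m]); first exact: measurable_possible.
    by apply/seteqP; split => m /=; [exact: set_mem|exact: mem_set].
  apply: measurable_funM => //; apply: measurable_funM; last first.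
    exact: measurable_pgf.
  have [] // : bmeas (fun m => \prod_k nat_mean (am_mass m (p k), p k)).
  apply: bmeas_prod => k; have [mn n01] := unit_nat_mean; apply: bmeas01 => //.
  apply: (measurableT_comp mn); apply: measurable_fun_pair => //.
  exact: measurable_am_mass.
apply/funext => m; case: ifPn => [/set_mem pm|pm].
  by rewrite -posterior_factors//; exact: pgf_posterior.
rewrite /posterior; case: pselect => // pm'.
by move/negP : pm; case; exact: mem_set.
Qed.

End measurable_posterior.

End posterior_family.

(** * Conjugacy *)

Theorem theorem4p2 (R : realType) (d : measure_display) (Psi : measurableType d)
  (singletonsP : forall p : Psi, measurable [set p])
  (s : nat) (T : set R) (kappa : nat -> R) (eta : R -> 'rV[R]_s)
  (phi : nat -> 'rV[R]_s) (A : R -> R)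
  (mT : measurable T) (T_ge0 : forall t, T t -> 0 <= t)
  (meta : forall i, measurable_fun T (fun t => eta t 0 i))
  (mA : measurable_fun T A)
  (kappa_ge0 : forall x, 0 <= kappa x)
  (pmfP : forall t, T t ->
    (\sum_(x <oo) (likelihood kappa eta phi A x t)%:E = 1)%E)
  (G : probability Psi R) (G_diffuse : forall p : Psi, G [set p] = 0%E)
  (d' : measure_display) (Omega : measurableType d') (P : probability Omega R)
  (theta : nat -> {RV P >-> R}) (psi : nat -> {RV P >-> Psi})
  (x : nat -> {RV P >-> nat})
  (Theta X : {RV P >-> atomic_measure Psi R})
  (theta_range : forall k w, T (theta k w))
  (atomsP : {ae P, forall w,
    (forall k, 0 < theta k w) /\ injective (fun k => psi k w)})
  (ThetaE : {ae P, forall w, forall S : set Psi, measurable S ->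
    Theta w S = sum_of_atoms (fun k => theta k w) (fun k => psi k w) S})
  (XE : {ae P, forall w, forall S : set Psi, measurable S ->
    X w S = sum_of_atoms (fun k => (x k w)%:R) (fun k => psi k w) S})
  (xP : cond_independent_pmf P (likelihood kappa eta phi A) theta psi x) :
  conj_prior T kappa eta phi A G P Theta ->
  exists Q : R.-pker (atomic_measure Psi R) ~> (atomic_measure Psi R),
    posterior_kernel P Theta X Q /\
    {ae distribution P X, forall m,
      conj_prior T kappa eta phi A G (Q m) idfun}.
Proof.
move=> [K [p [xifix [lamfix [gamma [xi [lam [fix1 gamma0 rateoo ratefin crm]]]]]]]].
have mtheta j : measurable_fun setT (theta j) by exact: measurable_funPT.
have mpsi j : measurable_fun setT (psi j) by exact: measurable_funPT.
have mx j : measurable_fun setT (x j) by exact: measurable_funPT.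
have mTheta : measurable_fun setT Theta by exact: measurable_funPT.
have mX : measurable_fun setT X by exact: measurable_funPT.
have marked_ae : {ae P, forall w, marked theta psi x Theta X w}.
  by apply: filterS3 atomsP ThetaE XE => w.
have [good [mgood good_marked good_ae]] : exists good : set Omega,
    [/\ measurable good, good `<=` marked theta psi x Theta X & {ae P, forall w, good w}].
  have [N [mN N0 NP]] := marked_ae; exists (~` N); split; first exact: measurableC.
    by move=> w Nw; apply: contrapT => mw; apply: Nw; exact: NP.
  by exists N; split=> // w /= /contrapT.
have xP' : cond_independent_pmf P (full_likelihood T kappa eta phi A) theta psi x.
  move=> n a E mE; rewrite xP//; apply: eq_integral => w _; congr _%:E.
  by apply: eq_bigr => k _; rewrite full_likelihoodE.
have crm' : crm_with P Theta T p (fun k => conj_density T eta A (xifix k) (lamfix k))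
    (prior_intensity mT meta mA G xi lam gamma0).
  rewrite (_ : _ (prior_intensity _ _ _ _ _ _ _) = conj_rate T eta A G gamma xi lam)//.
  by apply/funext => C; exact: rate_measureE.
have pI : injective p by case: crm.
pose base := base_law singletonsP P mtheta mpsi mx mgood good_marked.
have bpois := base_poisson singletonsP T_ge0 kappa_ge0 pmfP G_diffuse fix1
  mtheta mpsi mx mTheta xP' mgood good_marked good_ae crm'.
pose Q := posterior singletonsP mT meta mA kappa_ge0 pmfP p fix1 gamma0 rateoo ratefin base.
have aefix := ae_fixed_location singletonsP T_ge0 G_diffuse fix1 mTheta
  good_marked good_ae crm'.
have aeposs := ae_possible singletonsP mT meta mA kappa_ge0 pmfP mtheta mpsi mx mTheta
  mX xP' good_marked good_ae.
have aefin := ae_finite singletonsP T_ge0 kappa_ge0 pmfP G_diffuse fix1 ratefin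
  mtheta mpsi mx mTheta mX xP' good_marked good_ae crm'.
have possible_ae : {ae P, forall w, possible kappa p (X w)}.
  by apply: filterS2 aeposs aefin => w.
have mQ f : unit_fun f -> measurable_fun setT (fun m => ev (Q m) (pgf singletonsP f)).
  move=> uf; exact: (measurable_posterior T_ge0 pmfP G_diffuse pI fix1 rateoo ratefin
    bpois uf).
have rule f g : unit_fun f -> unit_fun g ->
    bayes_rule P Theta X Q (pgf singletonsP f) (pgf singletonsP g).
  move=> uf ug.
  have E := joint_pgf_bayes singletonsP T_ge0 kappa_ge0 pmfP G_diffuse fix1 rateoo ratefin
    mtheta mpsi mx mTheta mX xP' good_marked good_ae crm' uf ug.
  have ub a := unit_bayes_fun singletonsP mT meta mA kappa_ge0 pmfP p fix1 gamma0
    rateoo ratefin uf ug a.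
  have [mb bb] := bmeas_marks mtheta mpsi mx ub.
  apply: (etrans E); rewrite mulrC -evZ//; apply: ev_ae.
  - exact: measurable_funM.
  - apply: measurable_funM; first exact: (measurableT_comp (mQ f uf) mX).
    exact: (measurableT_comp (measurable_pgf singletonsP ug) mX).
  apply: filterS3 good_ae possible_ae aefix => w gw pw fw.
  have mw := good_marked w gw.
  have Ef := pgf_posterior T_ge0 pmfP G_diffuse pI fix1 rateoo ratefin bpois pw uf.
  have Em := posterior_of_marks singletonsP mT meta mA kappa_ge0 pmfP pI fix1 gamma0
    rateoo ratefin uf mw pw fw.
  have Eg := pgf_X singletonsP ug mw.
  have mean01 j := post_mean01 mT meta mA kappa_ge0 pmfP p fix1 gamma0 rateoo ratefin uf
    (x j w) (psi j w).
  have Eb := iprodM (fun j => mark_fun01 (x j w) (psi j w) ug) mean01.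
  apply: (etrans (congr1 (fun y => _ * y) Eb)).
  apply: esym; apply: (etrans (congr1 (fun y => y * _) Ef)).
  apply: (etrans (congr1 (fun y => y * _ * _) Em)).
  apply: (etrans (congr1 (fun y => _ * y) Eg)).
  by rewrite mulrAC [in LHS]mulrC [_ * iprod _]mulrC.
have [||D mD|D mD|f [g ug ->]|f g [f' uf ->] [g' ug ->]|Qk [postQ QkE]] :=
  @exists_posterior _ _ _ P _ _ _ _ Theta X mTheta mX
    (pgfs singletonsP) (pgfs singletonsP) _ _ _ _ Q _ _.
- by move=> _ [f uf ->]; exact: bmeas_pgf.
- by move=> _ [f uf ->]; exact: bmeas_pgf.
- exact: bspan_pgfs.
- exact: bspan_pgfs.
- exact: mQ.
- exact: rule.
exists Qk; split=> //.
have mposs := measurable_possible singletonsP kappa p.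
have conjQ m : possible kappa p m -> conj_prior T kappa eta phi A G (Qk m) idfun.
  move=> pm; rewrite QkE.
  exact: (posterior_conj T_ge0 pmfP pI fix1 rateoo ratefin bpois pm).
have [N [mN N0 NP]] := possible_ae.
exists (~` [set m | possible kappa p m]); split; first exact: measurableC.
  apply: (@subset_measure0 _ _ _ P _ N) => //.
    by rewrite -[X in measurable X]setTI; apply: mX => //; exact: measurableC.
by move=> m /= + pm; apply; exact: conjQ.
Qed.
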